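(* Let $R$ be an admissible ring with canonical ideal $\mathcal{K}$. Then (a) $\Gamma_{\mathcal{K}:\mathcal{F}}=\Gamma_{\mathcal{K}}-\Gamma_{\mathcal{F}}$ for any $\mathcal{F}\in\mathfrak{R}_R$, and (b) $d\big((\Gamma_{\mathcal{K}}-\Gamma_{\mathcal{E}})\backslash(\Gamma_{\mathcal{K}}-\Gamma_{\mathcal{F}})\big)=d(\Gamma_{\mathcal{F}}\backslash\Gamma_{\mathcal{E}})$ for any $\mathcal{E},\mathcal{F}\in\mathfrak{R}_R$ with $\mathcal{E}\subseteq\mathcal{F}$.
   Context: Rings: all rings are commutative and unitary. A one-dimensional Noetherian ring $R$ is Cohen–Macaulay if $\operatorname{depth}(R_{\mathfrak m})=1$ for all maximal ideals $\mathfrak m$. $Q_R$ is the total ring of fractions of $R$, $Q_R^{\mathrm{reg}}$ the set of its regular elements, $T^{\mathrm{reg}}:=T\cap Q_R^{\mathrm{reg}}$ for $T\subseteq Q_R$, and $\overline{R}$ the integral closure of $R$ in $Q_R$. A fractional ideal of $R$ is an $R$-submodule $\mathcal{E}\subseteq Q_R$ with $r\mathcal{E}\subseteq R$ for some $r\in R^{\mathrm{reg}}$; it is regular if $\mathcal{E}^{\mathrm{reg}}\ne\emptyset$. $\mathfrak{R}_R$ is the set of regular fractional ideals. For $\mathcal{E},\mathcal{F}\subseteq Q_R$, $\mathcal{F}:\mathcal{E}:=\{x\in Q_R\mid x\mathcal{E}\subseteq\mathcal{F}\}$. A canonical ideal of a one-dimensional Cohen–Macaulay ring $R$ is a $\mathcal{K}\in\mathfrak{R}_R$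 with $\mathcal{E}=\mathcal{K}:(\mathcal{K}:\mathcal{E})$ for all $\mathcal{E}\in\mathfrak{R}_R$. Values: let $R$ be a one-dimensional semilocal Cohen–Macaulay ring. $\mathfrak{V}_R$ is the set of valuation rings of $Q_R$ over $R$, i.e. subrings $V$ with $R\subseteq V\subsetneq Q_R$ such that $Q_R\setminus V$ is multiplicatively closed. This set is finite and nonempty; each $V\in\mathfrak{V}_R$ is a discrete valuation ring in the sense that it has a unique regular maximal ideal $\mathfrak{m}_V$, which is invertible and is the only regular prime ideal of $V$. The associated discrete valuation $\nu_V\colon Q_R\to\mathbb{Z}\cup\{\infty\}$ is $\nu_V(x)=\max\{k\in\mathbb{Z}\mid x\in\mathfrak{m}_V^k\}$, with $\nu_V(x)=\infty$ if $x\in\bigcap_k\mathfrak{m}_V^k$. Set $\nu=(\nu_V)_{V\in\mathfrak{V}_R}$ and, for $\mathcal{E}\in\mathfrak{R}_R$, $\Gamma_{\mathcal{E}}:=\nu(\mathcal{E}^{\mathrm{reg}})\subseteq\mathbb{Z}^{\mathfrak{V}_R}$. $R$ is admissible if it is a one-dimensional semilocal Cohen–Macaulay ring that is analytically reduced (its completion $\widehat{R}$ at the Jacobson radical is reduced), residually rational ($\overline{R}/\mathfrak{n}=R/(\mathfrak{n}\cap R)$ for all maximal ideals $\mathfrak{n}$ of $\overline{R}$) and has large residue fields ($|R/\mathfrak{m}|\ge|\mathfrak{V}_{R_{\mathfrak{m}}}|$ for all maximal ideals $\mathfrak{m}$ of $R$). For admissible $R$, $\Gamma_R$ is a good semigroup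 with $D_{\Gamma_R}=\mathbb{Z}^{\mathfrak{V}_R}$, $\overline{\Gamma_R}=\mathbb{N}^{\mathfrak{V}_R}$, and $\Gamma_{\mathcal{E}}\in\mathfrak{G}_{\Gamma_R}$ for all $\mathcal{E}\in\mathfrak{R}_R$, in the following terminology. Semigroups: $\mathbb{N}=\{0,1,2,\dots\}$. For a finite set $I$, $\mathbb{Z}^I$ carries the componentwise partial order and minimum; $\alpha<\beta$ means $\alpha\le\beta$, $\alpha\ne\beta$. For $E\subseteq\mathbb{Z}^I$ consider: (E0) there is $\alpha\in\mathbb{Z}^I$ with $\alpha+\mathbb{N}^I\subseteq E$; (E1) $\alpha,\beta\in E$ implies $\min\{\alpha,\beta\}\in E$; (E2) for $\alpha,\beta\in E$ and $j\in I$ with $\alpha_j=\beta_j$ there is $\varepsilon\in E$ with $\varepsilon_j>\alpha_j$ and $\varepsilon_i\ge\min\{\alpha_i,\beta_i\}$ for all $i\neq j$, with equality if $\alpha_i\ne\beta_i$. For $E,F\subseteq\mathbb{Z}^I$, $E-F:=\{\alpha\in\mathbb{Z}^I\mid\alpha+F\subseteq E\}$. A good semigroup is (up to isomorphism) a submonoid $S\subseteq\overline{S}:=\mathbb{N}^I$ with group of differences $D_S=\mathbb{Z}^I$ satisfying (E0), (E1), (E2). A semigroup ideal of $S$ is a nonempty $E\subseteq D_S$ with $E+S\subseteq E$ and $\alpha+E\subseteq S$ for some $\alpha\in S$; it is good if it satisfies (E1) and (E2); $\mathfrak{G}_S$ is the set of good semigroup ideals. For $E$ satisfying (E1), $\mu^E:=\min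 E$ and $\gamma^E:=\min(E-\overline{S})$. Distance: a chain $\alpha=\alpha^{(0)}<\dots<\alpha^{(n)}=\beta$ in $E$ is saturated of length $n$ if no element of $E$ lies strictly between $\alpha^{(i)}$ and $\alpha^{(i+1)}$ for any $i$. In a good semigroup ideal $E$ any two saturated chains with the same endpoints $\alpha\le\beta$ in $E$ have the same length, denoted $d_E(\alpha,\beta)$. For good semigroup ideals $E\subseteq F$ of $S$, the distance is $d(F\backslash E):=d_F(\mu^F,\gamma^E)-d_E(\mu^E,\gamma^E)$. (All sets to which $d$ is applied in the claim are good semigroup ideals of $\Gamma_R$.) *)

(* Defs.v *)
From HB Require Import structures.
From mathcomp Require Import all_boot all_order all_algebra.
From mathcomp Require Import boolp classical_sets functions cardinality.
From mathcomp Require Import constructive_ereal ring.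

Set Implicit Arguments.
Unset Strict Implicit.
Unset Printing Implicit Defensive.

Import Order.TTheory GRing.Theory Num.Theory.
Local Open Scope classical_set_scope.
Local Open Scope quotient_scope.
Local Open Scope ring_scope.

Section Ideals.
Variable T : comNzRingType.
Implicit Types (A I J : set T) (s : seq T) (p : nat -> set T).

(* Throughout, A is a subring of the ambient ring T, and ideals of A are       *)
(* subsets of T; the ideals of T itself are the case A = setT.                 *)
Definition ideal A I :=
  [/\ I `<=` A, I 0, (forall x y, I x -> I y -> I (x + y)) &
      (forall a x, A a -> I x -> I (a * x))].

Definition prime_ideal A I :=
  [/\ ideal A I, I <> A &
      forall x y, A x -> A y -> I (x * y) -> I x \/ I y].

Definition maximal_ideal A I :=
  [/\ ideal A I, I <> A &
      forall J, ideal A J -> I `<=` J -> J = I \/ J = A].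

Definition ideal_prod I J : set T :=
  [set x | exists2 s : seq (T * T),
     (forall q, q \in s -> I q.1 /\ J q.2) & x = \sum_(q <- s) q.1 * q.2].

Fixpoint ideal_pow A I n : set T :=
  if n is n'.+1 then ideal_prod I (ideal_pow A I n') else A.

Definition ideal_gen (X : set T) : set T := ideal_prod setT X.

Definition colon (F E : set T) : set T := [set x | forall e, E e -> F (x * e)].

(* Integer powers: I^(-n) is the inverse A : I^n of an invertible ideal I.     *)
Definition ideal_zpow A I (k : int) : set T :=
  match k with
  | Posz n => ideal_pow A I n
  | Negz n => colon A (ideal_pow A I n.+1)
  end.

Definition regular_part A : set T := A `&` [set x | GRing.lreg x].

Definition jacobson : set T :=
  [set x | forall m, maximal_ideal setT m -> m x].

Definition noetherian :=
  forall I, ideal setT I -> exists s, I = ideal_gen [set` s].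

Definition prime_chain n p :=
  (forall i, (i <= n)%N -> prime_ideal setT (p i)) /\
  (forall i, (i < n)%N -> p i `<` p i.+1).

Definition krull_dim n :=
  (exists p, prime_chain n p) /\ ~ (exists p, prime_chain n.+1 p).

Definition semilocal := finite_set [set m | maximal_ideal setT m].

Definition regular_sequence s :=
  (forall i y, (i < size s)%N ->
     ideal_gen [set` take i s] (s`_i * y) -> ideal_gen [set` take i s] y) /\
  ideal_gen [set` s] <> setT.

(* Depth of a local ring T, whose maximal ideal is its Jacobson radical.       *)
Definition local_depth n :=
  (exists s, [/\ size s = n, [set` s] `<=` jacobson & regular_sequence s]) /\
  (forall s, [set` s] `<=` jacobson -> regular_sequence s -> (size s <= n)%N).

Definition reduced := forall (x : T) n, x ^+ n = 0 -> x = 0.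

End Ideals.

Arguments jacobson T : clear implicits.
Arguments noetherian T : clear implicits.
Arguments krull_dim T n : clear implicits.
Arguments semilocal T : clear implicits.
Arguments local_depth T n : clear implicits.
Arguments reduced T : clear implicits.

Section Spectrum.
Variable R : comNzRingType.

Record spec := Spec {
  spec_set :> set R;
  spec_prime : prime_ideal setT spec_set }.

Definition spec_pred (p : spec) : R -> bool := fun x => x \in spec_set p.

Lemma ideal_proper (I : set R) : ideal setT I -> I <> setT -> ~ I 1.
Proof.
move=> [_ _ _ IM] IT I1; apply: IT; rewrite -subTset => x _.
by rewrite -[x]mulr1; apply: IM.
Qed.

Lemma ideal_idealr_closed (I : set R) :
  ideal setT I -> ~ I 1 -> idealr_closed (fun x => x \in I).
Proof.
move=> [_ I0 ID IM] I1; split; rewrite ?unfold_in /=.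
- exact/mem_set.
- by apply/negP => /set_mem.
- move=> a x y /set_mem Ix /set_mem Iy; apply/mem_set.
  by apply: ID => //; apply: IM.
Qed.

Lemma spec_idealr_closed p : idealr_closed (spec_pred p).
Proof.
have [pI pT _] := spec_prime p.
by apply: ideal_idealr_closed => //; apply: ideal_proper.
Qed.

HB.instance Definition _ p :=
  isIdealr.Build R (spec_pred p) (spec_idealr_closed p).

Lemma spec_prime_idealr_closed p : prime_idealr_closed (spec_pred p).
Proof.
have [_ _ pM] := spec_prime p.
move=> x y /set_mem/(pM _ _ I I) [px|py]; apply/orP; [left|right];
  exact/mem_set.
Qed.

HB.instance Definition _ p :=
  isPrimeIdealrClosed.Build R (spec_pred p) (@spec_prime_idealr_closed p).

End Spectrum.

Section Localization.
Variable R : comNzRingType.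

(* Excluding 0 keeps the localization nontrivial, hence a comNzRingType.        *)
Record mulset := Mulset {
  mulset_set :> set R;
  mulset1 : mulset_set 1;
  mulsetM : forall x y, mulset_set x -> mulset_set y -> mulset_set (x * y);
  mulset0 : ~ mulset_set 0 }.

Variable S : mulset.

Record den := Den { den_val : R; denP : `[< mulset_set S den_val >] }.
HB.instance Definition _ := [isSub for den_val].
HB.instance Definition _ := [Choice of den by <:].

Local Notation ratios := (R * den)%type.

Definition den_one : den := Den (asboolT (mulset1 S)).
Definition den_mul (s t : den) : den :=
  Den (asboolT (mulsetM (asboolW (denP s)) (asboolW (denP t)))).

Implicit Types x y z : ratios.

Definition ratio_eq x y : bool :=
  `[< exists2 u, mulset_set S u &
        u * (x.1 * den_val y.2 - y.1 * den_val x.2) = 0 >].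

Lemma ratio_eq_refl : reflexive ratio_eq.
Proof.
by move=> x; apply/asboolP; exists 1; [exact: mulset1|rewrite subrr mulr0].
Qed.

Lemma ratio_eq_sym : symmetric ratio_eq.
Proof.
move=> x y; apply/asboolP/asboolP => -[u Su e]; exists u => //;
  by rewrite -opprB mulrN e oppr0.
Qed.

Lemma ratio_eq_trans : transitive ratio_eq.
Proof.
move=> y x z /asboolP[u Su eu] /asboolP[v Sv ev]; apply/asboolP.
exists (den_val y.2 * (u * v)).
  by do !apply: mulsetM => //; exact: asboolW (denP y.2).
transitivity (v * den_val z.2 * (u * (x.1 * den_val y.2 - y.1 * den_val x.2)) +
   u * den_val x.2 * (v * (y.1 * den_val z.2 - z.1 * den_val y.2))).
  by ring.
by rewrite eu ev !mulr0 addr0.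
Qed.

Canonical ratio_equiv :=
  EquivRel ratio_eq ratio_eq_refl ratio_eq_sym ratio_eq_trans.

Definition loc : Type := {eq_quot ratio_eq}.
HB.instance Definition _ := Choice.on loc.

Definition mkfrac (a : R) (s : den) : loc := \pi_loc (a, s).

Lemma frac_eqP a s b t :
  mkfrac a s = mkfrac b t <->
  exists2 u, mulset_set S u & u * (a * den_val t - b * den_val s) = 0.
Proof.
split=> [/eqP|H]; first by rewrite eqmodE => /asboolP.
by apply/eqP; rewrite eqmodE; apply/asboolP.
Qed.

Lemma fracP (x : loc) : exists a s, x = mkfrac a s.
Proof. by elim/quotW: x => -[a s]; exists a, s. Qed.

Lemma repr_frac a s : exists2 u, mulset_set S u &
  u * ((repr (mkfrac a s)).1 * den_val s - a * den_val (repr (mkfrac a s)).2) = 0.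
Proof.
apply/frac_eqP; rewrite /mkfrac -surjective_pairing; exact: reprK.
Qed.

Definition loc_add (x y : loc) : loc :=
  mkfrac ((repr x).1 * den_val (repr y).2 + (repr y).1 * den_val (repr x).2)
    (den_mul (repr x).2 (repr y).2).

Definition loc_opp (x : loc) : loc := mkfrac (- (repr x).1) (repr x).2.

Definition loc_mul (x y : loc) : loc :=
  mkfrac ((repr x).1 * (repr y).1) (den_mul (repr x).2 (repr y).2).

Lemma frac_add a s b t :
  loc_add (mkfrac a s) (mkfrac b t) = mkfrac (a * den_val t + b * den_val s) (den_mul s t).
Proof.
apply/frac_eqP => /=; have [u Su eu] := repr_frac a s.
have [v Sv ev] := repr_frac b t; exists (u * v); first exact: mulsetM.
set x := repr (mkfrac a s) in eu *; set y := repr (mkfrac b t) in ev *.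
transitivity (v * den_val y.2 * den_val t * (u * (x.1 * den_val s - a * den_val x.2)) +
  u * den_val x.2 * den_val s * (v * (y.1 * den_val t - b * den_val y.2))); first by ring.
by rewrite eu ev !mulr0 addr0.
Qed.

Lemma frac_opp a s : loc_opp (mkfrac a s) = mkfrac (- a) s.
Proof.
apply/frac_eqP => /=; have [u Su eu] := repr_frac a s; exists u => //.
by rewrite !mulNr -opprD mulrN eu oppr0.
Qed.

Lemma frac_mul a s b t :
  loc_mul (mkfrac a s) (mkfrac b t) = mkfrac (a * b) (den_mul s t).
Proof.
apply/frac_eqP => /=; have [u Su eu] := repr_frac a s.
have [v Sv ev] := repr_frac b t; exists (u * v); first exact: mulsetM.
set x := repr (mkfrac a s) in eu *; set y := repr (mkfrac b t) in ev *.
transitivity (v * y.1 * den_val t * (u * (x.1 * den_val s - a * den_val x.2)) +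
  u * a * den_val x.2 * (v * (y.1 * den_val t - b * den_val y.2))); first by ring.
by rewrite eu ev !mulr0 addr0.
Qed.

Lemma frac_congr a s b t : a * den_val t = b * den_val s -> mkfrac a s = mkfrac b t.
Proof.
move=> e; apply/frac_eqP; exists 1; first exact: mulset1.
by rewrite e subrr mulr0.
Qed.

Lemma loc_addA : associative loc_add.
Proof.
move=> x y z; have [a [s ->]] := fracP x; have [b [t ->]] := fracP y.
have [c [u ->]] := fracP z; rewrite !frac_add; apply: frac_congr => /=; ring.
Qed.

Lemma loc_addC : commutative loc_add.
Proof.
move=> x y; have [a [s ->]] := fracP x; have [b [t ->]] := fracP y.
rewrite !frac_add; apply: frac_congr => /=; ring.
Qed.

Lemma loc_add0 : left_id (mkfrac 0 den_one) loc_add.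
Proof.
move=> x; have [a [s ->]] := fracP x.
rewrite frac_add; apply: frac_congr => /=; ring.
Qed.

Lemma loc_addN : left_inverse (mkfrac 0 den_one) loc_opp loc_add.
Proof.
move=> x; have [a [s ->]] := fracP x.
rewrite frac_opp frac_add; apply: frac_congr => /=; ring.
Qed.

HB.instance Definition _ :=
  GRing.isZmodule.Build loc loc_addA loc_addC loc_add0 loc_addN.

Lemma loc_mulA : associative loc_mul.
Proof.
move=> x y z; have [a [s ->]] := fracP x; have [b [t ->]] := fracP y.
have [c [u ->]] := fracP z; rewrite !frac_mul; apply: frac_congr => /=; ring.
Qed.

Lemma loc_mulC : commutative loc_mul.
Proof.
move=> x y; have [a [s ->]] := fracP x; have [b [t ->]] := fracP y.
rewrite !frac_mul; apply: frac_congr => /=; ring.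
Qed.

Lemma loc_mul1 : left_id (mkfrac 1 den_one) loc_mul.
Proof.
move=> x; have [a [s ->]] := fracP x.
rewrite frac_mul; apply: frac_congr => /=; ring.
Qed.

Lemma loc_mulDl : left_distributive loc_mul loc_add.
Proof.
move=> x y z; have [a [s ->]] := fracP x; have [b [t ->]] := fracP y.
have [c [u ->]] := fracP z.
rewrite !(frac_mul, frac_add); apply: frac_congr => /=; ring.
Qed.

Lemma loc_1neq0 : mkfrac 1 den_one != 0.
Proof.
apply/eqP => /frac_eqP /= [u Su]; rewrite !mulr1 subr0 mulr1 => u0.
by apply: (@mulset0 S); rewrite -u0.
Qed.

HB.instance Definition _ := GRing.Zmodule_isComNzRing.Build loc
  loc_mulA loc_mulC loc_mul1 loc_mulDl loc_1neq0.

Definition to_loc (a : R) : loc := mkfrac a den_one.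

Lemma to_loc_is_zmod_morphism : zmod_morphism to_loc.
Proof.
move=> a b; rewrite /to_loc -[RHS]/(loc_add _ (loc_opp _)) frac_opp frac_add.
apply: frac_congr => /=; ring.
Qed.

Lemma to_loc_is_monoid_morphism : monoid_morphism to_loc.
Proof.
split=> // a b; rewrite /to_loc -[RHS]/(loc_mul _ _) frac_mul.
apply: frac_congr => /=; ring.
Qed.

HB.instance Definition _ :=
  GRing.isZmodMorphism.Build R loc to_loc to_loc_is_zmod_morphism.
HB.instance Definition _ :=
  GRing.isMonoidMorphism.Build R loc to_loc to_loc_is_monoid_morphism.

End Localization.

Section LocalizationAtPrime.
Variables (R : comNzRingType) (p : spec R).

Lemma prime_compl1 : (~` (p : set R)) 1.
Proof. by case: p => /= q [qI qT _]; apply: ideal_proper. Qed.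

Lemma prime_complM x y :
  (~` (p : set R)) x -> (~` (p : set R)) y -> (~` (p : set R)) (x * y).
Proof. by case: p => /= q [_ _ qM] qx qy /(qM _ _ I I) []. Qed.

Lemma prime_compl0 : ~ (~` (p : set R)) 0.
Proof. by case: p => /= q [[_ q0 _ _] _ _]; apply. Qed.

Definition prime_compl := Mulset prime_compl1 prime_complM prime_compl0.

Definition loc_at : Type := loc prime_compl.
HB.instance Definition _ := GRing.ComNzRing.on loc_at.

End LocalizationAtPrime.

Section TotalRingOfFractions.
Variable R : comNzRingType.

Lemma lreg_neq0 : ~ GRing.lreg (0 : R).
Proof.
by move=> /(_ 1 0); rewrite !mul0r => /(_ erefl)/eqP; rewrite oner_eq0.
Qed.

Definition regular_mulset : mulset R :=
  @Mulset R [set x | GRing.lreg x] (@lreg1 R) (@lregM R) lreg_neq0.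

Definition total_frac : Type := loc regular_mulset.
HB.instance Definition _ := GRing.ComNzRing.on total_frac.

Definition to_total : R -> total_frac := @to_loc R regular_mulset.
HB.instance Definition _ := GRing.RMorphism.on to_total.

Lemma to_total_inj : injective to_total.
Proof.
move=> a b /frac_eqP [u /= Su]; rewrite !mulr1 => e.
by apply/eqP; rewrite -subr_eq0; apply/eqP/Su; rewrite e mulr0.
Qed.

Definition image_ring : set total_frac := range to_total.

Definition integral_closure : set total_frac :=
  [set x | integralOver to_total x].

Definition valuation_rings : set (set total_frac) :=
  [set V : set total_frac |
    [/\ GRing.subring_closed [in V], image_ring `<=` V, V <> setT &
        forall x y, ~ V x -> ~ V y -> ~ V (x * y)]].

Definition submodule (E : set total_frac) :=
  [/\ E 0, (forall x y, E x -> E y -> E (x + y)) &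
      (forall r x, E x -> E (to_total r * x))].

Definition fractional_ideal (E : set total_frac) :=
  submodule E /\
  exists2 r, regular_part image_ring r & forall x, E x -> image_ring (r * x).

Definition regular_fractional_ideal (E : set total_frac) :=
  fractional_ideal E /\ regular_part E !=set0.

End TotalRingOfFractions.

Arguments valuation_rings R : clear implicits.
Arguments image_ring R : clear implicits.
Arguments integral_closure R : clear implicits.

Section Completion.
Variable R : comNzRingType.

Record pideal := Pideal {
  pideal_set :> set R;
  pidealP : ideal setT pideal_set;
  pideal1 : ~ pideal_set 1 }.

Variable J : pideal.
Local Notation Jn n := (ideal_pow setT J n).

Lemma ideal_prod_ideal (I K : set R) :
  ideal setT I -> ideal setT K -> ideal setT (ideal_prod I K).
Proof.
move=> [_ I0 ID IM] [_ K0 KD KM]; split=> //.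
- by exists [::] => //; rewrite big_nil.
- move=> x y [s sP ->] [t tP ->]; exists (s ++ t); last by rewrite big_cat.
  by move=> q; rewrite mem_cat => /orP[/sP|/tP].
- move=> a x _ [s sP ->]; exists [seq (a * q.1, q.2) | q <- s].
    by move=> _ /mapP[q /sP[Iq Kq] ->]; split => //; apply: IM.
  by rewrite big_map mulr_sumr; apply: eq_bigr => q _; rewrite mulrA.
Qed.

Lemma ideal_pow_ideal n : ideal setT (Jn n).
Proof.
by elim: n => [//|n IHn] /=; apply: ideal_prod_ideal => //; exact: pidealP.
Qed.

Lemma ideal_pow1_proper : ~ Jn 1%N 1.
Proof.
move=> [s sP e]; apply: (@pideal1 J); rewrite e.
case: (pidealP J) => _ J0 JD JM.
rewrite big_seq; elim/big_ind: _ => // q /sP[Jq _].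
by rewrite mulrC; apply: JM.
Qed.

Lemma idealN (I : set R) x : ideal setT I -> I x -> I (- x).
Proof. by move=> [_ _ _ IM] Ix; rewrite -mulN1r; apply: IM. Qed.

(* The completion is the inverse limit of the rings R / J^n.  A compatible     *)
(* family of residue classes is given by representatives f n with              *)
(* f (n + 1) = f n modulo J^n, and two such sequences give the same family     *)
(* when f n = g n modulo J^n for every n.                                      *)
Definition coherent : pred (nat -> R) :=
  fun f => `[< forall n, Jn n (f n.+1 - f n) >].

Lemma coherent_subring_closed : GRing.subring_closed coherent.
Proof.
split=> [|f g /asboolP cf /asboolP cg|f g /asboolP cf /asboolP cg];
  apply/asboolP => n; have [_ I0 ID IM] := ideal_pow_ideal n.
- by rewrite subrr.
- rewrite [X in Jn n X](_ : _ = (f n.+1 - f n) + - (g n.+1 - g n)).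
    by apply: ID => //; apply: idealN => //; apply: ideal_pow_ideal.
  by rewrite !fctE; ring.
- rewrite [X in Jn n X](_ : _ = f n.+1 * (g n.+1 - g n) + g n * (f n.+1 - f n)).
    by apply: ID; apply: IM.
  by rewrite !fctE; ring.
Qed.

Record coherent_seq := CoherentSeq {
  coherent_val :> nat -> R;
  coherentP : coherent coherent_val }.

HB.instance Definition _ := [isSub for coherent_val].
HB.instance Definition _ := [Choice of coherent_seq by <:].
HB.instance Definition _ :=
  GRing.SubChoice_isSubComNzRing.Build (nat -> R) coherent coherent_seq
    coherent_subring_closed.

Definition null_seq : coherent_seq -> bool :=
  fun f => `[< forall n, Jn n (coherent_val f n) >].

Lemma null_seq_idealr_closed : idealr_closed null_seq.
Proof.
split.
- by apply/asboolP => n; have [_ ? _ _] := ideal_pow_ideal n.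
- by apply/negP => /asboolP /(_ 1%N); exact: ideal_pow1_proper.
- move=> a f g /asboolP nf /asboolP ng; apply/asboolP => n.
  by have [_ _ ID IM] := ideal_pow_ideal n; apply: ID => //; apply: IM.
Qed.

HB.instance Definition _ :=
  isIdealr.Build coherent_seq null_seq null_seq_idealr_closed.

Definition completion : Type := {ideal_quot (null_seq : idealr coherent_seq)}.
HB.instance Definition _ := GRing.ComNzRing.on completion.

End Completion.

Section Jacobson.
Variable R : comNzRingType.

Lemma exists_maximal_ideal : exists m : set R, maximal_ideal setT m.
Proof.
pose P (X : set R) := [/\ ~ X 1, (forall x y, X x -> X y -> X (x + y)) &
  forall a x, X x -> X (a * x)].
have P0 : P [set 0].
  split=> [/eqP|x y -> ->|a x ->]; rewrite ?oner_eq0 //.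
    by rewrite addr0.
  by rewrite mulr0.
have [F FP Ftot|m [[m1 mD mM] mmax]] := @Zorn_bigcup R P.
  split=> [[X FX X1]|x y [X FX Xx] [Y FY Yy]|a x [X FX Xx]].
  - by have [] := FP _ FX.
  - have [XY|YX] := Ftot _ _ FX FY.
      by exists Y => //; have [_ YD _] := FP _ FY; apply: YD => //; apply: XY.
    by exists X => //; have [_ XD _] := FP _ FX; apply: XD => //; apply: YX.
  - by exists X => //; have [_ _ XM] := FP _ FX; apply: XM.
have m0 : m 0.
  apply: contrapT => nm0; apply: (mmax [set 0]) => //; split.
    by move=> x mx; case: nm0; rewrite -(mul0r x); apply: mM.
  by move=> /(_ 0 erefl).
exists m; split=> [||J JI mJ]; first by split=> // a x _; apply: mM.
  by move=> mT; apply: m1; rewrite mT.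
have [JT|JT] := pselect (J = setT); first by right.
left; apply: contrapT => nJm; apply: (mmax J).
  split=> // Jm; exact/nJm/seteqP.
have J1 := ideal_proper JI JT; case: JI => _ _ JD JM; split=> // a x.
exact: JM.
Qed.

Lemma jacobson_ideal_subproof : ideal setT (jacobson R).
Proof.
split=> // [m [[]]//|x y Jx Jy m mm|a x _ Jx m mm];
  have [[_ _ mD mM] _ _] := mm; first by apply: mD; [apply: Jx|apply: Jy].
by apply: mM => //; apply: Jx.
Qed.

Lemma jacobson_proper_subproof : ~ jacobson R 1.
Proof.
have [m mm] := exists_maximal_ideal => /(_ m mm).
by have [mI mT _] := mm; apply: ideal_proper.
Qed.

Definition jacobson_ideal : pideal R :=
  Pideal jacobson_ideal_subproof jacobson_proper_subproof.

End Jacobson.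

Arguments jacobson_ideal R : clear implicits.

Section Admissible.
Variable R : comNzRingType.

Definition one_dim_cohen_macaulay :=
  [/\ noetherian R, krull_dim R 1 &
      forall m : spec R, maximal_ideal setT (m : set R) ->
        local_depth (loc_at m) 1].

Definition analytically_reduced := reduced (completion (jacobson_ideal R)).

(* The inclusion of R / (n :&: R) into Rbar / n is onto.                       *)
Definition residually_rational :=
  forall n : set (total_frac R), maximal_ideal (integral_closure R) n ->
  forall x, integral_closure R x -> exists r : R, n (x - to_total r).

Definition large_residue_fields :=
  forall m : spec R, maximal_ideal setT (m : set R) ->
    (valuation_rings (loc_at m) #<=
       [set: {ideal_quot (spec_pred m : idealr R)}])%card.

Definition admissible :=
  [/\ one_dim_cohen_macaulay, semilocal R, analytically_reduced,
      residually_rational & large_residue_fields].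

Definition canonical_ideal (K : set (total_frac R)) :=
  regular_fractional_ideal K /\
  forall E, regular_fractional_ideal E -> E = colon K (colon K E).

End Admissible.

Section Extrema.
Context {d : Order.disp_t} {T : porderType d}.

(* The greatest (least) element of A, and x0 when there is none.               *)
Definition greatest_of (x0 : T) (A : set T) : T := xget x0 (A `&` ubound A).
Definition least_of (x0 : T) (A : set T) : T := xget x0 (A `&` lbound A).

End Extrema.

Section Values.
Variable R : comNzRingType.

(* regular_maximal_ideal V is the regular maximal ideal m_V of V, which is      *)
(* unique when V is a valuation ring as above; likewise the maximum defining   *)
(* valuation V x is attained whenever x lies outside some power of m_V.        *)
Definition regular_maximal_ideal (V : set (total_frac R)) : set (total_frac R) :=
  xget set0 [set M | maximal_ideal V M /\ regular_part M !=set0].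

Definition valuation (V : set (total_frac R)) (x : total_frac R) : \bar int :=
  let mpow := ideal_zpow V (regular_maximal_ideal V) in
  if pselect (forall k, mpow k x) then +oo%E
  else (greatest_of 0 [set k | mpow k x])%:E%E.

Definition value_set (E : set (total_frac R)) :
    set (set_type (valuation_rings R) -> int) :=
  [set alpha | exists2 x, regular_part E x &
     forall V, valuation (set_val V) x = (alpha V)%:E%E].

End Values.

(* Subsets of Z^I, with the componentwise addition and order on I -> int.      *)
Section ValueSemigroups.
Variable I : Type.
Implicit Types (E F : set (I -> int)) (alpha beta : I -> int).

Definition vcolon E F : set (I -> int) :=
  [set alpha | forall beta, F beta -> E (alpha + beta)].

Definition natural_cone : set (I -> int) :=
  [set alpha | forall i, 0 <= alpha i].

Definition mu_of E : I -> int := least_of (fun=> 0) E.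
Definition gamma_of E : I -> int :=
  least_of (fun=> 0) (vcolon E natural_cone).

Definition saturated_chain E alpha beta n (c : nat -> I -> int) :=
  [/\ c 0%N = alpha, c n = beta, (forall i, (i <= n)%N -> E (c i)) &
      forall i, (i < n)%N -> (c i < c i.+1)%O /\
        ~ exists2 delta, E delta & (c i < delta < c i.+1)%O].

(* The common length of the saturated chains from alpha to beta in E.          *)
Definition chain_length E alpha beta : nat :=
  xget 0%N [set n | exists c, saturated_chain E alpha beta n c].

(* distance F E is d(F \ E), for good semigroup ideals E `<=` F.               *)
Definition distance F E : int :=
  (chain_length F (mu_of F) (gamma_of E))%:Z -
  (chain_length E (mu_of E) (gamma_of E))%:Z.

End ValueSemigroups.

(* Main.v *)
(* Write D(a) for the set of elements of value at least a, and let c be least   *)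
(* with D(c) contained in K.  Residual rationality shows that K has no element  *)
(* of value c_i - 1 at i and at least c_j at every j <> i, so K : D(b) is        *)
(* D(c - b).  Dualizing the chain F + D(b) and using the modular law, K : F has *)
(* an element of value a_i at i and at least a elsewhere if and only if F has   *)
(* none of value c_i - 1 - a_i at i and at least c - a elsewhere.  Large residue *)
(* fields let such elements, found for each i separately, be combined into one  *)
(* of value a, which gives (a).  For (b), saturated chains of values from a to  *)
(* b in the value set of E have length equal to that of the R-module            *)
(* (E :&: D(a)) / (E :&: D(b)), so the distance of two value sets is the length *)
(* of F / E, and E |-> K : E reverses inclusions.                               *)
(*                                                                              *)
(* The finiteness of the integral closure Rbar rests on a uniform bound: by     *)
(* additivity of lengths, every element of Rbar satisfies a monic equation of   *)
(* degree at most len(R / xR) + 1, for x regular in the Jacobson radical.       *)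
(* Hence a limit of elements of R lying in x^k Rbar for k -> infinity is        *)
(* nilpotent in the completion, and vanishes when R is analytically reduced.    *)
Require Import Defs.
From HB Require Import structures.
From mathcomp Require Import all_boot all_order all_algebra.
From mathcomp Require Import boolp classical_sets functions cardinality.
From mathcomp Require Import constructive_ereal ring zify.

Set Implicit Arguments.
Unset Strict Implicit.
Unset Printing Implicit Defensive.

Import Order.TTheory GRing.Theory Num.Theory.
Local Open Scope classical_set_scope.
Local Open Scope quotient_scope.
Local Open Scope ring_scope.

(** * Ideals of a Noetherian ring *)

(** Everything is compared with the integral closure [A] of [R] and with the sets [dset alpha] of
    elements of value at least [alpha]. Analytic reducedness makes [A] finite over [R]
    ([integral_closure_finite]). Its maximal ideals are then finite in number and principal
    ([integral_maximal_seq], [maximal_principal]), and localizing at them gives exactly the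
    valuation rings of [R] ([vring_valuation_ring], [valuation_ring_vring]). Regular fractional
    ideals become the submodules squeezed between two sets [dset] ([regular_fractional_idealP]).

    Residual rationality allows the leading term of an element at one valuation to be cancelled with
    a coefficient from [R] ([leading_coef]). Large residue fields allow elements that have the right
    value at one index each, and at least that value elsewhere, to be merged into one element of
    that value ([generic_element]).

    For (a), let [dset c] be the largest such set inside [K]. By [conductor_gap], [K] has no element
    of value [c i - 1] at [i] and at least [c] elsewhere, whence [K : dset beta = dset (c - beta)]
    ([colon_dset]). Biduality and the modular law show that [K : F] has an element of value
    [alpha i] at [i] and at least [alpha] elsewhere as soon as [F] has none of value
    [c i - 1 - alpha i] at [i] and at least [c - alpha] elsewhere ([colon_dual_value]). If [alpha]
    translates the values of [F] into those of [K], an element of the latter kind would violate the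
    gap of [K]; so [alpha] is a value of [K : F] ([gset_colon]).

    For (b), consecutive values of [E] cut out a simple subquotient ([consecutive_len]), so
    saturated chains of values compute lengths and the distance of two value sets is the length of
    [F / E] ([distance_len]). The duality [E |-> K : E] reverses strict inclusions and hence
    preserves this length ([distance_dual]). *)

Section IdealBasics.
Variable T : comNzRingType.
Implicit Types (A I J M : set T) (S : set T).

Lemma ideal_sum A I (X : eqType) (s : seq X) (F : X -> T) : ideal A I ->
  (forall i, i \in s -> I (F i)) -> I (\sum_(i <- s) F i).
Proof.
by move=> [_ I0 ID _] sF; rewrite big_seq; apply: (big_ind I).
Qed.

Lemma ideal_gen_min I (X : set T) : ideal setT I -> X `<=` I ->
  ideal_gen X `<=` I.
Proof.
move=> iI XI _ [s sP ->]; apply: (ideal_sum iI) => q /sP[_ Xq].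
by case: iI => _ _ _; apply => //; apply: XI.
Qed.

Lemma ideal_gen_self (X : set T) : X `<=` ideal_gen X.
Proof.
move=> x Xx; exists [:: (1, x)]; last by rewrite big_seq1 mul1r.
by move=> q; rewrite inE => /eqP ->.
Qed.

Definition ideal_add I J : set T :=
  [set z | exists i j, [/\ I i, J j & z = i + j]].

Lemma ideal_add_ideal I J : ideal setT I -> ideal setT J ->
  ideal setT (ideal_add I J).
Proof.
move=> [_ I0 ID IM] [_ J0 JD JM]; split=> //.
- by exists 0, 0; rewrite addr0.
- move=> _ _ [i [j [Ii Jj ->]]] [i' [j' [Ii' Jj' ->]]].
  by exists (i + i'), (j + j'); split; [exact: ID|exact: JD|ring].
- move=> a _ _ [i [j [Ii Jj ->]]]; exists (a * i), (a * j).
  by split; [exact: IM|exact: JM|ring].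
Qed.

Lemma ideal_addl I J : ideal setT J -> I `<=` ideal_add I J.
Proof. by move=> [_ J0 _ _] i Ii; exists i, 0; rewrite addr0. Qed.

Lemma ideal_addr I J : ideal setT I -> J `<=` ideal_add I J.
Proof. by move=> [_ I0 _ _] i Ii; exists 0, i; rewrite add0r. Qed.

Definition principal (a : T) : set T := range (fun r => r * a).

Lemma principal_ideal a : ideal setT (principal a).
Proof.
split=> //.
- by exists 0 => //; rewrite mul0r.
- by move=> _ _ [r _ <-] [s _ <-]; exists (r + s) => //; rewrite mulrDl.
- by move=> r _ _ [s _ <-]; exists (r * s) => //; rewrite mulrA.
Qed.

Lemma principal_self a : principal a a.
Proof. by exists 1 => //; rewrite mul1r. Qed.

Lemma ideal_mulr A I x a : ideal A I -> I x -> A a -> I (x * a).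
Proof. by move=> [_ _ _ IM] Ix Aa; rewrite mulrC; apply: IM. Qed.

Lemma idealB I x y : ideal setT I -> I x -> I y -> I (x - y).
Proof.
by move=> iI Ix Iy; have [_ _ ID _] := iI; apply: ID => //; apply: idealN.
Qed.

Lemma ideal_quo_ideal I a : ideal setT I -> ideal setT [set y | I (y * a)].
Proof.
move=> [_ I0 ID IM]; split=> //=.
- by rewrite mul0r.
- by move=> x y Ix Iy; rewrite mulrDl; apply: ID.
- by move=> b x _ Ix; rewrite -mulrA; apply: IM.
Qed.

Lemma prime_ideal_proper A I : A 1 -> prime_ideal A I -> ~ I 1.
Proof.
move=> A1 [[IA _ _ IM] nIA _] I1; apply: nIA; apply/seteqP; split=> // a Aa.
by rewrite -[a]mulr1; apply: IM.
Qed.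

Lemma ideal_neqP A I : A 1 -> ideal A I -> I <> A <-> ~ I 1.
Proof.
move=> A1 [IA _ _ IM]; split=> [nIA I1|nI1 IA']; last by apply: nI1; rewrite IA'.
apply: nIA; apply/seteqP; split=> // a Aa.
by rewrite -[a]mulr1; apply: IM.
Qed.

Section MaximalIdeals.
Variable A : set T.
Hypothesis sA : GRing.subring_closed [in A].

Lemma subring1 : A 1.
Proof. by case: sA => /set_mem. Qed.

Lemma subringB x y : A x -> A y -> A (x - y).
Proof. by case: sA => _ sB _ /mem_set Ax /mem_set Ay; apply/set_mem/sB. Qed.

Lemma subringM x y : A x -> A y -> A (x * y).
Proof. by case: sA => _ _ sM /mem_set Ax /mem_set Ay; apply/set_mem/sM. Qed.

Lemma subring0 : A 0.
Proof. by rewrite -(subrr 1); apply: subringB; apply: subring1. Qed.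

Lemma subringD x y : A x -> A y -> A (x + y).
Proof.
move=> Ax Ay; rewrite -[y]opprK; apply: subringB => //.
by rewrite -sub0r; apply: subringB => //; apply: subring0.
Qed.

Lemma subringN x : A x -> A (- x).
Proof. by move=> Ax; rewrite -sub0r; apply: subringB => //; apply: subring0. Qed.

Lemma subringX x n : A x -> A (x ^+ n).
Proof.
move=> Ax; elim: n => [|n IHn]; first by rewrite expr0; apply: subring1.
by rewrite exprS; apply: subringM.
Qed.

Lemma maximal_ideal_inv M a : maximal_ideal A M -> A a -> ~ M a ->
  exists2 b, A b & M (1 - b * a).
Proof.
move=> [[MA M0 MD MM] nMA Mmax] Aa nMa.
pose J : set T := [set z | exists i r, [/\ M i, A r & z = i + r * a]].
have iJ : ideal A J.
  split.
  - move=> _ [i [r [Mi Ar ->]]]; apply: subringD; first exact: MA.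
    exact: subringM.
  - by exists 0, 0; split=> //; [exact: subring0|rewrite mul0r addr0].
  - move=> _ _ [i [r [Mi Ar ->]]] [i' [r' [Mi' Ar' ->]]].
    by exists (i + i'), (r + r'); split; [exact: MD|exact: subringD|ring].
  - move=> c _ Ac [i [r [Mi Ar ->]]]; exists (c * i), (c * r).
    by split; [exact: MM|exact: subringM|ring].
have MJ : M `<=` J.
  by move=> y My; exists y, 0; split=> //; [exact: subring0|rewrite mul0r addr0].
have [JM|JA] := Mmax J iJ MJ.
  case: nMa; rewrite -JM; exists 0, 1; split=> //; first exact: subring1.
  by rewrite mul1r add0r.
have [i [r [Mi Ar e]]] : J 1 by rewrite JA; apply: subring1.
by exists r => //; rewrite e addrK.
Qed.

Lemma maximal_ideal_prime M : maximal_ideal A M -> prime_ideal A M.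
Proof.
move=> mM; have [iM nMA Mmax] := mM; split=> // x y Ax Ay Mxy.
have [Mx|nMx] := pselect (M x); [by left|right].
have [b Ab Mb] := maximal_ideal_inv mM Ax nMx.
have -> : y = y * (1 - b * x) + b * (x * y) by ring.
by case: iM => _ _ MD MM; apply: MD; apply: MM.
Qed.

Lemma maximal_ideal1 M : maximal_ideal A M -> ~ M 1.
Proof. by move=> /maximal_ideal_prime; apply: prime_ideal_proper; apply: subring1. Qed.

Lemma maximal_idealM M x y : maximal_ideal A M -> A x -> A y ->
  ~ M x -> ~ M y -> ~ M (x * y).
Proof. by move=> /maximal_ideal_prime[_ _ Mp] Ax Ay nx ny /Mp[]. Qed.

Lemma maximal_ideal_sub M N : maximal_ideal A M -> maximal_ideal A N ->
  M `<=` N -> M = N.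
Proof.
by move=> [_ _ Mmax] [iN nN _] MN; have [->|/nN] := Mmax _ iN MN.
Qed.

(** Each [N] in [s] has an element outside [M], as comparable maximal ideals agree; the product of
    these stays outside the prime ideal [M]. *)
Lemma maximal_ideal_avoid M (s : seq (set T)) : maximal_ideal A M ->
  (forall N, N \in s -> maximal_ideal A N /\ N <> M) ->
  exists2 u, A u & ~ M u /\ forall N, N \in s -> N u.
Proof.
move=> mM; elim: s => [_|N s IHs sP].
  by exists 1; [exact: subring1|split=> //; exact: maximal_ideal1].
have [N' N's|u Au [nMu su]] := IHs; first by apply: sP; rewrite inE N's orbT.
have [mN nNM] : maximal_ideal A N /\ N <> M by apply: sP; rewrite inE eqxx.
have [v [Nv nMv]] : exists v, N v /\ ~ M v.
  apply: contrapT => nv; apply: nNM; apply: maximal_ideal_sub => // v Nv.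
  by apply: contrapT => nMv; apply: nv; exists v.
have [[NA _ _ NM] _ _] := mN; have Av := NA _ Nv.
exists (u * v); first exact: subringM.
split; first exact: maximal_idealM.
move=> N'; rewrite inE => /predU1P[->|N's]; first exact: NM.
have [[_ _ _ N'M] _ _] := (sP N' (mem_behead (s := N :: s) N's)).1.
by rewrite mulrC; apply: N'M => //; apply: su.
Qed.

End MaximalIdeals.
End IdealBasics.

Lemma subring_setT (T : comNzRingType) : GRing.subring_closed [in @setT T].
Proof. by split=> [|x y _ _|x y _ _]; rewrite inE. Qed.
#[global] Hint Resolve subring_setT : core.

Section Noetherian.
Variable R : comNzRingType.
Hypothesis HN : noetherian R.
Implicit Types (I J N M : set R).

(** Otherwise choice produces a strictly ascending sequence; its union is finitely generated, so all
    generators already lie in one term. *)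
Lemma noetherian_max (P : set (set R)) :
  (forall I, P I -> ideal setT I) -> P !=set0 ->
  exists2 M, P M & forall J, P J -> M `<=` J -> J = M.
Proof.
move=> Pi [I0 PI0]; apply: contrapT => nmax.
have step M : exists J, P M -> [/\ P J, M `<=` J & J <> M].
  have [PM|nPM] := pselect (P M); last by exists M.
  apply: contrapT => nJ; apply: nmax; exists M => // J PJ MJ.
  by apply: contrapT => JM; apply: nJ; exists J.
have [f fP] := choice step.
pose u n := iter n f I0.
have Pu n : P (u n) by elim: n => //= n /fP[].
have uS n : u n `<=` u n.+1 by have [] := fP _ (Pu n).
have uP n : u n.+1 <> u n by have [] := fP _ (Pu n).
have umono m n : (m <= n)%N -> u m `<=` u n.
  move=> /subnK <-; elim: (n - m)%N => // k IHk.
  by apply: subset_trans IHk _; rewrite addSn; apply: uS.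
pose U := \bigcup_n u n.
have iU : ideal setT U.
  split=> //.
  - by exists 0%N => //; case: (Pi _ (Pu 0%N)).
  - move=> x y [m _ ux] [n _ uy]; exists (maxn m n) => //.
    case: (Pi _ (Pu (maxn m n))) => _ _ D _; apply: D.
      exact: umono (leq_maxl _ _) _ ux.
    exact: umono (leq_maxr _ _) _ uy.
  - by move=> a x _ [n _ ux]; exists n => //; case: (Pi _ (Pu n)) => _ _ _; apply.
have [s Us] := HN iU.
have sU : [set` s] `<=` U by rewrite Us; apply: ideal_gen_self.
have [k sk] : exists k, [set` s] `<=` u k.
  elim: s sU {Us} => [_|a s IHs sU]; first by exists 0%N.
  have [|k sk] := IHs; first by move=> x xs; apply: sU; rewrite /= inE xs orbT.
  have [l _ al] : U a by apply: sU; rewrite /= inE eqxx.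
  exists (maxn k l) => x /=; rewrite inE => /predU1P[->|xs].
    exact: umono (leq_maxr _ _) _ al.
  exact: umono (leq_maxl _ _) _ (sk _ xs).
apply: (uP k); apply/seteqP; split=> // x ux.
have : U x by exists k.+1.
by rewrite Us; apply: (ideal_gen_min (Pi _ (Pu k))).
Qed.

Lemma noetherian_in_maximal I : ideal setT I -> ~ I 1 ->
  exists2 m, maximal_ideal setT m & I `<=` m.
Proof.
move=> iI nI1.
have [m [im nm1 Im] mmax] := @noetherian_max
    [set J | [/\ ideal setT J, ~ J 1 & I `<=` J]] ltac:(by move=> ? []) ltac:(by exists I; split).
exists m => //; split=> //.
  by apply/ideal_neqP.
move=> J iJ mJ; have [J1|nJ1] := pselect (J 1).
  by right; apply: contrapT => JT; have /(ideal_neqP _ iJ) := JT; apply.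
by left; apply: mmax => //; split=> //; apply: subset_trans mJ.
Qed.

(** An ideal [p] maximal among those containing [I] and missing [S] is prime: if [a] and [b] are
    outside, both [p + (a)] and [p + (b)] meet [S], and a product of such elements would lie in [p]
    if [a b] did. *)
Lemma prime_separation I (S : set R) : ideal setT I -> S 1 ->
  (forall x y, S x -> S y -> S (x * y)) -> (forall x, I x -> ~ S x) ->
  exists p, [/\ prime_ideal setT p, I `<=` p & forall x, p x -> ~ S x].
Proof.
move=> iI S1 SM IS.
have [p [ip Ip pS] pmax] := @noetherian_max
    [set J | [/\ ideal setT J, I `<=` J & forall x, J x -> ~ S x]]
    ltac:(by move=> ? []) ltac:(by exists I; split).
have meet a : ~ p a -> exists i r, p i /\ S (i + r * a).
  move=> npa; apply: contrapT => nS; apply: npa.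
  have ia := principal_ideal a.
  rewrite -(pmax (ideal_add p (principal a))).
  - exact/ideal_addr/principal_self.
  - split; first exact: ideal_add_ideal.
      by apply: subset_trans Ip _; apply: ideal_addl.
    by move=> _ [i [_ [pi [r _ <-] ->]]] Sx; apply: nS; exists i, r.
  - exact: ideal_addl.
exists p; split=> //; split=> //.
  by apply/(ideal_neqP _ ip) => // /pS.
move=> a b _ _ pab; apply: contrapT => /not_orP[/meet[i [r [pi Sa]]] /meet[j [s [pj Sb]]]].
apply: pS (SM _ _ Sa Sb).
have -> : (i + r * a) * (j + s * b) = (j + s * b) * i + (r * a) * j + (r * s) * (a * b).
  by ring.
have [_ _ pD pM] := ip.
by apply: (pD _ _ (pD _ _ _ _)); apply: pM.
Qed.

Lemma ideal_pow_ideal_setT I n : ideal setT I -> ideal setT (ideal_pow setT I n).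
Proof. by move=> iI; elim: n => //= n; apply: ideal_prod_ideal. Qed.

Lemma ideal_pow_elt I x n : I x -> ideal_pow setT I n (x ^+ n).
Proof.
move=> Ix; elim: n => //= n IHn; exists [:: (x, x ^+ n)]; last by rewrite big_seq1 exprS.
by move=> q; rewrite inE => /eqP ->.
Qed.

(* Pigeonhole: some generator of I occurs often in a long product of generators. *)
Lemma ideal_pow_nil I L : ideal setT I -> ideal setT L ->
  (forall z, I z -> exists k, L (z ^+ k)) ->
  exists n, ideal_pow setT I n `<=` L.
Proof.
move=> iI iL IL.
have [_ L0 LD LM] := iL.
have [s Is] := HN iI.
have sI : [set` s] `<=` I by rewrite Is; apply: ideal_gen_self.
suff [n nP] : exists n, forall y, (forall t : seq R, {subset t <= s} -> size t = n ->
    L (y * \prod_(a <- t) a)).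
  exists n => x xn.
  suff : exists u : seq (R * seq R), (forall q, q \in u -> {subset q.2 <= s} /\ size q.2 = n)
      /\ x = \sum_(q <- u) q.1 * \prod_(a <- q.2) a.
    move=> [u [uP ->]]; apply: (ideal_sum iL) => q /uP[q1 q2].
    exact: nP.
  elim: n {nP} x xn => [|n IHn] x /=.
    move=> _; exists [:: (x, [::])]; rewrite big_seq1 big_nil mulr1; split=> //.
    by move=> q; rewrite inE => /eqP ->.
  move=> [v vP ->]; elim: v vP => [|[i j] v IHv] vP.
    by exists [::]; rewrite !big_nil.
  have [|u [uP eu]] := IHv; first by move=> q qv; apply: vP; rewrite inE qv orbT.
  have [/= Ii Ij] := vP (i, j) (mem_head _ _).
  have [w [wP ew]] := IHn j Ij.
  move: Ii; rewrite Is => -[g gP eg].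
  exists ([seq (p.1 * q.1, p.2 :: q.2) | p <- g, q <- w] ++ u); split.
    move=> q; rewrite mem_cat => /orP[/allpairsP[[p r] /= [pg rw ->]]|/uP//] /=.
    have [_ ps] := gP _ pg; have [rs1 rs2] := wP _ rw; split; last by rewrite rs2.
    by move=> a; rewrite inE => /predU1P[->|/rs1].
  rewrite big_cons big_cat -eu /=; congr (_ + _).
  rewrite eg ew big_distrlr big_allpairs_dep /=; apply: eq_bigr => p _; apply: eq_bigr => q _.
  by rewrite big_cons; ring.
elim: s sI {Is} => [|a s IHs] sI.
  exists 1%N => y [//|b [|//]] bs _.
  by have := bs b (mem_head _ _).
have [|n nP] := IHs; first by move=> x xs; apply: sI; rewrite /= inE xs orbT.
have [k ak] : exists k, L (a ^+ k) by apply/IL/sI; rewrite /= inE eqxx.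
exists (k + n)%N => y t ts tn.
have [kc|ck] := leqP k (count_mem a t).
  have -> : \prod_(b <- t) b = a ^+ k * (a ^+ (count_mem a t - k) * \prod_(b <- t | b != a) b).
    rewrite mulrA -exprD subnKC // (bigID (pred1 a)) /=; congr (_ * _).
    rewrite (eq_bigr (fun=> a)) => [|b /eqP//].
    by rewrite big_const_seq iter_mulr_1.
  by rewrite mulrCA mulrC; apply: LM.
pose t' := [seq b <- t | b != a].
have t's : {subset t' <= s}.
  by move=> b; rewrite mem_filter => /andP[/negbTE ba /ts]; rewrite inE ba.
have nt' : (n <= size t')%N.
  have := count_predC (pred1 a) t; rewrite tn size_filter.
  have -> : count (predC (pred1 a)) t = count (fun b => b != a) t by apply: eq_count.
  by lia.
have -> : \prod_(b <- t) b =
   (\prod_(b <- drop n t') b * \prod_(b <- t | b == a) b) * \prod_(b <- take n t') b.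
  rewrite (bigID (pred1 a)) /= -[in LHS](big_filter _ (fun b => b != a)) -/t'.
  by rewrite -{1}(cat_take_drop n t') big_cat /=; ring.
rewrite mulrA; apply: nP; last by rewrite size_takel.
by move=> b /mem_take/t's.
Qed.

End Noetherian.

Lemma lreg0P (T : comNzRingType) (b : T) :
  GRing.lreg b <-> forall y, y * b = 0 -> y = 0.
Proof.
split=> [lb y e|H x y /eqP]; first by apply: lb; rewrite mulrC e mulr0.
by rewrite -subr_eq0 -mulrBr mulrC => /eqP/H/eqP; rewrite subr_eq0 => /eqP.
Qed.

(** * Nakayama's lemma, Krull's intersection theorem and analytic reducedness *)

Section JacobsonRadical.
Variable R : comNzRingType.
Hypothesis HN : noetherian R.
Implicit Types (I J N M m p : set R).

Lemma jacobson_unit (j : R) : jacobson R j -> exists b, b * (1 - j) = 1.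
Proof.
move=> Jj; apply: contrapT => nb.
have [|m mm pm] := noetherian_in_maximal HN (principal_ideal (1 - j)).
  by move=> [b _ e]; apply: nb; exists b.
apply: (maximal_ideal1 (@subring_setT R) mm).
have -> : (1 : R) = (1 - j) + j by rewrite subrK.
have [[_ _ mD _] _ _] := mm; apply: mD; last exact: Jj.
exact/pm/principal_self.
Qed.

(** If [I] is nonzero, let [L] be maximal among the ideals properly contained in [I]. Then [I / L]
    is simple and is killed by the radical, as [1 - r j] is a unit for [j] in the radical; so [I]
    would lie in [L]. *)
Lemma nakayama I : ideal setT I ->
  I `<=` ideal_prod (jacobson R) I -> I = [set 0].
Proof.
move=> iI IJI; apply/seteqP; split=> [y Iy|_ ->]; last by case: iI.
apply: contrapT => ny0; have [_ I0 ID IM] := iI.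
have [L [iL LI nIL] Lmax] := @noetherian_max _ HN
  [set L | [/\ ideal setT L, L `<=` I & ~ I `<=` L]] ltac:(by move=> ? [])
  ltac:(by exists [set 0]; split; [split=> //; [move=> ? ? -> ->; rewrite addr0|
    move=> a ? _ ->; rewrite mulr0]|move=> ? ->|move=> /(_ _ Iy)]).
have [_ L0 LD LM] := iL.
apply: nIL; apply: subset_trans IJI _.
move=> _ [s sP ->]; apply: (ideal_sum iL) => -[j z] /sP[/= Jj Iz].
have Lz u : I u -> ~ L u -> forall v, I v -> exists l r, L l /\ v = l + r * u.
  move=> Iu nLu v Iv; apply: contrapT => nlr; apply: nLu.
  rewrite -(Lmax (ideal_add L (principal u))).
  - exact/ideal_addr/principal_self.
  - split.
    + exact/ideal_add_ideal/principal_ideal.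
    + move=> _ [l [_ [Ll [r _ <-] ->]]]; apply: ID; first exact: LI.
      exact: IM.
    + by move=> /(_ v Iv)[l [_ [Ll [r _ <-] e]]]; apply: nlr; exists l, r.
  - exact/ideal_addl/principal_ideal.
apply: contrapT => nLjz.
have nLz : ~ L z by move=> Lz'; apply: nLjz; apply: LM.
have [l [r [Ll e]]] := Lz _ (IM j z Logic.I Iz) nLjz _ Iz.
have [b be] : exists b, b * (1 - r * j) = 1.
  apply: jacobson_unit => m mm; have [[_ _ _ mM] _ _] := mm; apply: mM => //.
  exact: Jj.
apply: nLz; rewrite -[z]mul1r -be.
have -> : b * (1 - r * j) * z = b * (z - r * (j * z)) by ring.
by rewrite {1}e addrK; apply: LM.
Qed.

(** Let [I] be maximal with [JN] inside [I] and [I] meeting [N] inside [JN]. Every element of the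
    radical has a power in [I], so [I] contains a power of the radical and with it [N]. Hence [N]
    lies in [JN], and Nakayama applies. *)
Lemma krull_intersection :
  \bigcap_n ideal_pow setT (jacobson R) n = [set 0].
Proof.
set N := \bigcap_n _; have iJ := jacobson_ideal_subproof R.
have iN : ideal setT N.
  split=> //.
  - by move=> n _; case: (ideal_pow_ideal_setT n iJ).
  - move=> x y Nx Ny n nT; case: (ideal_pow_ideal_setT n iJ) => _ _ D _.
    by apply: D; [apply: Nx|apply: Ny].
  - move=> a x _ Nx n nT; case: (ideal_pow_ideal_setT n iJ) => _ _ _; apply=> //.
    exact: Nx.
have [_ N0 ND NM] := iN.
set JN := ideal_prod (jacobson R) N.
have iJN : ideal setT JN by apply: ideal_prod_ideal.
have JNN : JN `<=` N.
  by move=> _ [s sP ->]; apply: (ideal_sum iN) => q /sP[_ ?]; apply: NM.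
have [I [iI JNI IN] Imax] := @noetherian_max _ HN
  [set I | [/\ ideal setT I, JN `<=` I & I `&` N `<=` JN]] ltac:(by move=> ? [])
  ltac:(by exists JN; split=> // x []).
have [_ I0 ID IM] := iI.
apply: nakayama => //; apply: (subset_trans _ IN).
rewrite subsetI; split=> //.
suff JI a : jacobson R a -> exists k, I (a ^+ k).
  by have [n nI] := ideal_pow_nil HN iJ iI JI => x Nx; apply: nI; apply: Nx.
move=> Ja.
have [_ [k _ <-] kmax] := @noetherian_max _ HN
  (range (fun k => [set y | I (y * a ^+ k)]))
  ltac:(by move=> _ [k _ <-]; apply: ideal_quo_ideal)
  ltac:(by exists [set y | I (y * a ^+ 0)]; exists 0%N).
(* For [k] at which the ideals [I : a^k] are stable, [i + r a^k] in [N] gives [r a^(k+1)] in [I],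
   hence [r a^k] in [I]; so [I + (a^k)] still meets [N] inside [JN]. *)
exists k; rewrite -(Imax (ideal_add I (principal (a ^+ k)))).
- exact/ideal_addr/principal_self.
- split.
  + exact/ideal_add_ideal/principal_ideal.
  + by apply: subset_trans JNI _; apply/ideal_addl/principal_ideal.
  + move=> _ [[i [_ [Ii [r _ <-] ->]]] Nz]; apply: IN; split=> //.
    apply: ID => //.
    have Iaz : I (a * (i + r * a ^+ k)).
      by apply: JNI; exists [:: (a, i + r * a ^+ k)]; [move=> q; rewrite inE => /eqP ->|rewrite big_seq1].
    have Irk : I (r * a ^+ k.+1).
      have -> : r * a ^+ k.+1 = a * (i + r * a ^+ k) - a * i by rewrite exprS; ring.
      by apply: idealB => //; apply: IM.
    suff Ek : [set y | I (y * a ^+ k.+1)] = [set y | I (y * a ^+ k)].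
      by move: Irk; rewrite -[I _]/([set y | I (y * a ^+ k.+1)] r) Ek.
    apply: kmax; first by exists k.+1.
    by move=> y /= Iy; rewrite exprS mulrCA; apply: IM.
- exact/ideal_addl/principal_ideal.
Qed.

(** The form in which the hypothesis on the completion is applied: a Cauchy sequence with nilpotent
    limit tends to zero. *)
Lemma analytically_reduced_reduced : analytically_reduced R ->
  forall (f : nat -> R) d,
    (forall n, ideal_pow setT (jacobson R) n (f n.+1 - f n)) ->
    (forall n, ideal_pow setT (jacobson R) n (f n ^+ d)) ->
    forall n, ideal_pow setT (jacobson R) n (f n).
Proof.
move=> red f d cf fd.
have cohf : coherent (jacobson_ideal R) f by apply/asboolP.
pose F : coherent_seq (jacobson_ideal R) := CoherentSeq cohf.
have powF k n : coherent_val (F ^+ k) n = f n ^+ k.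
  elim: k => [|k IHk]; first by rewrite !expr0.
  by rewrite !exprS -IHk.
have nullF (g : coherent_seq (jacobson_ideal R)) :
    null_seq g <-> \pi_(completion (jacobson_ideal R)) g = 0.
  rewrite -(rmorph0 (\pi_(completion (jacobson_ideal R)))).
  by split=> [n|/eqP]; [apply/eqP|]; rewrite -Quotient.idealrBE subr0.
suff : null_seq F by move=> /asboolP.
apply/nullF; apply: (red _ d).
rewrite -rmorphXn; apply/nullF/asboolP => n; rewrite powF; exact: fd.
Qed.

(** A nilpotent element is viewed as a constant sequence; by Krull's theorem [R] embeds in its
    completion. *)
Lemma reduced_of_analytically_reduced : analytically_reduced R -> reduced R.
Proof.
move=> red x n xn.
have : (\bigcap_k ideal_pow setT (jacobson R) k) x.
  have iJk k := ideal_pow_ideal_setT k (jacobson_ideal_subproof R).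
  move=> k _; apply: (analytically_reduced_reduced red (f := fun=> x) (d := n)).
    by move=> l; rewrite subrr; case: (iJk l).
  by move=> l; rewrite xn; case: (iJk l).
by rewrite krull_intersection.
Qed.

(* Adding nonzero elements orthogonal to b and to each other one at a time     *)
(* must stop, since their annihilators' annihilators strictly increase.        *)
Lemma orthogonal_complement (L : set R) (b : R) : reduced R -> ideal setT L ->
  exists c, [/\ L c, b * c = 0 & forall y, L y -> y * b = 0 -> y * c = 0 -> y = 0].
Proof.
move=> red [_ L0 LD LM].
pose AA c : set R := [set r | forall z, z * c = 0 -> z * r = 0].
have [||_ [c [Lc bc] <-] cmax] := @noetherian_max _ HN
  [set AA c | c in [set c | L c /\ b * c = 0]].
- move=> _ [c _ <-]; split=> //.
  + by move=> z _; rewrite mulr0.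
  + by move=> r s rc sc z zc; rewrite mulrDr rc ?sc ?addr0.
  + by move=> a r _ rc z zc; rewrite mulrCA rc ?mulr0.
- by exists (AA 0); exists 0 => //; split; rewrite ?mulr0.
have red2 (z : R) : z * z = 0 -> z = 0 by move=> e; apply: (red z 2%N); rewrite expr2.
exists c; split=> // y Ly yb yc.
have split_ann z : z * (c + y) = 0 -> z * c = 0 /\ z * y = 0.
  move=> e; have zc : z * c = 0.
    apply: red2; have -> : z * c * (z * c) = (z * (c + y)) * (z * c) - z * z * (y * c).
      by ring.
    by rewrite e yc mul0r mulr0 subrr.
  by split=> //; rewrite -e mulrDr zc add0r.
have AAy : AA (c + y) y by move=> z /split_ann[].
apply: red2; move: AAy; rewrite (cmax (AA (c + y))); first by apply.
- exists (c + y) => //; split; first exact: LD.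
  by rewrite mulrDr bc mulrC yb addr0.
- by move=> r cr z /split_ann[zc _]; apply: cr.
Qed.
End JacobsonRadical.

(** * One-dimensional Cohen-Macaulay rings *)

Section LocalRegularity.
Variable R : comNzRingType.
Implicit Types (m p : set R) (a b : R).

(** Says inside [R] that [a] is a nonzerodivisor in the localization at [m]. *)
Definition locally_regular m a := forall y t, ~ m t -> t * (a * y) = 0 ->
  exists2 u, ~ m u & u * y = 0.

Lemma to_loc_eq0 (p : spec R) (a : R) (s : den (prime_compl p)) :
  mkfrac a s = 0 :> loc_at p <-> exists2 u, ~ (p : set R) u & u * a = 0.
Proof.
rewrite -[0]/(mkfrac 0 (den_one (prime_compl p))); split.
  by move=> /frac_eqP[u nu]; rewrite mulr1 mul0r subr0; exists u.
by move=> [u nu e]; apply/frac_eqP; exists u => //; rewrite mulr1 mul0r subr0.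
Qed.

Lemma mkfrac_mul (S : mulset R) a b (s t : den S) :
  mkfrac a s * mkfrac b t = mkfrac (a * b) (den_mul s t) :> loc S.
Proof. exact: frac_mul. Qed.

(** The regular sequence of length one consists of a fraction; its numerator lies in [m], since
    otherwise the fraction would be a unit in the radical. *)
Lemma cohen_macaulay_locally_regular (m : spec R) :
  local_depth (loc_at m) 1 -> exists2 a, (m : set R) a & locally_regular m a.
Proof.
move=> [[[|z [|? ?]] [// _ zJ [zreg _]]] _].
have {}zreg y : z * y = 0 -> y = 0.
  move=> e; have : ideal_gen [set` take 0 [:: z]] y.
    apply: (zreg 0%N) => //=; rewrite e; exists [::] => //; by rewrite big_nil.
  apply: (@ideal_gen_min _ [set 0]) => //.
  by split=> // [x y' -> ->|a x _ ->]; rewrite ?addr0 ?mulr0.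
have {}zJ : jacobson (loc_at m) z by apply: zJ; rewrite /= inE eqxx.
have [a [s ez]] := fracP z; exists a.
  apply: contrapT => nma.
  have [M mM] := exists_maximal_ideal (loc_at m).
  apply: (maximal_ideal1 (@subring_setT _) mM).
  have -> : 1 = mkfrac (den_val s) (Den (asboolT (nma : mulset_set (prime_compl m) a))) * z :> loc_at m.
    rewrite ez mkfrac_mul; apply: frac_congr => /=; ring.
  by have [[_ _ _ MM] _ _] := mM; apply: MM => //; apply: zJ.
move=> y t nmt e.
have : to_loc (prime_compl m) y = 0 :> loc_at m.
  apply: zreg; rewrite ez mkfrac_mul; apply/to_loc_eq0; by exists t.
by move=> /to_loc_eq0.
Qed.

Lemma regular_locally_regular m b : prime_ideal setT m ->
  GRing.lreg b -> locally_regular m b.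
Proof.
move=> pm rb y t nmt e; exists t => //.
by move/lreg0P : rb; apply; rewrite -e; ring.
Qed.

Hypothesis HN : noetherian R.
Hypothesis Hdim : krull_dim R 1.

(** Local regularity keeps 0 out of the multiplicative set of all [t a^k] with [t] outside [p]. A
    prime [q] missing this set lies strictly inside [p], so [p] strictly inside [m] would give a
    chain of three primes. *)
Lemma locally_regular_prime m p a : maximal_ideal setT m ->
  prime_ideal setT p -> p `<=` m -> p a -> locally_regular m a -> p = m.
Proof.
move=> mm pp pm pa ra; apply: contrapT => npm.
have mp := maximal_ideal_prime (@subring_setT R) mm.
have [ip _ pP] := pp; have [_ p0 pD pM] := ip.
have np1 := prime_ideal_proper Logic.I pp.
have [q [pq _ qS]] : exists q, [/\ prime_ideal setT q, [set 0] `<=` q &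
    forall x, q x -> ~ (exists t k, ~ p t /\ x = t * a ^+ k)].
  apply: (prime_separation HN (S := [set x | exists t k, ~ p t /\ x = t * a ^+ k])).
  - by split=> // [x y -> ->|b x _ ->]; rewrite ?addr0 ?mulr0.
  - by exists 1, 0%N; rewrite mulr1.
  - move=> _ _ [t [k [nt ->]]] [t' [k' [nt' ->]]]; exists (t * t'), (k + k')%N.
    by split; [move=> /(pP _ _ Logic.I Logic.I)[]|rewrite exprD; ring].
  - move=> x -> [t [k [nt e]]].
    suff : forall k y, ~ p t -> 0 = y * a ^+ k -> p y.
      by move=> /(_ k t nt e).
    elim=> [y|{e}k IHk y] _; first by rewrite mulr1 => <-.
    move=> e.
    have : exists2 u, ~ m u & u * (y * a ^+ k) = 0.
      apply: (ra _ 1); first exact: (maximal_ideal1 (@subring_setT R)).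
      by rewrite [RHS]e exprS; ring.
    move=> [u nmu e']; have npu : ~ p u by move=> /pm.
    have : p (u * y) by apply: IHk => //; rewrite -e'; ring.
    by move=> /(pP _ _ Logic.I Logic.I)[].
have qp : q `<=` p.
  move=> y qy; apply: contrapT => npy; apply: (qS _ qy); exists y, 0%N.
  by rewrite mulr1.
have nqa : ~ q a by move=> /qS; apply; exists 1, 1%N; rewrite mul1r expr1.
case: Hdim => _; apply.
exists (fun i => if i is 0%N then q else if i is 1%N then p else m); split.
  by move=> [|[|i]].
move=> [|[|//]] _; split=> // sub.
- by apply: nqa; apply: sub.
- by apply: npm; apply/seteqP.
Qed.

Lemma regular_prime_maximal p b : prime_ideal setT p -> GRing.lreg b -> p b ->
  maximal_ideal setT p.
Proof.
move=> pp rb pb; have [ip _ _] := pp.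
have [m mm pm] := noetherian_in_maximal HN ip (prime_ideal_proper Logic.I pp).
rewrite (locally_regular_prime mm pp pm pb) //.
apply: regular_locally_regular rb.
exact: maximal_ideal_prime mm.
Qed.

(** A prime containing [b] and missing the powers of [z] would be maximal, but maximal ideals
    contain the radical. *)
Lemma regular_power b z : GRing.lreg b -> jacobson R z ->
  exists k, principal b (z ^+ k).
Proof.
move=> rb Jz; apply: contrapT => nk.
have [p [pp bp pS]] : exists p, [/\ prime_ideal setT p, principal b `<=` p &
    forall x, p x -> ~ (exists k, x = z ^+ k)].
  apply: (prime_separation HN (S := [set x | exists k, x = z ^+ k])).
  - exact: principal_ideal.
  - by exists 0%N.
  - by move=> _ _ [k ->] [l ->]; exists (k + l)%N; rewrite exprD.
  - by move=> x bx [k e]; apply: nk; exists k; rewrite -e.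
have mp := regular_prime_maximal pp rb (bp _ (principal_self b)).
by apply: (pS z); [apply: Jz|exists 1%N; rewrite expr1].
Qed.

Lemma jacobson_power b : GRing.lreg b ->
  exists n, ideal_pow setT (jacobson R) n `<=` principal b.
Proof.
move=> rb; apply: (ideal_pow_nil HN) => [||z].
- exact: jacobson_ideal_subproof.
- exact: principal_ideal.
- exact: regular_power.
Qed.

Hypothesis Hsemi : semilocal R.

Lemma maximal_ideals_seq : exists s : seq (set R), forall m,
  m \in s <-> maximal_ideal setT m.
Proof.
have /finite_seqP[s sE] := Hsemi; exists s => m.
have <- : [set` s] m = maximal_ideal setT m by rewrite -sE.
by [].
Qed.

(** [orthogonal_complement] with [b = 0] gives [x] in the radical that kills no nonzero element of
    the radical. If [x] kills [y], choose [m] above the annihilator of [y], [a] in [m] regular at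
    [m], and [u] outside [m] but in all other maximal ideals. Then [u a y] is in the radical, hence
    zero, and local regularity contradicts the choice of [m]. *)
Lemma exists_regular_jacobson : reduced R ->
  (forall m : spec R, maximal_ideal setT (m : set R) -> local_depth (loc_at m) 1) ->
  exists2 x, jacobson R x & GRing.lreg x.
Proof.
move=> red Hdepth.
have iJ := jacobson_ideal_subproof R.
have [x [Jx _ xP]] := orthogonal_complement HN 0 red iJ.
exists x => //; apply/lreg0P => y yx; apply: contrapT => ny0.
have iann : ideal setT [set r | r * y = 0].
  split=> //=; first by rewrite mul0r.
    by move=> r s /= e e'; rewrite mulrDl e e' addr0.
  by move=> a r _ /= e; rewrite -mulrA e mulr0.
have [|m mm annm] := noetherian_in_maximal HN iann; first by rewrite /= mul1r.
have pm := maximal_ideal_prime (@subring_setT R) mm.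
have [a ma ra] := @cohen_macaulay_locally_regular (Spec pm) (Hdepth (Spec pm) mm).
have [s sP] := maximal_ideals_seq.
have [N|u _ [nmu uP]] := @maximal_ideal_avoid _ _ (@subring_setT R) m [seq N <- s | N != m] mm.
  by rewrite mem_filter => /andP[/eqP Nm /sP].
have Jua : jacobson R (u * a).
  move=> N mN; have [[_ _ _ NM] _ _] := mN.
  have [->|/eqP Nm] := pselect (N = m); first by case: mm => -[_ _ _ mM] _ _; apply: mM.
  by rewrite mulrC; apply: NM => //; apply: uP; rewrite mem_filter Nm; apply/sP.
have e : u * a * y = 0.
  case: iJ => _ _ _ JM.
  apply: xP; [by rewrite mulrC; apply: JM|by rewrite mulr0|].
  by rewrite -mulrA yx mulr0.
have [t nmt tuy] := ra (u * y) 1 (maximal_ideal1 (@subring_setT R) mm) ltac:(by rewrite -e; ring).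
have : m (t * u) by apply: annm; rewrite /= -mulrA.
exact: (maximal_idealM (@subring_setT R)).
Qed.

(** If [y (b + c) = 0] with [b c = 0], then [y b] has square zero and vanishes, and so does [y c];
    the orthogonal complement [c] leaves only [y = 0]. *)
Lemma regular_completion b : reduced R ->
  exists c, b * c = 0 /\ GRing.lreg (b + c).
Proof.
move=> red; have iT : ideal setT (@setT R) by [].
have [c [_ bc cP]] := orthogonal_complement HN b red iT.
exists c; split=> //; apply/lreg0P => y e.
have red2 (z : R) : z * z = 0 -> z = 0 by move=> ez; apply: (red z 2%N); rewrite expr2.
have yb : y * b = 0.
  apply: red2; have -> : y * b * (y * b) = y * b * (y * (b + c)) - y * y * (b * c) by ring.
  by rewrite e bc !mulr0 subrr.
by apply: cP => //; rewrite -e mulrDr yb add0r.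
Qed.

End LocalRegularity.

(** * Lengths of submodules of the total ring of fractions *)

Section TotalFracUnits.
Variable R : comNzRingType.
Local Notation Q := (total_frac R).

Definition total_unit : pred Q := fun q => `[< exists y, y * q = 1 >].

(** Non-units are sent to themselves, as the unit ring interface demands. *)
Definition total_inv (q : Q) : Q :=
  if pselect (exists y, y * q = 1) is left e then projT1 (cid e) else q.

Lemma total_mulVr : {in total_unit, left_inverse 1 total_inv *%R}.
Proof.
move=> q /asboolP uq; rewrite /total_inv; case: pselect => // e.
by case: cid.
Qed.

Lemma total_unitP (x y : Q) : y * x = 1 -> total_unit x.
Proof. by move=> e; apply/asboolP; exists y. Qed.

Lemma total_inv_out : {in [predC total_unit], total_inv =1 id}.
Proof.
move=> q; rewrite inE /= => /asboolPn nq; rewrite /total_inv.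
by case: pselect.
Qed.

HB.instance Definition _ :=
  GRing.ComNzRing_hasMulInverse.Build Q total_mulVr total_unitP total_inv_out.

Lemma total_unit_lreg (b : R) : GRing.lreg b -> to_total b \is a GRing.unit.
Proof.
move=> rb; apply/unitrP.
exists (mkfrac 1 (Den (asboolT (rb : mulset_set (regular_mulset R) b)))).
have e : to_total b * mkfrac 1 (Den (asboolT (rb : mulset_set (regular_mulset R) b))) = 1.
  rewrite /to_total /to_loc.
  rewrite -[_ * _]/(loc_mul _ _) frac_mul; apply: frac_congr => /=; ring.
by rewrite e mulrC e.
Qed.

Lemma total_fracP (q : Q) : exists a b, GRing.lreg b /\ q * to_total b = to_total a.
Proof.
have [a [s ->]] := fracP q; exists a, (den_val s).
split; first exact: asboolW (denP s).
rewrite /to_total /to_loc -[_ * _]/(loc_mul _ _) frac_mul; apply: frac_congr => /=; ring.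
Qed.

(** The numerator of a regular fraction is regular in [R], hence invertible among the fractions. *)
Lemma lreg_unit (q : Q) : GRing.lreg q <-> q \is a GRing.unit.
Proof.
split=> [/lreg0P rq|uq]; last exact: mulrI.
have [a [b [rb e]]] := total_fracP q.
have ub := total_unit_lreg rb.
have ra : GRing.lreg a.
  apply/lreg0P => y ya; apply: (@to_total_inj R); rewrite rmorph0; apply: rq.
  by apply: (mulIr ub); rewrite -mulrA e mul0r -rmorphM ya rmorph0.
by have := total_unit_lreg ra; rewrite -e unitrM => /andP[].
Qed.

End TotalFracUnits.

Section Lengths.
Variable R : comNzRingType.
Local Notation Q := (total_frac R).
Local Notation emb := (@to_total R).
Implicit Types (A B C D E : set Q).

Lemma submodule0 A : submodule A -> A 0. Proof. by case. Qed.
Lemma submoduleD A x y : submodule A -> A x -> A y -> A (x + y).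
Proof. by case=> _ D _; apply: D. Qed.
Lemma submoduleM A r x : submodule A -> A x -> A (emb r * x).
Proof. by case=> _ _; apply. Qed.
Lemma submoduleN A x : submodule A -> A x -> A (- x).
Proof. by move=> sA Ax; have := submoduleM (-1) sA Ax; rewrite rmorphN1 mulN1r. Qed.
Lemma submoduleB A x y : submodule A -> A x -> A y -> A (x - y).
Proof. by move=> sA Ax Ay; apply: submoduleD => //; apply: submoduleN. Qed.

Lemma submodule_sum A (X : eqType) (s : seq X) (F : X -> Q) : submodule A ->
  (forall i, i \in s -> A (F i)) -> A (\sum_(i <- s) F i).
Proof.
move=> [A0 AD _] sF; rewrite big_seq; exact: (big_ind A).
Qed.

Lemma submodule_setI A B : submodule A -> submodule B -> submodule (A `&` B).
Proof.
move=> sA sB; split.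
- by split; apply: submodule0.
- by move=> x y [Ax Bx] [Ay By]; split; apply: submoduleD.
- by move=> r x [Ax Bx]; split; apply: submoduleM.
Qed.

Lemma submodule_add A B : submodule A -> submodule B -> submodule (ideal_add A B).
Proof.
move=> [A0 AD AM] [B0 BD BM]; split.
- by exists 0, 0; rewrite addr0.
- move=> _ _ [i [j [Ii Jj ->]]] [i' [j' [Ii' Jj' ->]]].
  by exists (i + i'), (j + j'); split; [exact: AD|exact: BD|ring].
- move=> a _ [i [j [Ii Jj ->]]]; exists (emb a * i), (emb a * j).
  by split; [exact: AM|exact: BM|ring].
Qed.

Lemma submodule_addl A B : submodule B -> A `<=` ideal_add A B.
Proof. by move=> [B0 _ _] a Aa; exists a, 0; rewrite addr0. Qed.

Lemma submodule_addr A B : submodule A -> B `<=` ideal_add A B.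
Proof. by move=> [A0 _ _] b Bb; exists 0, b; rewrite add0r. Qed.

Lemma submodule_add_min A B C : submodule C -> A `<=` C -> B `<=` C ->
  ideal_add A B `<=` C.
Proof.
by move=> sC sAC sBC _ [a [b [Aa Bb ->]]]; apply: submoduleD; [|exact: sAC|exact: sBC].
Qed.

Definition scale (u : Q) A : set Q := [set y | exists2 a, A a & y = u * a].

Lemma submodule_scale u A : submodule A -> submodule (scale u A).
Proof.
move=> [A0 AD AM]; split.
- by exists 0; rewrite ?mulr0.
- by move=> _ _ [a Aa ->] [b Ab ->]; exists (a + b); [exact: AD|rewrite mulrDr].
- by move=> r _ [a Aa ->]; exists (emb r * a); [exact: AM|rewrite mulrCA].
Qed.

Lemma scale_sub u A B : A `<=` B -> scale u A `<=` scale u B.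
Proof. by move=> AB _ [a Aa ->]; exists a => //; apply: AB. Qed.

Lemma scale_scale u v A : scale u (scale v A) = scale (u * v) A.
Proof.
apply/seteqP; split=> [_ [_ [a Aa ->] ->]|_ [a Aa ->]].
  by exists a => //; rewrite mulrA.
by exists (v * a); [exists a|rewrite mulrA].
Qed.

Lemma scale1 A : scale 1 A = A.
Proof.
apply/seteqP; split=> [_ [a Aa ->]|a Aa]; first by rewrite mul1r.
by exists a; rewrite ?mul1r.
Qed.

Lemma image_ring_submodule : submodule (image_ring R).
Proof.
split.
- by exists 0 => //; rewrite rmorph0.
- by move=> _ _ [a _ <-] [b _ <-]; exists (a + b) => //; rewrite rmorphD.
- by move=> r _ [a _ <-]; exists (r * a) => //; rewrite rmorphM.
Qed.

(** Strict chains of submodules of [Q] measure the length of [B / A] without forming quotient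
    modules. *)
Inductive chain A : set Q -> nat -> Prop :=
| chain0 : submodule A -> chain A A 0
| chainS B C n : chain A B n -> submodule C -> B `<` C -> chain A C n.+1.

Lemma chainP A B n : chain A B n -> [/\ submodule A, submodule B & A `<=` B].
Proof.
elim=> [sA|{}B C k _ [sA sB AB] sC [BC _]] //; split=> //.
exact: subset_trans BC.
Qed.

Lemma chain_cat A B C m n : chain A B m -> chain B C n -> chain A C (n + m).
Proof.
move=> cAB; elim=> // D E k _ cD sE DE; rewrite addSn.
exact: chainS DE.
Qed.

Lemma chain_cons A B C n : submodule A -> A `<` B -> chain B C n -> chain A C n.+1.
Proof.
move=> sA AB cBC; have [sB _ _] := chainP cBC; rewrite -addn1.
by apply: chain_cat cBC; apply: chainS AB => //; apply: chain0.
Qed.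

Lemma chain_le A B : submodule A -> submodule B -> A `<=` B -> exists k, chain A B k.
Proof.
move=> sA sB AB; have [BA|nBA] := pselect (B `<=` A).
  by exists 0%N; rewrite (_ : B = A); [apply: chain0|apply/seteqP].
by exists 1%N; apply: (@chainS A A) => //; apply: chain0.
Qed.

(* The modular law: a proper inclusion stays proper after intersecting with B *)
(* or after adding B.                                                          *)
Lemma chain_modular A B C n : submodule B -> chain A C n ->
  exists k l, [/\ chain (A `&` B) (C `&` B) k,
    chain (ideal_add A B) (ideal_add C B) l & (n <= k + l)%N].
Proof.
move=> sB; elim=> [sA|{}C D m cAC [k [l [ck cl mkl]]] sD [CD nDC]].
  by exists 0%N, 0%N; split=> //; apply: chain0; [apply: submodule_setI|apply: submodule_add].
have [_ sCB _] := chainP ck; have [_ sCB' _] := chainP cl.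
have sDB := submodule_setI sD sB; have sDB' := submodule_add sD sB.
have [k' ck'] : exists k', chain (C `&` B) (D `&` B) k' /\
    ((D `&` B `<=` C `&` B) \/ (0 < k')%N).
  have [sub|nsub] := pselect (D `&` B `<=` C `&` B).
    have [|k' ?] := chain_le sCB sDB; first exact: setSI.
    by exists k'; split=> //; left.
  exists 1%N; split; last by right.
  apply: chainS (chain0 sCB) sDB _; split=> //; exact: setSI.
have subCB : ideal_add C B `<=` ideal_add D B.
  by move=> _ [c [b [Cc Bb ->]]]; exists c, b; split=> //; apply: CD.
have [l' cl'] : exists l', chain (ideal_add C B) (ideal_add D B) l' /\
    ((ideal_add D B `<=` ideal_add C B) \/ (0 < l')%N).
  have [sub|nsub] := pselect (ideal_add D B `<=` ideal_add C B).
    have [//|l' ?] := chain_le sCB' sDB'.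
    by exists l'; split=> //; left.
  exists 1%N; split; last by right.
  exact: chainS (chain0 sCB') sDB' _.
exists (k' + k)%N, (l' + l)%N; split.
- exact: chain_cat ck ck'.1.
- exact: chain_cat cl cl'.1.
suff : (0 < k')%N \/ (0 < l')%N by lia.
case: ck' => _ [sub1|]; last by left.
case: cl' => _ [sub2|]; last by right.
case: nDC => d Dd.
have [c [b [Cc Bb e]]] : ideal_add C B d by apply/sub2/submodule_addl.
have Db : D b.
  have -> : b = d - c by rewrite e addrC addKr.
  by apply: submoduleB => //; apply: CD.
have [Cb _] := sub1 b (conj Db Bb).
by rewrite e; apply: submoduleD => //; have [] := chainP cAC.
Qed.

(* len A B n says that the R-module B / A has length n, and blen A B n that its *)
(* length is at most n.                                                         *)
Definition blen A B n := forall k, chain A B k -> (k <= n)%N.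
Definition len A B n := chain A B n /\ blen A B n.

(** By the modular law a chain from [A] to [C] splits into its traces on [B], from [A] to [B], and
    its sums with [B], from [B] to [C]. *)
Lemma blen_add A B C n m : submodule B -> A `<=` B -> B `<=` C ->
  blen A B n -> blen B C m -> blen A C (n + m).
Proof.
move=> sB AB BC bAB bBC k ck; have [sA sC _] := chainP ck.
have [i [j [ci cj kij]]] := chain_modular sB ck.
have eAB : A `&` B = A by apply/setIidPl.
have eCB : C `&` B = B by apply/setIidPr.
have eAB' : ideal_add A B = B.
  apply/seteqP; split; last exact: submodule_addr.
  exact: submodule_add_min.
have eCB' : ideal_add C B = C.
  apply/seteqP; split; last exact: submodule_addl.
  exact: submodule_add_min.
rewrite eAB eCB in ci; rewrite eAB' eCB' in cj.
by apply: leq_trans kij _; apply: leq_add; [apply: bAB|apply: bBC].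
Qed.

Lemma len_exists A B N : submodule A -> submodule B -> A `<=` B -> blen A B N ->
  exists n, len A B n.
Proof.
move=> sA sB AB bN.
have ex : exists n, (fun n => `[< chain A B n >]) n.
  by have [k ck] := chain_le sA sB AB; exists k; apply/asboolP.
have bd n : (fun n => `[< chain A B n >]) n -> (n <= N)%N by move=> /asboolP/bN.
case: (ex_maxnP ex bd) => n /asboolP cn nmax; exists n; split=> // k ck.
exact/nmax/asboolP.
Qed.

Lemma len_uniq A B n m : len A B n -> len A B m -> n = m.
Proof.
by move=> [cn bn] [cm bm]; apply/eqP; rewrite eqn_leq (bn _ cm) (bm _ cn).
Qed.

Lemma len_add A B C n m : len A B n -> len B C m -> len A C (n + m).
Proof.
move=> [cn bn] [cm bm]; have [sA sB AB] := chainP cn; have [_ sC BC] := chainP cm.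
by split; [rewrite addnC; apply: chain_cat cn cm|apply: blen_add bn bm].
Qed.

Lemma blen_sub A B C D n : submodule A -> submodule D -> A `<=` B -> C `<=` D ->
  blen A D n -> blen B C n.
Proof.
move=> sA sD AB CD bn k ck; have [sB sC _] := chainP ck.
have [i ci] := chain_le sA sB AB; have [j cj] := chain_le sC sD CD.
by have := bn _ (chain_cat ci (chain_cat ck cj)); lia.
Qed.

Lemma chain_proper A B n : chain A B n.+1 -> A `<` B.
Proof.
move=> c; inversion c as [|C D m cAC sD [CD nDC]]; subst.
have [_ _ sAC] := chainP cAC; split; first exact: subset_trans CD.
by move=> BA; apply: nDC; apply: subset_trans sAC.
Qed.

Lemma blen0 A : blen A A 0.
Proof. by move=> [//|k] /chain_proper[_ nAA]; case: nAA. Qed.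

Lemma chain_map A B n (phi : set Q -> set Q) :
  (forall C, submodule C -> A `<=` C -> C `<=` B -> submodule (phi C)) ->
  (forall C D, submodule C -> submodule D -> A `<=` C -> C `<` D -> D `<=` B ->
    phi C `<` phi D) ->
  chain A B n -> chain (phi A) (phi B) n.
Proof.
move=> sphi mphi c; elim: c sphi mphi => [sA|{}B C k cAB IH sC BC] sphi mphi.
  by apply/chain0/sphi.
have [sA sB AB] := chainP cAB; have [BC' _] := BC.
apply: chainS.
- apply: IH => [D sD AD DB|D E sD sE AD DE EB].
    by apply: sphi => //; apply: subset_trans BC'.
  by apply: mphi => //; apply: subset_trans BC'.
- by apply: sphi => //; apply: subset_trans BC'.
- by apply: mphi => // ?.
Qed.

Lemma chain_rev A B n (phi : set Q -> set Q) :
  (forall C, submodule C -> A `<=` C -> C `<=` B -> submodule (phi C)) ->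
  (forall C D, submodule C -> submodule D -> A `<=` C -> C `<` D -> D `<=` B ->
    phi D `<` phi C) ->
  chain A B n -> chain (phi B) (phi A) n.
Proof.
move=> sphi mphi c; elim: c sphi mphi => [sA|{}B C k cAB IH sC BC] sphi mphi.
  by apply/chain0/sphi.
have [sA sB AB] := chainP cAB; have [BC' _] := BC.
apply: chain_cons.
- exact: (sphi _ sC (subset_trans AB BC')).
- exact: (mphi _ _ sB sC AB BC).
- apply: IH => [D sD AD DB|D E sD sE AD DE EB].
    by apply: sphi => //; apply: subset_trans BC'.
  by apply: mphi => //; apply: subset_trans BC'.
Qed.

Lemma chain_scale u A B n : u \is a GRing.unit -> chain A B n ->
  chain (scale u A) (scale u B) n.
Proof.
move=> uu; apply: chain_map => [C sC _ _|C D sC sD _ [CD nDC] _].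
  exact: submodule_scale.
split; first exact: scale_sub.
by move=> DC; apply: nDC => d Dd; have [c Cc /(mulrI uu) ->] : scale u C (u * d)
  by apply: DC; exists d.
Qed.

Lemma blen1 A B : (forall C, submodule C -> A `<=` C -> C `<=` B -> C = A \/ C = B) ->
  blen A B 1.
Proof.
move=> H [//|[//|k]] c; inversion c as [|C D m cAC sD CB]; subst.
have [_ sC _] := chainP cAC; have /chain_proper[sAC nCA] := cAC.
have [sCB nBC] := CB.
by case: (H C sC sAC sCB) => e; [case: nCA|case: nBC]; rewrite e.
Qed.

Lemma len1 A B : submodule A -> submodule B -> A `<` B ->
  (forall C, submodule C -> A `<=` C -> C `<=` B -> C = A \/ C = B) ->
  len A B 1.
Proof.
move=> sA sB AB H; split; last exact: blen1.
by apply: chainS AB => //; apply: chain0.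
Qed.

End Lengths.

(** * Finite length modulo a regular element *)

Section FiniteLength.
Variable R : comNzRingType.
Local Notation Q := (total_frac R).
Local Notation emb := (@to_total R).
Local Notation R0 := (image_ring R).
Hypothesis HN : noetherian R.
Hypothesis Hdim : krull_dim R 1.

Lemma image_submodule (I : set R) : ideal setT I -> submodule (emb @` I).
Proof.
move=> [_ I0 ID IM]; split.
- by exists 0 => //; rewrite rmorph0.
- by move=> _ _ [a Ia <-] [b Ib <-]; exists (a + b); [exact: ID|rewrite rmorphD].
- by move=> r _ [a Ia <-]; exists (r * a); [exact: IM|rewrite rmorphM].
Qed.

Lemma preimage_ideal (E : set Q) a : submodule E -> ideal setT [set r | E (emb (r * a))].
Proof.
move=> sE; split=> //=.
- by rewrite mul0r rmorph0; apply: submodule0.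
- by move=> x y Ex Ey; rewrite mulrDl rmorphD; apply: submoduleD.
- by move=> r x _ Ex; rewrite -mulrA rmorphM; apply: submoduleM.
Qed.

Lemma image_embP (I : set R) r : (emb @` I) (emb r) <-> I r.
Proof.
by split=> [[s Is /to_total_inj <-]//|Ir]; exists r.
Qed.

(** Noetherian induction: let [M] be maximal among the ideals containing [b] with no bound on the
    length of [R / M]. If [M] is prime it is maximal, by dimension one, and the length is 1.
    Otherwise [a a'] lies in [M] with neither factor in [M], and [R / M] is an extension of
    [R / (M + (a))] by a copy of [R / (M : a)], both of bounded length. *)
Lemma finite_length (b : R) : GRing.lreg b ->
  exists n, blen (scale (emb b) R0) R0 n.
Proof.
move=> rb.
suff H I : ideal setT I -> I b -> exists n, blen (emb @` I) R0 n.
  have [n bn] := H _ (principal_ideal b) (principal_self b); exists n.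
  rewrite (_ : scale _ _ = emb @` principal b) //.
  apply/seteqP; split=> [_ [_ [r _ <-] ->]|_ [_ [r _ <-] <-]].
    by exists (r * b); [exists r|rewrite rmorphM mulrC].
  by exists (emb r); [exists r|rewrite rmorphM mulrC].
move=> iI Ib; apply: contrapT => nI.
have [||M [iM Mb nM] Mmax] := @noetherian_max _ HN
  [set I | [/\ ideal setT I, I b & ~ exists n, blen (emb @` I) R0 n]].
- by move=> ? [].
- by exists I.
have sR := image_ring_submodule R.
have sM := image_submodule iM.
have [_ M0 MD MM] := iM.
have bigger J : ideal setT J -> M `<=` J -> ~ J `<=` M -> exists n, blen (emb @` J) R0 n.
  move=> iJ MJ nJM; apply: contrapT => nJ; apply: nJM.
  by rewrite (Mmax J) //; split=> //; apply: MJ.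
have M1 : ~ M 1.
  move=> M1; apply: nM; exists 0%N; rewrite (_ : emb @` M = R0); first exact: blen0.
  apply/seteqP; split=> _ [r _ <-]; exists r => //.
  by rewrite -[r]mulr1; apply: MM.
have [pM|npM] := pselect (prime_ideal setT M).
  have [_ _ mmax] := regular_prime_maximal HN Hdim pM rb Mb.
  apply: nM; exists 1%N; apply: blen1 => C sC MC CR.
  have eC : emb @` [set r | C (emb (r * 1))] = C.
    apply/seteqP; split=> [_ [r /= Cr <-]|c Cc]; first by rewrite -[r]mulr1.
    by have [r _ e] := CR c Cc; exists r => //=; rewrite mulr1 e.
  have MJ : M `<=` [set r | C (emb (r * 1))].
    by move=> r Mr /=; rewrite mulr1; apply: MC; exists r.
  rewrite -eC; case: (mmax _ (preimage_ideal 1 sC) MJ) => ->; first by left.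
  by right.
have [a [a' [Maa na na']]] : exists a a', [/\ M (a * a'), ~ M a & ~ M a'].
  apply: contrapT => nex; apply: npM; split=> //.
    exact/ideal_neqP.
  move=> a a' _ _ Maa; apply: contrapT => /not_orP[na na'].
  by apply: nex; exists a, a'.
have i1 := ideal_add_ideal iM (principal_ideal a).
have M1' : M `<=` ideal_add M (principal a) by apply/ideal_addl/principal_ideal.
have [n1 b1] : exists n, blen (emb @` ideal_add M (principal a)) R0 n.
  apply: bigger => // sub; apply: na; apply: sub.
  by apply: ideal_addr => //; apply: principal_self.
have [n2 b2] : exists n, blen (emb @` [set r | M (r * a)]) R0 n.
  apply: bigger; first exact: ideal_quo_ideal.
    by move=> r Mr /=; rewrite mulrC; apply: MM.
  by move=> sub; apply: na'; apply: sub; rewrite /= mulrC.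
apply: nM; exists (n2 + n1)%N; apply: (@blen_add _ _ (emb @` ideal_add M (principal a))) => //.
- exact: image_submodule.
- by move=> _ [r Mr <-]; exists r => //; apply: M1'.
- by move=> _ [r _ <-]; exists r.
move=> k ck; apply: b2.
(* Taking [C : a] is strictly monotone on the submodules between [M] and [M + (a)]. *)
pose phi (C : set Q) : set Q := emb @` [set r | C (emb (r * a))].
have -> : emb @` [set r | M (r * a)] = phi (emb @` M).
  apply/seteqP; split=> _ [r Mr <-]; exists r => //=; first exact/image_embP.
  by have /image_embP := Mr.
have -> : R0 = phi (emb @` ideal_add M (principal a)).
  apply/seteqP; split=> _ [r Mr <-]; exists r => //=; apply/image_embP.
  by apply: ideal_addr => //; exists r.
apply: chain_map ck => [C sC _ _|C D sC sD MC [CD nDC] DM].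
  exact/image_submodule/preimage_ideal.
split=> [_ [r Cr <-]|sub]; first by exists r => //; apply: CD.
apply: nDC => d Dd; have [_ [m [_ [Mm [r _ <-] ->]]] e] := DM d Dd.
have Cm : C (emb m) by apply: MC; exists m.
rewrite -e rmorphD; apply: submoduleD => //.
apply/(image_embP [set r | C (emb (r * a))])/sub; exists r => //=.
have -> : emb (r * a) = d - emb m by rewrite -e rmorphD addrC addKr.
by apply: submoduleB => //; apply: CD.
Qed.

End FiniteLength.

Section ChainConditions.
Variable R : comNzRingType.
Local Notation Q := (total_frac R).
Implicit Types (A B C D E : set Q).

Lemma blen_dcc A n (C : nat -> set Q) : submodule A ->
  (forall i, submodule (C i)) -> (forall i, A `<=` C i) ->
  (forall i, C i.+1 `<=` C i) -> blen A (C 0%N) n ->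
  exists N, forall i, (N <= i)%N -> C N `<=` C i.
Proof.
move=> sA sC AsC Cdec bn.
have dec i j : (i <= j)%N -> C j `<=` C i.
  move=> /subnK <-; elim: (j - i)%N => // k IHk.
  by rewrite addSn; apply: subset_trans IHk; apply: Cdec.
pose p k := `[< exists i, chain (C i) (C 0%N) k >].
have ex : exists k, p k by exists 0%N; apply/asboolP; exists 0%N; apply: chain0.
have bd k : p k -> (k <= n)%N.
  by move=> /asboolP[i ck]; have := blen_sub sA (sC 0%N) (AsC i) (@subset_refl _ _) bn ck.
case: (ex_maxnP ex bd) => k /asboolP[N ck] kmax.
exists N => i Ni; apply: contrapT => nsub.
have : p k.+1.
  by apply/asboolP; exists i; apply: chain_cons ck => //; split=> //; apply: dec.
by move=> /kmax; rewrite ltnn.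
Qed.

End ChainConditions.

(** * Finiteness of the integral closure *)

Section IntegralClosure.
Variable R : comNzRingType.
Local Notation Q := (total_frac R).
Local Notation emb := (@to_total R).
Local Notation R0 := (image_ring R).
Local Notation Rbar := (integral_closure R).
Hypothesis HN : noetherian R.
Hypothesis Hdim : krull_dim R 1.
Variable x : R.
Hypothesis Jx : jacobson R x.
Hypothesis rx : GRing.lreg x.
Local Notation xq := (emb x).

Lemma integral_closureD w v : Rbar w -> Rbar v -> Rbar (w + v).
Proof. exact: (@integral_add _ _ emb w v). Qed.

Lemma integral_closureB w v : Rbar w -> Rbar v -> Rbar (w - v).
Proof. exact: (@integral_sub _ _ emb w v). Qed.

Lemma integral_closureM w v : Rbar w -> Rbar v -> Rbar (w * v).
Proof. exact: (@integral_mul _ _ emb w v). Qed.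

Lemma integral_closure_emb r : Rbar (emb r).
Proof. exact: (@integral_id _ _ emb r). Qed.

Definition powers_span (w : Q) n : set Q :=
  [set y | exists a : nat -> R, y = \sum_(i < n) emb (a i) * w ^+ i].

Lemma integral_closureP w : Rbar w <-> exists k, powers_span w k (w ^+ k).
Proof.
split=> [[p pmon pw]|[k [a ea]]].
  exists (size p).-1, (fun i => - p`_i).
  have sp : (0 < size p)%N by rewrite lt0n size_poly_eq0 monic_neq0.
  move: pw; rewrite rootE (@horner_coef_wide _ (size p)); last exact: size_poly.
  have := monicP pmon; rewrite lead_coefE.
  case: (size p) sp => [//|d] /= _ ld.
  rewrite big_ord_recr /= !coef_map /= ld rmorph1 mul1r addrC addr_eq0 => /eqP ->.
  by rewrite -sumrN; apply: eq_bigr => i _; rewrite coef_map rmorphN mulNr.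
exists ('X^k - \poly_(i < k) a i).
  rewrite monicE lead_coefDl ?lead_coefXn // size_polyXn size_polyN ltnS.
  exact: size_poly.
rewrite /root rmorphB /= map_polyXn !hornerE ea.
rewrite (@horner_coef_wide _ k); last first.
  by apply: leq_trans (size_poly _ _) _; apply: size_poly.
rewrite subr_eq0; apply/eqP; apply: eq_bigr => i _.
by rewrite coef_map coef_poly ltn_ord.
Qed.

Lemma emb_unit : xq \is a GRing.unit.
Proof. exact: total_unit_lreg. Qed.

Lemma embX_unit n : xq ^+ n \is a GRing.unit.
Proof. exact/unitrX/emb_unit. Qed.

(** Every regular element divides a power of [x], so [Q] is [R] with [x] inverted. *)
Lemma total_pow_frac (q : Q) : exists k r, xq ^+ k * q = emb r.
Proof.
have [a [b [rb e]]] := total_fracP q.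
have [k [r _ er]] := regular_power HN Hdim rb Jx.
by exists k, (r * a); rewrite -rmorphXn -er !rmorphM /= -e; ring.
Qed.

Lemma total_pow_le k l q r : (k <= l)%N -> xq ^+ k * q = emb r ->
  xq ^+ l * q = emb (x ^+ (l - k) * r).
Proof. by move=> /subnK <- e; rewrite addnK rmorphM /= -e rmorphXn exprD; ring. Qed.

(** Multiplication by [x] makes [W / R] and [xW / xR] equally long; comparing the ways from [xR] to
    [W] through [R] and through [xW] bounds [W / xW] by [R / xR]. *)
Lemma blen_overmodule e (W : set Q) m : len (scale xq R0) R0 e ->
  submodule W -> R0 `<=` W -> scale (xq ^+ m) W `<=` R0 -> blen (scale xq W) W e.
Proof.
move=> [ce be] sW RW WR k ck.
have sR := image_ring_submodule R.
have [p [cp bp]] : exists p, len R0 W p.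
  have rxm : GRing.lreg (x ^+ m) by exact: lregX.
  have [n bn] := finite_length HN Hdim rxm.
  apply: (@len_exists _ _ _ n) => // j cj.
  have cj' := chain_scale (embX_unit m) cj.
  rewrite rmorphXn /= in bn.
  exact: (blen_sub (submodule_scale _ sR) sR (@subset_refl _ _) WR bn cj').
have c1 := chain_cat (chain_scale emb_unit cp) ck.
have sxR := submodule_scale xq sR.
have [_ _ xRR] := chainP ce.
by have := blen_add sR xRR RW be bp c1; lia.
Qed.

Lemma powers_span_submodule w n : submodule (powers_span w n).
Proof.
split.
- by exists (fun=> 0); rewrite big1 // => i _; rewrite rmorph0 mul0r.
- move=> _ _ [a ->] [b ->]; exists (fun i => a i + b i).
  by rewrite -big_split; apply: eq_bigr => i _; rewrite rmorphD mulrDl.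
- move=> r _ [a ->]; exists (fun i => r * a i).
  by rewrite mulr_sumr; apply: eq_bigr => i _; rewrite rmorphM mulrA.
Qed.

Lemma powers_span_pow w n i : (i < n)%N -> powers_span w n (w ^+ i).
Proof.
move=> ni; exists (fun j => (j == i)%:R).
rewrite (bigD1 (Ordinal ni)) //= eqxx rmorph1 mul1r big1 ?addr0 // => j.
by rewrite -val_eqE /= => /negbTE ->; rewrite rmorph0 mul0r.
Qed.

Lemma powers_span_min w n (E : set Q) : submodule E ->
  (forall i, (i < n)%N -> E (w ^+ i)) -> powers_span w n `<=` E.
Proof.
move=> sE Ew _ [a ->]; apply: submodule_sum => // i _.
by apply: submoduleM => //; apply: Ew.
Qed.

Lemma powers_span_mulX w n k y : powers_span w n y ->
  powers_span w (n + k) (w ^+ k * y).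
Proof.
move=> [a ->]; rewrite mulr_sumr; apply: submodule_sum.
  exact: powers_span_submodule.
move=> i _; rewrite mulrCA -exprD; apply: submoduleM.
  exact: powers_span_submodule.
by apply: powers_span_pow; rewrite addnC ltn_add2r.
Qed.

(** Put [W = R[w]]. As [W / xW] has length at most [e], the submodules [C j], spanned by [xW] and
    the first [j] powers of [w], become stable at some [j <= e + 1]. Then [W] is the span of these
    [j] powers plus [xW], hence plus [x^m W] for all [m], and for large [m] the last summand lies in
    [R]. *)
Lemma integral_degree e w : len (scale xq R0) R0 e -> Rbar w ->
  powers_span w e.+1 (w ^+ e.+1).
Proof.
move=> le /integral_closureP[d wd].
have d0 : (0 < d)%N.
  case: d wd => // -[a]; rewrite big_ord0 expr0 => /eqP.
  by rewrite oner_eq0.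
have sR := image_ring_submodule R.
set W := powers_span w d; have sW : submodule W by apply: powers_span_submodule.
have wW y : W y -> W (w * y).
  move=> /(powers_span_mulX 1); rewrite expr1 addn1; apply: powers_span_min => // i.
  by rewrite ltnS leq_eqVlt => /predU1P[->//|id]; apply: powers_span_pow.
have Ww i : W (w ^+ i).
  elim: i => [|i IHi]; first exact: powers_span_pow.
  by rewrite exprS; apply: wW.
have spanW j : powers_span w j `<=` W by apply: powers_span_min.
have R1 j y : (0 < j)%N -> R0 y -> powers_span w j y.
  move=> j0 [r _ <-]; rewrite -[emb r]mulr1; apply: submoduleM.
    exact: powers_span_submodule.
  exact: (@powers_span_pow _ _ 0%N).
have RW : R0 `<=` W by move=> y; apply: R1.
have [m WR] : exists m, scale (xq ^+ m) W `<=` R0.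
  suff [m mP] : exists m, forall i, (i < d)%N -> R0 (xq ^+ m * w ^+ i).
    exists m => _ [y Wy ->].
    have : scale (xq ^+ m) W (xq ^+ m * y) by exists y.
    move: Wy => [a ->] _; rewrite mulr_sumr; apply: submodule_sum => // i _.
    by rewrite mulrCA; apply: submoduleM => //; apply: mP.
  move: (d) => n; elim: n => [|n [m mP]]; first by exists 0%N.
  have [k [r er]] := total_pow_frac (w ^+ n).
  exists (maxn m k) => i; rewrite ltnS leq_eqVlt => /predU1P[->|/(mP i)[s _ es]].
    by rewrite (total_pow_le (leq_maxr m k) er); eexists.
  by rewrite (total_pow_le (leq_maxl m k) (esym es)); eexists.
have bW := blen_overmodule le sW RW WR.
pose C j := ideal_add (powers_span w j) (scale xq W).
have sxW := submodule_scale xq sW.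
have xWW : scale xq W `<=` W by move=> _ [y Wy ->]; apply: submoduleM.
have sC j : submodule (C j) by apply: submodule_add => //; apply: powers_span_submodule.
have CW j : C j `<=` W by apply: submodule_add_min.
have spanS j : powers_span w j `<=` powers_span w j.+1.
  apply: powers_span_min; first exact: powers_span_submodule.
  by move=> i ij; apply: powers_span_pow; apply: leq_trans ij _.
have CS j : C j `<=` C j.+1.
  by move=> _ [y [z [jy Wz ->]]]; exists y, z; split=> //; apply: spanS.
(* The search starts at [j = 1] so that the span contains [R]; failure would give [e + 1] strict
   steps in [W / xW]. *)
have [j [j0 je Cj]] : exists j, [/\ (0 < j)%N, (j <= e.+1)%N & C j.+1 `<=` C j].
  apply: contrapT => nj.
  have ch k : (k <= e.+1)%N -> chain (C 1%N) (C k.+1) k.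
    elim: k => [_|k IHk ke]; first exact: chain0.
    apply: chainS (IHk (ltnW ke)) (sC _) _; split; first exact: CS.
    by move=> sub; apply: nj; exists k.+1.
  have b1 := blen_sub sxW sW _ (CW e.+2) bW (ch _ (leqnn _)).
  have : (e.+1 <= e)%N by apply: b1; apply: submodule_addr; apply: powers_span_submodule.
  by rewrite ltnn.
have sj := powers_span_submodule w j.
have Cw i : C j (w ^+ i).
  elim: i => [|i [y [z [jy [z' Wz' ->] ew]]]].
    by apply: submodule_addl => //; apply: powers_span_pow.
  rewrite exprS ew mulrDr; apply: submoduleD => //.
    apply/Cj/submodule_addl => //.
    by have := powers_span_mulX 1 jy; rewrite expr1 addn1.
  apply: submodule_addr => //; exists (w * z'); first exact: wW.
  by rewrite mulrCA.
have WC : W `<=` C j by apply: powers_span_min.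
have Wk k y : W y -> exists s z, [/\ powers_span w j s, W z & y = s + xq ^+ k * z].
  elim: k y => [|k IHk] y Wy.
    by exists 0, y; split=> //; [exact: submodule0|rewrite expr0 mul1r add0r].
  have [s [z [js /WC[s' [_ [js' [z' Wz' ->] ->]]] ->]]] := IHk y Wy.
  exists (s + xq ^+ k * s'), z'; split=> //; last by rewrite exprSr; ring.
  by apply: submoduleD => //; rewrite -rmorphXn; apply: submoduleM.
have Wj y : W y -> powers_span w j y.
  move=> /(Wk m)[s [z [js Wz ->]]]; apply: submoduleD => //.
  by apply: R1 => //; apply: WR; exists z.
by have := powers_span_mulX (e.+1 - j) (Wj _ (Ww j)); rewrite -exprD subnK // subnKC.
Qed.

(** Multiplying the monic equation of [w] by [x^(k (e + 1))] gives one for [r] whose lower terms are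
    all divisible by [x^k]. The exponent [e + 1] is the same for all [k]. *)
Lemma pow_mem_of_integral e k r w : len (scale xq R0) R0 e -> Rbar w ->
  emb r = xq ^+ k * w -> principal (x ^+ k) (r ^+ e.+1).
Proof.
move=> le Rw er; have [a ea] := integral_degree le Rw.
exists (\sum_(i < e.+1) a i * x ^+ (k * (e - i)) * r ^+ i) => //.
apply: (@to_total_inj R); rewrite rmorphM !rmorphXn /= er exprMn ea.
rewrite rmorph_sum mulr_sumr mulr_suml; apply: eq_bigr => i _.
rewrite !rmorphM !rmorphXn /= er exprMn -!exprM.
have -> : (k * e.+1 = k + k * (e - i) + k * i)%N.
  have := ltn_ord i; rewrite ltnS => ie; rewrite -[in LHS](subnK ie); ring.
by rewrite !exprD; ring.
Qed.

Lemma integral_contraction_ideal n : ideal setT [set r | exists2 w, Rbar w & emb r = xq ^+ n * w].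
Proof.
split=> //.
- by exists 0; rewrite ?rmorph0 ?mulr0 //; rewrite -(rmorph0 emb); exact: integral_closure_emb.
- move=> r s [w Rw er] [v Rv es]; exists (w + v); last by rewrite rmorphD /= er es mulrDr.
  exact: integral_closureD.
- move=> a r _ [w Rw er]; exists (emb a * w); last by rewrite rmorphM /= er mulrCA.
  exact: (integral_closureM (integral_closure_emb a) Rw).
Qed.

Hypothesis Hred : analytically_reduced R.

(* Otherwise, by the descending chain condition modulo the powers of x, there  *)
(* is a Cauchy sequence in R outside xR whose k-th term lies in x^k Rbar; its *)
(* limit is nilpotent in the completion.                                      *)
Lemma integral_contraction_sub : exists n, forall r w, Rbar w -> emb r = xq ^+ n * w ->
  principal x r.
Proof.
apply: contrapT => nex.
pose B n : set R := [set r | exists2 w, Rbar w & emb r = xq ^+ n * w].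
have iB n : ideal setT (B n) by apply: integral_contraction_ideal.
have BS n : B n.+1 `<=` B n.
  move=> r [w Rw er]; exists (xq * w); last by rewrite mulrA -exprSr.
  exact: (integral_closureM (integral_closure_emb x) Rw).
have Bdec i j : (i <= j)%N -> B j `<=` B i.
  move=> /subnK <-; elim: (j - i)%N => // k IHk.
  by rewrite addSn; apply: subset_trans IHk; apply: BS.
have [e0 be0] := finite_length HN Hdim rx.
have sR := image_ring_submodule R.
have xR : scale xq R0 `<=` R0 by move=> _ [y Ry ->]; apply: submoduleM.
have [e le] := len_exists (submodule_scale xq sR) sR xR be0.
(* [R / x^k R] has finite length, so the images of the ideals [B i] in it become stable. *)
have stab k : exists N, forall i r, B N r -> exists r' s, B i r' /\ r = r' + s * x ^+ k.
  have rxk : GRing.lreg (x ^+ k) by exact: lregX.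
  have [n bn] := finite_length HN Hdim rxk.
  pose D i := ideal_add (B i) (principal (x ^+ k)).
  have iD i : ideal setT (D i) by apply/ideal_add_ideal/principal_ideal.
  have [|||||N NP] := @blen_dcc _ (scale (emb (x ^+ k)) R0) n (fun i => emb @` D i).
  - exact: submodule_scale.
  - by move=> i; apply: image_submodule.
  - move=> i _ [_ [s _ <-] ->]; exists (s * x ^+ k); last by rewrite rmorphM mulrC.
    by apply: ideal_addr => //; exists s.
  - move=> i _ [r [b [c [Bb Pc ->]]] <-]; exists (b + c) => //.
    by exists b, c; split=> //; apply: BS.
  - apply: (blen_sub _ sR (@subset_refl _ _) _ bn); first exact: submodule_scale.
    by move=> _ [r _ <-]; exists r.
  exists N => i r Br; have [Ni|iN] := leqP N i; last first.
    by exists r, 0; split; [apply: Bdec Br; apply: ltnW|rewrite mul0r addr0].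
  have /image_embP[b [_ [Bb [s _ <-] ->]]] : (emb @` D i) (emb r).
    by apply: NP => //; apply/image_embP/ideal_addl => //; apply: principal_ideal.
  by exists b, s.
have [N NP] := choice stab.
(* This choice dominates [N k], for stability, and [k], for convergence. *)
pose M k := (\sum_(j < k.+1) N j + k)%N.
have NM k : (N k <= M k)%N by rewrite /M big_ord_recr /=; lia.
have kM k : (k <= M k)%N by rewrite /M; lia.
have MS k i r : B (M k) r -> exists r', B i r' /\ exists s, r' - r = s * x ^+ k.
  move=> /(Bdec _ _ (NM k)) /(NP k i r)[r' [s [Br' ->]]]; exists r'; split=> //.
  by exists (- s); ring.
have [r0 [Br0 nr0]] : exists r, B (M 1%N) r /\ ~ principal x r.
  apply: contrapT => nr; apply: nex; exists (M 1%N) => r w Rw er.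
  by apply: contrapT => nx; apply: nr; exists r; split=> //; exists w.
have step (kr : nat * R) : exists r', B (M kr.1) kr.2 ->
   B (M kr.1.+1) r' /\ exists s, r' - kr.2 = s * x ^+ kr.1.
  have [H|H] := pselect (B (M kr.1) kr.2); last by exists 0.
  by have [r' H'] := MS _ (M kr.1.+1) _ H; exists r'.
have [g gP] := choice step.
pose f := fix f n := if n is n'.+1 then g (n'.+1, f n') else r0.
have fB n : B (M n.+1) (f n).
  by elim: n => //= n IHn; have [] := gP (n.+1, f n) IHn.
have fS n : exists s, f n.+1 - f n = s * x ^+ n.+1.
  by have [] := gP (n.+1, f n) (fB n).
have Jpow k : ideal_pow setT (jacobson R) k (x ^+ k) by apply: ideal_pow_elt.
have iJ k := ideal_pow_ideal_setT k (jacobson_ideal_subproof R).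
have Jmul k a : ideal_pow setT (jacobson R) k (a * x ^+ k).
  by have [_ _ _ JM] := iJ k; apply: JM.
have fJ : forall n, ideal_pow setT (jacobson R) n (f n).
  apply: (@analytically_reduced_reduced _ Hred f e.+1) => n.
    have [s ->] := fS n; rewrite exprS mulrA; exact: Jmul.
  have [w Rw er] := Bdec _ _ (leq_trans (leqnSn n) (kM n.+1)) _ (fB n).
  have [s _ <-] := pow_mem_of_integral le Rw er; exact: Jmul.
have fx n : principal x (f n - f 0%N).
  elim: n => [|n [s _ es]]; first by exists 0 => //; rewrite mul0r subrr.
  have [t et] := fS n; exists (s + t * x ^+ n) => //.
  by rewrite mulrDl es -mulrA -exprSr -et; ring.
have [n Jn] := jacobson_power HN Hdim rx.
(* All terms agree modulo [x], and late terms lie in a power of the radical inside [xR]; so [r0]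
   would be in [xR]. *)
apply: nr0; rewrite -[r0]/(f 0%N) -[f 0%N](subKr (f n)).
by apply: idealB; [exact: principal_ideal|apply/Jn/fJ|exact: fx].
Qed.

(** Dividing by [x] repeatedly, an element of [R] in [x^(n + k) Rbar] lies in [x^(k + 1) R]; with a
    power of [x] that clears the denominator of [w], this puts [x^n w] in [R]. *)
Lemma integral_closure_finite : exists n, forall w, Rbar w -> R0 (xq ^+ n * w).
Proof.
have [n nP] := integral_contraction_sub.
have desc k r w : Rbar w -> emb r = xq ^+ (n + k) * w -> principal (x ^+ k.+1) r.
  elim: k r w => [|k IHk] r w Rw er.
    by rewrite expr1; apply: (nP r w) => //; rewrite er addn0.
  have Rxw : Rbar (xq ^+ k.+1 * w).
    apply: (fun u => integral_closureM u Rw); rewrite -rmorphXn; exact: integral_closure_emb.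
  have [s _ es] := nP r _ Rxw ltac:(by rewrite er exprD mulrA).
  have [|t _ et] := IHk s w Rw.
    apply: (mulrI emb_unit); rewrite mulrA -exprS -addnS -er -es rmorphM; ring.
  by exists t => //; rewrite exprSr mulrA et.
exists n => w Rw; have [k [r er]] := total_pow_frac w.
have [kn|nk] := leqP k n.
  by rewrite (total_pow_le kn er); eexists.
have ek : (n + (k - n) = k)%N by lia.
have [|t _ et] := desc (k - n)%N r w Rw; first by rewrite ek.
exists (t * x) => //.
have u := embX_unit (k - n); apply: (mulrI u).
rewrite [RHS]mulrA -exprD addnC ek er -et exprS !rmorphM rmorphXn /=; ring.
Qed.

End IntegralClosure.

(* The properties of A := integral_closure R used below; keeping A abstract     *)
(* prevents unification from unfolding integrality.                             *)
Record normal_extension (R : comNzRingType) (x : R) (A : set (total_frac R)) (N : nat) : Prop :=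
  NormalExtension {
    ne_noetherian : noetherian R;
    ne_dim : krull_dim R 1;
    ne_jacobson : jacobson R x;
    ne_lreg : GRing.lreg x;
    ne_subring : GRing.subring_closed [in A];
    ne_emb : forall r, A (to_total r);
    ne_finite : forall w, A w -> image_ring R (to_total x ^+ N * w);
    ne_integral : forall w k, powers_span w k (w ^+ k) -> A w;
    ne_residual : forall n, maximal_ideal A n -> forall w, A w -> exists r, n (w - to_total r) }.

(** * Maximal ideals of the integral closure *)

Section Dedekind.
Variable R : comNzRingType.
Local Notation Q := (total_frac R).
Local Notation emb := (@to_total R).
Local Notation R0 := (image_ring R).
Variables (x : R) (A : set Q) (N : nat).
Hypothesis H : normal_extension x A N.
Local Notation xq := (emb x).
Local Notation HN := (ne_noetherian H).
Local Notation Hdim := (ne_dim H).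
Local Notation Jx := (ne_jacobson H).
Local Notation rx := (ne_lreg H).
Local Notation sA := (ne_subring H).
Local Notation AN := (ne_finite H).
Local Notation Hres := (ne_residual H).
Implicit Types (n : set Q).

Lemma emb_mem r : A (emb r). Proof. exact: (ne_emb H). Qed.
Hint Resolve emb_mem : core.

Lemma image_ring_sub : R0 `<=` A.
Proof. by move=> _ [r _ <-]; apply: emb_mem. Qed.

Lemma ideal_submodule I : ideal A I -> submodule I.
Proof. by move=> [_ I0 ID IM]; split=> // r y Iy; apply: IM. Qed.

Lemma self_ideal : ideal A A.
Proof.
split=> //; first exact: (subring0 sA).
  by move=> y z; apply: (subringD sA).
by move=> y z; apply: (subringM sA).
Qed.

Lemma extension_submodule : submodule A.
Proof. exact: ideal_submodule self_ideal. Qed.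

Lemma blen_extension : exists e, blen (scale xq A) A e.
Proof.
have sR := image_ring_submodule R.
have [e0 be0] := finite_length HN Hdim rx.
have xR : scale xq R0 `<=` R0 by move=> _ [y Ry ->]; apply: submoduleM.
have [e le] := len_exists (submodule_scale xq sR) sR xR be0.
exists e; apply: (blen_overmodule HN Hdim rx le extension_submodule image_ring_sub (m := N)).
by move=> _ [w Aw ->]; apply: AN.
Qed.

(** Multiplication by [x^N] maps [A] into [R], so submodules of [A] correspond to certain ideals of
    [R]. *)
Lemma submodule_max (P : set (set Q)) :
  (forall E, P E -> submodule E /\ E `<=` A) -> P !=set0 ->
  exists2 M, P M & forall E, P E -> M `<=` E -> E = M.
Proof.
move=> PP [E0 PE0].
pose pre E := [set r | scale (xq ^+ N) E (emb (r * 1))].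
have preE E : P E -> E = [set y | exists2 r, pre E r & emb r = xq ^+ N * y].
  move=> PE; have [sE EA] := PP _ PE; apply/seteqP; split=> [y Ey|y [r [z Ez]]].
    have [r _ er] := AN (EA _ Ey); exists r => //.
    by exists y => //; rewrite mulr1.
  by rewrite mulr1 => -> /(mulrI (embX_unit rx N)) <-.
have [||_ [M PM <-] Mmax] := @noetherian_max _ HN [set pre E | E in P].
- by move=> _ [E PE <-]; apply/preimage_ideal/submodule_scale; case: (PP _ PE).
- by exists (pre E0); exists E0.
exists M => // E PE ME; rewrite (preE E PE) (preE M PM).
suff -> : pre E = pre M by [].
apply: Mmax; first by exists E.
by move=> r; apply: scale_sub.
Qed.

Lemma integral_in_maximal I : ideal A I -> ~ I 1 ->
  exists2 n, maximal_ideal A n & I `<=` n.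
Proof.
move=> iI I1.
have [||n [iN n1 In] nmax] := @submodule_max [set J | [/\ ideal A J, ~ J 1 & I `<=` J]].
- by move=> J [iJ _ _]; split; [exact: ideal_submodule|case: iJ].
- by exists I; split.
exists n => //; split=> //; first exact/(ideal_neqP (subring1 sA) iN).
move=> J iJ nJ; have [J1|nJ1] := pselect (J 1).
  right; apply: contrapT => JA.
  by have /(ideal_neqP (subring1 sA) iJ) := JA.
by left; apply: nmax => //; split=> //; apply: subset_trans nJ.
Qed.

Lemma ideal_full I : ideal A I -> (forall n, maximal_ideal A n -> ~ I `<=` n) -> I 1.
Proof.
by move=> iI nI; apply: contrapT => /(integral_in_maximal iI)[n /nI].
Qed.

Definition contraction n : set R := [set r | n (emb r)].

(** By residual rationality the inverse modulo [n] of an element of [R] can be taken in [R]. *)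
Lemma contraction_maximal n : maximal_ideal A n -> maximal_ideal setT (contraction n).
Proof.
move=> mn; have [[nA n0 nD nM] _ _] := mn.
have n1 := maximal_ideal1 sA mn.
have ic : ideal setT (contraction n).
  split=> //.
  - by move=> r s nr ns; rewrite -[contraction n _]/(n (emb (r + s))) rmorphD; apply: nD.
  - by move=> a r _ nr; rewrite -[contraction n _]/(n (emb (a * r))) rmorphM /=; apply: nM.
split=> //; first by apply/ideal_neqP => //; rewrite -[contraction n _]/(n (emb 1)) rmorph1.
move=> J iJ cJ; have [Jc|nJc] := pselect (J `<=` contraction n).
  by left; apply/seteqP.
right; apply: contrapT => JT.
have /(ideal_neqP Logic.I iJ) := JT; apply.
have [r [Jr nr]] : exists r, J r /\ ~ n (emb r).
  by apply: contrapT => E; apply: nJc => r Jr; apply: contrapT => nr; apply: E; exists r.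
have [b Ab nb] := maximal_ideal_inv sA mn (emb_mem r) nr.
have [s ns] := Hres mn Ab.
have [_ _ JD JM] := iJ.
have -> : (1 : R) = (1 - s * r) + s * r by rewrite subrK.
apply: JD; last exact: JM.
apply: cJ; rewrite -[contraction n _]/(n (emb (1 - s * r))) rmorphB rmorphM rmorph1 /=.
have -> : 1 - emb s * emb r = (1 - b * emb r) + emb r * (b - emb s) by ring.
by apply: nD => //; apply: nM.
Qed.

Lemma maximal_xq n : maximal_ideal A n -> n xq.
Proof. by move=> /contraction_maximal mc; apply: Jx mc. Qed.

Lemma maximal_scale n : maximal_ideal A n -> scale xq A `<=` n.
Proof.
move=> mn _ [a Aa ->]; apply: (ideal_mulr _ (maximal_xq mn) Aa).
by case: mn.
Qed.

(** Intersecting distinct maximal ideals one after another gives a strict chain above [xA], and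
    [A / xA] has finite length. *)
Lemma integral_maximal_seq : exists s : seq (set Q), forall n,
  n \in s <-> maximal_ideal A n.
Proof.
have [e be] := blen_extension.
pose ok (s : seq (set Q)) := uniq s /\ forall n, n \in s -> maximal_ideal A n.
pose meet (s : seq (set Q)) : set Q := [set a | A a /\ forall n, n \in s -> n a].
have smeet s : ok s -> submodule (meet s).
  move=> [_ sm]; split.
  - by split=> [|n /sm[[]]//]; apply: (submodule0 extension_submodule).
  - move=> y z [Ay sy] [Az sz]; split; first exact: (submoduleD extension_submodule).
    by move=> n ns; have [[_ _ nD _] _ _] := sm n ns; apply: nD; [apply: sy|apply: sz].
  - move=> r y [Ay sy]; split; first exact: (submoduleM _ extension_submodule).
    by move=> n ns; have [[_ _ _ nM] _ _] := sm n ns; apply: nM => //; apply: sy.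
have ch s : ok s -> chain (meet s) A (size s).
  elim: s => [|n s IHs] oks.
    rewrite (_ : meet [::] = A); last by apply/seteqP; split=> [? []|? ?].
    exact: (chain0 extension_submodule).
  have oks' : ok s.
    by have [/andP[_ us] sm] := oks; split=> // m ms; apply: sm; rewrite inE ms orbT.
  apply: chain_cons (IHs oks'); first exact: smeet.
  split=> [a [Aa sa]|sub].
    by split=> // m ms; apply: sa; rewrite inE ms orbT.
  have [/andP[/negP ns _] sm] := oks.
  have mn : maximal_ideal A n by apply: sm; rewrite inE eqxx.
  have [m ms|u Au [nu us]] := maximal_ideal_avoid sA (s := s) mn.
    split; first by apply: (oks'.2).
    by move=> e'; apply: ns; rewrite -e'.
  apply: nu; have [_] : meet (n :: s) u by apply: sub; split.
  by apply; rewrite inE eqxx.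
have bd k : (fun k => `[< exists2 s, ok s & size s = k >]) k -> (k <= e)%N.
  move=> /asboolP[s oks <-].
  have xm : scale xq A `<=` meet s.
    move=> y xy; split=> [|n ns]; last by apply: maximal_scale xy; apply: oks.2.
    by move: xy => [a Aa ->]; apply: (submoduleM _ extension_submodule).
  have bs := blen_sub (submodule_scale xq extension_submodule) extension_submodule xm (@subset_refl _ _) be.
  exact: bs (ch s oks).
have ex : exists k, (fun k => `[< exists2 s, ok s & size s = k >]) k.
  by exists 0%N; apply/asboolP; exists [::].
case: (ex_maxnP ex bd) => _ /asboolP[s oks <-] smax; exists s => n.
split=> [|mn]; first exact: oks.2.
apply: contrapT => /negP ns.
suff : (size (n :: s) <= size s)%N by rewrite ltnn.
apply/smax/asboolP; exists (n :: s) => //; split; first by rewrite /= ns oks.1.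
by move=> m; rewrite inE => /predU1P[->//|]; apply: oks.2.
Qed.

(** [A / P] is a domain of finite length: for [a] outside [P] the chain [P + a^k A] stops, so
    [a^M (1 - b a)] is in [P] for some [b], and [a] is invertible modulo [P]. *)
Lemma prime_xq_maximal P : prime_ideal A P -> P xq -> maximal_ideal A P.
Proof.
move=> pP Px; have [iP nPA PP] := pP; have [PA P0 PD PM] := iP.
have P1 := prime_ideal_proper (subring1 sA) pP.
have [e be] := blen_extension.
split=> // J iJ PJ; have [JP|nJP] := pselect (J `<=` P); first by left; apply/seteqP.
right; apply: contrapT => nJA; have /(ideal_neqP (subring1 sA) iJ) := nJA; apply.
have [a [Ja nPa]] : exists a, J a /\ ~ P a.
  by apply: contrapT => E; apply: nJP => a Ja; apply: contrapT => na; apply: E; exists a.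
have [JA _ JD JM] := iJ; have Aa := JA _ Ja.
have Aak k : A (a ^+ k) by apply: (subringX sA).
pose C k := ideal_add P (scale (a ^+ k) A).
have [|||||M MP] := @blen_dcc _ (scale xq A) e C.
- exact: (submodule_scale _ extension_submodule).
- move=> k; apply: submodule_add; first exact: ideal_submodule.
  exact: (submodule_scale _ extension_submodule).
- move=> k _ [b Ab ->]; apply: submodule_addl.
    exact: (submodule_scale _ extension_submodule).
  by rewrite mulrC; apply: PM.
- move=> k _ [p [_ [Pp [b Ab ->] ->]]]; exists p, (a ^+ k * (a * b)).
  by split=> //; [exists (a * b) => //; apply: (subringM sA)|rewrite exprSr; ring].
- apply: (blen_sub (submodule_scale xq extension_submodule) extension_submodule (@subset_refl _ _) _ be).
  move=> _ [p [_ [Pp [b Ab ->] ->]]]; apply: (subringD sA); first exact: PA.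
  exact: (subringM sA).
have [p [_ [Pp [b Ab ->] eM]]] : C M.+1 (a ^+ M).
  apply: MP => //; apply: submodule_addr; first exact: ideal_submodule.
  by exists 1; [exact: (subring1 sA)|rewrite mulr1].
have Pab : P (a ^+ M * (1 - b * a)).
  by rewrite (_ : _ * _ = p) //; apply/eqP; rewrite mulrBr mulr1 {1}eM exprSr; apply/eqP; ring.
have A1 : A (1 - b * a) by apply: (subringB sA); [exact: (subring1 sA)|exact: (subringM sA)].
have P1ba : P (1 - b * a).
  elim: (M) Pab => [|k IHk]; first by rewrite mul1r.
  rewrite exprS -mulrA => /(PP _ _ Aa (subringM sA (Aak k) A1))[//|]; exact: IHk.
by rewrite -(subrK (b * a) 1); apply: JD; [exact: PJ|exact: JM].
Qed.

End Dedekind.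

(** * Generators of the maximal ideals of the integral closure *)

Section Uniformizers.
Variable R : comNzRingType.
Local Notation Q := (total_frac R).
Local Notation emb := (@to_total R).
Local Notation R0 := (image_ring R).
Variables (x : R) (A : set Q) (N : nat).
Hypothesis H : normal_extension x A N.
Local Notation xq := (emb x).
Local Notation HN := (ne_noetherian H).
Local Notation rx := (ne_lreg H).
Local Notation sA := (ne_subring H).
Local Notation AN := (ne_finite H).
Implicit Types (n : set Q).

Let emb_mem' r : A (emb r) := emb_mem H r.
Hint Resolve emb_mem' : core.

(** After multiplication by [x^(N + M)] all powers of [z] lie in [R], so the spans of the first [k]
    powers become stable and [z] is integral. *)
Lemma almost_integral z M : (forall k, A (xq ^+ M * z ^+ k)) -> A z.
Proof.
move=> Mz; set c := xq ^+ (N + M).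
have cz k : R0 (c * z ^+ k) by rewrite /c exprD -mulrA; apply/AN/Mz.
pose J k : set R := [set r | scale c (powers_span z k) (emb (r * 1))].
have [||_ [k _ <-] kmax] := @noetherian_max _ HN (range J).
- move=> _ [k _ <-]; apply/preimage_ideal/submodule_scale.
  exact: powers_span_submodule.
- by exists (J 0%N); exists 0%N.
apply: (ne_integral H (k := k)).
have [r _ er] := cz k.
have JJ : J k.+1 = J k.
  apply: kmax; first by exists k.+1.
  move=> s; apply: scale_sub; apply: powers_span_min.
    exact: powers_span_submodule.
  by move=> i ik; apply: powers_span_pow; apply: ltnW.
have : J k.+1 r by exists (z ^+ k); [exact: powers_span_pow|rewrite mulr1].
by rewrite JJ => -[y ky]; rewrite mulr1 er => /(mulrI (embX_unit rx _)) ->.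
Qed.

(** Among the annihilators inside [n] of elements of [A / xA], a maximal one is prime and contains
    [x], hence is maximal and equal to [n]. *)
Lemma socle_elt n : maximal_ideal A n ->
  exists y, [/\ A y, ~ scale xq A y & forall s, n s -> scale xq A (s * y)].
Proof.
move=> mn; have n1 := maximal_ideal1 sA mn.
have pn := maximal_ideal_prime sA mn.
have [[nA n0 nD nM] _ _] := mn; have [_ _ nP] := pn.
have sxA := submodule_scale xq (extension_submodule H).
have xAM a y : A a -> scale xq A y -> scale xq A (a * y).
  move=> Aa [b Ab ->]; exists (a * b); last by rewrite mulrCA.
  exact: (subringM sA).
pose ann y : set Q := [set s | A s /\ scale xq A (s * y)].
have iann y : ideal A (ann y).
  split; first by move=> s [].
  - by split; [exact: (subring0 sA)|rewrite mul0r; apply: submodule0].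
  - move=> s s' [As sy] [As' sy']; split; first exact: (subringD sA).
    by rewrite mulrDl; apply: submoduleD.
  - move=> a s Aa [As sy]; split; first exact: (subringM sA).
    by rewrite -mulrA; apply: xAM.
have [||_ [y [Ay yn] <-] ymax] := @submodule_max _ _ _ _ H
    [set ann y | y in [set y | A y /\ ann y `<=` n]].
- by move=> _ [y _ <-]; split; [exact: (ideal_submodule H (iann y))|move=> s []].
- exists (ann 1); exists 1 => //; split; first exact: (subring1 sA).
  by move=> s [_]; rewrite mulr1; apply: (maximal_scale H mn).
have y1 : ~ ann y 1 by move=> /yn.
have bigger z : A z -> ann (z * y) `<=` n -> ann (z * y) `<=` ann y.
  move=> Az zn; rewrite (ymax (ann (z * y))) //.
    by exists (z * y) => //; split=> //; apply: (subringM sA).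
  by move=> s [As sy]; split=> //; rewrite mulrCA; apply: xAM.
have pann : prime_ideal A (ann y).
  split=> //; first exact/(ideal_neqP (subring1 sA)).
  move=> a b Aa Ab [_ aby]; apply: contrapT => /not_orP[na nb].
  have [zn|nzn] := pselect (ann (a * y) `<=` n).
    by apply: nb; apply: (bigger a Aa zn); split=> //; rewrite mulrA (mulrC b).
  have [s [[As say] ns]] : exists s, ann (a * y) s /\ ~ n s.
    by apply: contrapT => E; apply: nzn => s sa; apply: contrapT => ns; apply: E; exists s.
  apply: na; apply: (bigger s As); last by split=> //; rewrite mulrCA.
  move=> u [Au usy]; have : n (u * s) by apply: yn; split; [exact: (subringM sA)|rewrite -mulrA].
  by move=> /(nP _ _ Au As)[].
have my := prime_xq_maximal H pann.
have {}my : maximal_ideal A (ann y).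
  by apply: my; split=> //; exists y.
have eyn := maximal_ideal_sub my mn yn.
exists y; split=> //.
  by move=> xy; apply: y1; split; [exact: (subring1 sA)|rewrite mul1r].
by move=> s; rewrite -eyn => -[].
Qed.

(** With [y] from [socle_elt], [z = y / x] is outside [A] but maps [n] into [A]. If it mapped [n]
    into [n], all [x z^k] would be in [A] and [z] would be integral. *)
Lemma maximal_invertible n : maximal_ideal A n ->
  exists a b, [/\ n a, ~ n (b * a) & forall s, n s -> A (b * s)].
Proof.
move=> mn; have [y [Ay nxy ny]] := socle_elt mn.
have [[nA _ nD nM] _ _] := mn.
pose z := xq^-1 * y.
have zn s : n s -> A (z * s).
  by move=> /ny[a Aa e]; rewrite /z -mulrA (mulrC y) e mulKr ?(emb_unit rx).
have nz : ~ A z.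
  by move=> Az; apply: nxy; exists z => //; rewrite mulVKr ?(emb_unit rx).
have [a [na nza]] : exists a, n a /\ ~ n (z * a).
  apply: contrapT => E; apply: nz; apply: (@almost_integral z 1) => k.
  have nzx : n (xq * z ^+ k).
    elim: k => [|k IHk]; first by rewrite mulr1; apply: (maximal_xq H mn).
    by apply: contrapT => nk; apply: E; exists (xq * z ^+ k); split=> //; rewrite mulrCA -exprS.
  by rewrite expr1; apply: nA.
by exists a, z.
Qed.

(** Let [u] be outside [n] and in all other maximal ideals, and [v = 1 - u' u] in [n]. Then
    [t = u a + v^2] lies in [n] and in no other maximal ideal, and [b t] is outside [n]. The ideal
    of all [y] with [y n] inside [tA] contains [t] and [b t], so it lies in no maximal ideal and
    contains 1. *)
Lemma maximal_principal n : maximal_ideal A n ->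
  exists2 t, t \is a GRing.unit & n = scale t A.
Proof.
move=> mn; have [a [b [na nba bn]]] := maximal_invertible mn.
have [[nA n0 nD nM] _ _] := mn.
have [s sP] := integral_maximal_seq H.
have [m|u Au [nu su]] := maximal_ideal_avoid sA (s := [seq m <- s | m != n]) mn.
  by rewrite mem_filter => /andP[/eqP ? /sP].
have [u' Au' nuu'] := maximal_ideal_inv sA mn Au nu.
set v := 1 - u' * u in nuu'.
pose t := u * a + v * v.
have nt : n t by apply: nD; apply: nM => //; apply: nA.
have nbt : ~ n (b * t).
  have -> : b * t = u * (b * a) + v * (b * v) by rewrite /t; ring.
  move=> E; have : n (u * (b * a)).
    have -> : u * (b * a) = (u * (b * a) + v * (b * v)) + (- (b * v)) * v by ring.
    by apply: nD => //; apply: nM => //; apply: (subringN sA); apply: bn.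
  by apply: (maximal_idealM sA mn) => //; apply: bn.
have At := nA _ nt.
have tm m : maximal_ideal A m -> m <> n -> ~ m t.
  move=> mm mneq mt; have mu : m u by apply: su; rewrite mem_filter; apply/andP; split; [exact/eqP|exact/sP].
  have [[mA _ mD mM] _ _] := mm.
  have nv : ~ m v.
    move=> mv; apply: (maximal_ideal1 sA mm); rewrite -(subrK (u' * u) 1); apply: mD => //.
    exact: mM.
  have Av := nA _ nuu'; apply: (maximal_idealM sA mm Av Av nv nv).
  have -> : v * v = t + (- a) * u by rewrite /t; ring.
  apply: mD => //; apply: mM => //; rewrite -sub0r; apply: (subringB sA); last exact: nA.
  exact: (subring0 sA).
pose L := [set y | A y /\ forall s, n s -> scale t A (y * s)].
have iL : ideal A L.
  split; first by move=> y [].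
  - split; first exact: (subring0 sA).
    by move=> w _; exists 0; [exact: (subring0 sA)|rewrite mulr0 mul0r].
  - move=> y z [Ay yL] [Az zL]; split; first exact: (subringD sA).
    move=> w nw; have [c Ac ec] := yL w nw; have [d Ad ed] := zL w nw.
    by exists (c + d); [exact: (subringD sA)|rewrite mulrDl ec ed mulrDr].
  - move=> c y Ac [Ay yL]; split; first exact: (subringM sA).
    move=> w nw; have [d Ad ed] := yL w nw.
    by exists (c * d); [exact: (subringM sA)|rewrite -mulrA ed mulrCA].
have [_ L1] : L 1.
  apply: (ideal_full H iL) => m mm Lm.
  have [mneq|mneq] := pselect (m = n).
    apply: nbt; rewrite -mneq; apply: Lm; split; first exact: bn.
    by move=> w nw; exists (b * w); [exact: bn|rewrite mulrCA mulrA].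
  apply: (tm _ mm mneq); apply: Lm; split=> // w nw.
  by exists w; [exact: nA|].
have nE : n = scale t A.
  apply/seteqP; split=> [y ny|_ [c Ac ->]]; first by have := L1 y ny; rewrite mul1r.
  by rewrite mulrC; apply: nM.
exists t => //.
have : n xq by apply: (maximal_xq H mn).
rewrite nE => -[c Ac ec].
by have := emb_unit rx; rewrite ec unitrM => /andP[].
Qed.

End Uniformizers.

(** * Valuation rings *)

(** The localization of [A] at [n], realized as a subset of [Q]. *)
Definition vring (R : comNzRingType) (A n : set (total_frac R)) : set (total_frac R) :=
  [set y | exists s, [/\ A s, ~ n s & A (s * y)]].

(* vge A n t k y says that the valuation of y at n = t A is at least k.  It is  *)
(* locked, since unification otherwise unfolds the arithmetic of fractions.     *)
HB.lock Definition vge (R : comNzRingType) (A n : set (total_frac R))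
    (t : total_frac R) (k : int) : set (total_frac R) :=
  [set y | vring A n (t ^ (- k) * y)].

Lemma vgeE (R : comNzRingType) (A n : set (total_frac R)) (t : total_frac R) k y :
  vge A n t k y = vring A n (t ^ (- k) * y).
Proof. by rewrite vge.unlock. Qed.

Section ValuationRings.
Variable R : comNzRingType.
Local Notation Q := (total_frac R).
Local Notation emb := (@to_total R).
Variables (x : R) (A : set Q) (N : nat).
Hypothesis H : normal_extension x A N.
Local Notation xq := (emb x).
Local Notation HN := (ne_noetherian H).
Local Notation Hdim := (ne_dim H).
Local Notation Jx := (ne_jacobson H).
Local Notation sA := (ne_subring H).
Implicit Types (n : set Q).

Let emb_mem' r : A (emb r) := emb_mem H r.
Hint Resolve emb_mem' : core.

Lemma int_max (P : int -> Prop) a b : (forall k l, (l <= k)%R -> P k -> P l) ->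
  P a -> ~ P b -> exists k, P k /\ ~ P (k + 1).
Proof.
move=> Pmono Pa nPb.
have ab : a <= b by rewrite leNgt; apply/negP => /ltW ba; apply/nPb/(Pmono a).
have ex : exists m : nat, `[< ~ P (a + m%:Z) >].
  by exists (absz (b - a)); apply/asboolP; rewrite gez0_abs ?subr_ge0 // addrCA subrr addr0.
case: (ex_minnP ex) => m /asboolP nm mmin.
case: m nm mmin => [|m] nm mmin; first by case: nm; rewrite addr0.
exists (a + m%:Z); split; last by rewrite -addrA -PoszD addn1.
apply: contrapT => nPm; have := mmin m; rewrite ltnn => E.
by suff : false by []; apply: E; apply/asboolP.
Qed.

Section OneMaximal.
Variables (n : set Q) (t : Q).
Hypothesis mn : maximal_ideal A n.
Hypothesis ut : t \is a GRing.unit.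
Hypothesis nt : n = scale t A.
Local Notation V := (vring A n).

Lemma A_vring : A `<=` V.
Proof.
move=> y Ay; exists 1; rewrite mul1r; split=> //; first exact: (subring1 sA).
exact: (maximal_ideal1 sA mn).
Qed.

Lemma vring_subring : GRing.subring_closed [in V].
Proof.
split=> [|y z /set_mem[s [As ns sy]] /set_mem[s' [As' ns' sz]]
         |y z /set_mem[s [As ns sy]] /set_mem[s' [As' ns' sz]]]; apply/mem_set.
- by apply: A_vring; apply: (subring1 sA).
- exists (s * s'); split; [exact: (subringM sA)|exact: (maximal_idealM sA mn)|].
  have -> : s * s' * (y - z) = s' * (s * y) - s * (s' * z) by ring.
  by apply: (subringB sA); apply: (subringM sA).
- exists (s * s'); split; [exact: (subringM sA)|exact: (maximal_idealM sA mn)|].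
  have -> : s * s' * (y * z) = (s * y) * (s' * z) by ring.
  exact: (subringM sA).
Qed.
Local Notation sV := vring_subring.

Lemma maximal_t : n t.
Proof. by rewrite nt; exists 1; [exact: (subring1 sA)|rewrite mulr1]. Qed.

Lemma maximal_subA : n `<=` A.
Proof. by case: mn => -[]. Qed.

Lemma t_vring : V t.
Proof. exact/A_vring/maximal_subA/maximal_t. Qed.

Lemma maximal_div y : n y -> exists2 a, A a & y = t * a.
Proof. by rewrite nt. Qed.

Lemma vring_tinv s y : A s -> ~ n s -> A y -> V (t^-1 * y) -> n y.
Proof.
move=> _ _ Ay [s' [As' ns' sy]].
have : n (s' * y).
  have -> : s' * y = t * (s' * (t^-1 * y)) by rewrite (mulrCA s') mulVKr.
  by rewrite nt; exists (s' * (t^-1 * y)).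
by have [_ _ nP] := maximal_ideal_prime sA mn; move=> /(nP _ _ As' Ay)[].
Qed.

Lemma vring_prime y z : V y -> V z -> V (t^-1 * (y * z)) ->
  V (t^-1 * y) \/ V (t^-1 * z).
Proof.
move=> [s [As ns sy]] [s' [As' ns' sz]] Vyz.
have n1 := maximal_ideal1 sA mn; have A1 := subring1 sA.
have [_ _ nP] := maximal_ideal_prime sA mn.
have : n ((s * y) * (s' * z)).
  apply: (vring_tinv A1 n1); first exact: (subringM sA).
  have -> : t^-1 * (s * y * (s' * z)) = (s * s') * (t^-1 * (y * z)) by ring.
  apply: (subringM sV) Vyz; apply: A_vring; exact: (subringM sA).
by move=> /(nP _ _ sy sz)[] /maximal_div[a Aa ea]; [left; exists s|right; exists s'];
  split=> //; rewrite mulrCA ea mulKr.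
Qed.

(** Take the largest [j] with [x] in [t^j A]; it exists because [A / xA] has finite length. *)
Lemma xq_factor : exists j u, [/\ A u, ~ n u & xq = t ^+ j * u].
Proof.
have [e be] := blen_extension H.
have sAm := extension_submodule H.
have tA := maximal_subA maximal_t.
have ch l : chain (scale (t ^+ l) A) A l.
  elim: l => [|l IHl]; first by rewrite expr0 scale1; apply: chain0.
  apply: chain_cons IHl; first exact: submodule_scale.
  split=> [_ [a Aa ->]|sub].
    by exists (t * a); [exact: (subringM sA)|rewrite exprSr mulrA].
  have [a Aa] : scale (t ^+ l.+1) A (t ^+ l) by apply: sub; exists 1; rewrite ?mulr1 //; apply: (subring1 sA).
  rewrite exprSr -mulrA -{1}[t ^+ l]mulr1 => /(mulrI (unitrX l ut)) e1.
  by apply: (maximal_ideal1 sA mn); rewrite nt; exists a.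
have bd l : (fun l => `[< scale (t ^+ l) A xq >]) l -> (l <= e)%N.
  move=> /asboolP[a Aa ea].
  have sub : scale xq A `<=` scale (t ^+ l) A.
    move=> _ [b Ab ->]; exists (a * b); first exact: (subringM sA).
    by rewrite ea mulrA.
  exact: (blen_sub (submodule_scale xq sAm) sAm sub (@subset_refl _ _) be (ch l)).
have ex : exists l, (fun l => `[< scale (t ^+ l) A xq >]) l.
  by exists 0%N; apply/asboolP; exists xq; rewrite ?mul1r.
case: (ex_maxnP ex bd) => j /asboolP[u Au eu] jmax; exists j, u; split=> //.
move=> /maximal_div[a Aa ea]; suff : (j.+1 <= j)%N by rewrite ltnn.
by apply: jmax; apply/asboolP; exists a; rewrite // eu ea exprSr mulrA.
Qed.

Lemma vring_power y : exists k, V (t ^+ k * y).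
Proof.
have [j [u [Au nu ej]]] := xq_factor.
have [k [r er]] := total_pow_frac HN Hdim Jx y.
exists (j * k)%N, (u ^+ k); split.
- exact: (subringX sA).
- elim: k {er} => [|k IHk]; first exact: (maximal_ideal1 sA mn).
  by rewrite exprS; apply: (maximal_idealM sA mn) => //; apply: (subringX sA).
- by rewrite mulrA [u ^+ k * _]mulrC exprM -exprMn -ej er.
Qed.

Lemma vring_tinv1 : ~ V t^-1.
Proof.
move=> Vt; apply: (maximal_ideal1 sA mn); apply: (vring_tinv (subring1 sA)).
- exact: (maximal_ideal1 sA mn).
- exact: (subring1 sA).
- by rewrite mulr1.
Qed.

Local Notation vge := (vge A n t).

Lemma vge0 y : vge 0 y <-> V y.
Proof. by rewrite !vgeE oppr0 expr0z mul1r. Qed.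

Lemma vgeD k y z : vge k y -> vge k z -> vge k (y + z).
Proof. by rewrite !vgeE mulrDr; apply: (subringD sV). Qed.

Lemma vgeB k y z : vge k y -> vge k z -> vge k (y - z).
Proof. by rewrite !vgeE mulrBr; apply: (subringB sV). Qed.

Lemma vgeM k l y z : vge k y -> vge l z -> vge (k + l) (y * z).
Proof.
rewrite !vgeE => Vy Vz; rewrite opprD exprzDr //.
have -> : t ^ (- k) * t ^ (- l) * (y * z) = (t ^ (- k) * y) * (t ^ (- l) * z) by ring.
exact: (subringM sV).
Qed.

Lemma vge_scale k l y : vge k (t ^ l * y) <-> vge (k - l) y.
Proof. by rewrite !vgeE mulrA -exprzDr // opprB [l - k]addrC. Qed.

Lemma vge_le k l y : l <= k -> vge k y -> vge l y.
Proof.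
move=> lk ky; rewrite -[y]mul1r -[l](subrK k) [l - k + k]addrC -[l - k]opprB.
have -> : k - (k - l) = (l - k) + k by ring.
apply: vgeM ky; rewrite !vgeE mulr1 opprB.
have -> : k - l = (absz (k - l))%:Z by rewrite gez0_abs ?subr_ge0.
exact: (subringX sV _ t_vring).
Qed.

Lemma vge_prime k l y z : vge k y -> vge l z -> ~ vge (k + 1) y -> ~ vge (l + 1) z ->
  ~ vge (k + l + 1) (y * z).
Proof.
rewrite !vgeE => ky lz nky nlz kl.
have e m w : t ^ (- (m + 1)) * w = t^-1 * (t ^ (- m) * w).
  by rewrite opprD exprzDr // mulrA [_ * t^-1]mulrC.
have : V (t^-1 * ((t ^ (- k) * y) * (t ^ (- l) * z))).
  rewrite (_ : _ * _ = t ^ (- (k + l + 1)) * (y * z)) //.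
  by rewrite e opprD exprzDr //; ring.
by move=> /(vring_prime ky lz); rewrite -!e => -[].
Qed.

Lemma vge_exists y : exists k, vge k y.
Proof.
have [k ky] := vring_power y; exists (- k%:Z).
by rewrite !vgeE opprK.
Qed.

(** If [l] bounds the value of the inverse from below, then [y] cannot have value at least [1 - l],
    for then 1 would have value at least 1. *)
Lemma vge_unit y : y \is a GRing.unit -> exists k, vge k y /\ ~ vge (k + 1) y.
Proof.
move=> uy; have [k ky] := vge_exists y; have [l ly] := vge_exists y^-1.
apply: (@int_max (fun k => vge k y) k (1 - l)) => // [a b ba|kl]; first exact: vge_le.
apply: vring_tinv1; have := vgeM kl ly; rewrite mulrV // subrK !vgeE mulr1.
by rewrite -[t^-1]/(t ^ (-1)).
Qed.

(** A relation and not a function: an element of [Q] that is not a unit can have infinite value. *)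
Definition vval k y := vge k y /\ ~ vge (k + 1) y.

Lemma vval_vge k l y : vval k y -> vge l y <-> l <= k.
Proof.
move=> [ky nky]; split=> [ly|lk]; last exact: vge_le ky.
by rewrite leNgt; apply/negP => kl; apply/nky/(vge_le _ ly); rewrite lezD1.
Qed.

Lemma vvalM k l y z : vval k y -> vval l z -> vval (k + l) (y * z).
Proof. by move=> [ky nky] [lz nlz]; split; [exact: vgeM|exact: vge_prime]. Qed.

Lemma vval_uniq k l y : vval k y -> vval l y -> k = l.
Proof.
by move=> ky ly; apply/eqP; rewrite eq_le; apply/andP; split;
  [apply/(vval_vge _ ly); case: ky|apply/(vval_vge _ ky); case: ly].
Qed.

Lemma vval1 : vval 0 1.
Proof.
split; first by apply/vge0; apply: A_vring; apply: (subring1 sA).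
by rewrite add0r !vgeE mulr1 -[t ^ (-1)]/(t^-1); apply: vring_tinv1.
Qed.

Lemma vval_scale k l y : vval k (t ^ l * y) <-> vval (k - l) y.
Proof. by rewrite /vval !vge_scale addrAC. Qed.

Lemma vval_inv k y : y \is a GRing.unit -> vval k y -> vval (- k) y^-1.
Proof.
move=> uy ky; have [l ly] : exists l, vval l y^-1 by apply: vge_unit; rewrite unitrV.
have : vval (k + l) 1 by rewrite -(mulrV uy); apply: vvalM.
by move=> /(vval_uniq vval1)/esym/eqP; rewrite addrC addr_eq0 => /eqP <-.
Qed.

End OneMaximal.
End ValuationRings.

(** * The valuation rings of [R] as localizations of its integral closure *)

Section ValuationRingClassification.
Variable R : comNzRingType.
Local Notation Q := (total_frac R).
Local Notation emb := (@to_total R).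
Variables (x : R) (A : set Q) (N : nat).
Hypothesis H : normal_extension x A N.
Local Notation xq := (emb x).
Local Notation HN := (ne_noetherian H).
Local Notation Hdim := (ne_dim H).
Local Notation Jx := (ne_jacobson H).
Local Notation rx := (ne_lreg H).
Local Notation sA := (ne_subring H).
Implicit Types (n : set Q).

Let emb_mem' r : A (emb r) := emb_mem H r.
Hint Resolve emb_mem' : core.

Local Notation V n := (vring A n).

Section OneMaximal.
Variables (n : set Q) (t : Q).
Hypothesis mn : maximal_ideal A n.
Hypothesis ut : t \is a GRing.unit.
Hypothesis nt : n = scale t A.
Local Notation sV := (vring_subring H mn).

Lemma vring_nonmem y : ~ V n y -> exists2 k, (0 < k)%N &
  V n (t ^+ k * y) /\ ~ V n (t^-1 * (t ^+ k * y)).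
Proof.
move=> nVy; have [k ky] := vring_power H mn ut nt y.
have ex : exists k, `[< V n (t ^+ k * y) >] by exists k; apply/asboolP.
case: (ex_minnP ex) => -[|m] /asboolP my mmin; first by case: nVy; rewrite mul1r in my.
exists m.+1 => //; split=> //; rewrite exprS -mulrA mulKr // => my'.
have : (m.+1 <= m)%N by apply: mmin; apply/asboolP.
by rewrite ltnn.
Qed.

Lemma vring_tX k y : (0 < k)%N -> V n y -> V n (t^-1 * (t ^+ k * y)).
Proof.
case: k => // k _ Vy; rewrite exprS -mulrA mulKr //.
by apply: (subringM sV) Vy; apply: (subringX sV); apply: (t_vring H mn nt).
Qed.

(** Elements outside [V] become units modulo [tV] after multiplication by a positive power of [t].
    If their product were in [V], the rescaled product would lie in the prime ideal [tV]. *)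
Lemma vring_valuation_ring : valuation_rings R (V n).
Proof.
split.
- exact: sV.
- by move=> _ [r _ <-]; apply: (A_vring H mn).
- by move=> VT; apply: (vring_tinv1 H mn ut nt); rewrite VT.
- move=> y z /vring_nonmem[k k0 [ky nky]] /vring_nonmem[l l0 [lz nlz]] yz.
  have : V n (t^-1 * ((t ^+ k * y) * (t ^+ l * z))).
    have -> : (t ^+ k * y) * (t ^+ l * z) = t ^+ (k + l) * (y * z) by rewrite exprD; ring.
    by apply: vring_tX => //; rewrite addn_gt0 k0.
  by move=> /(vring_prime H mn ut nt ky lz)[].
Qed.

Lemma mem_scale_vring y : scale t (V n) y <-> V n (t^-1 * y).
Proof.
split=> [[z Vz ->]|Vy]; first by rewrite mulKr.
by exists (t^-1 * y); rewrite ?mulVKr.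
Qed.

Lemma vring_quotient y : V n y -> ~ V n (t^-1 * y) ->
  exists2 z, V n z & V n (t^-1 * (1 - z * y)).
Proof.
move=> [s [As ns sy]] nVy.
have nsy : ~ n (s * y).
  move=> /(maximal_div nt)[a Aa ea]; apply: nVy; exists s; split=> //.
  by rewrite mulrCA ea mulKr.
have [b Ab nb] := maximal_ideal_inv sA mn sy nsy.
exists (b * s); first by apply: (A_vring H mn); apply: (subringM sA).
have [a Aa ea] := maximal_div nt nb.
by rewrite -mulrA ea mulKr //; apply: (A_vring H mn).
Qed.

Lemma vring_maximal : maximal_ideal (V n) (scale t (V n)).
Proof.
have V1 := subring1 sV.
have iM : ideal (V n) (scale t (V n)).
  split.
  - by move=> _ [z Vz ->]; apply: (subringM sV) Vz; apply: (t_vring H mn nt).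
  - by exists 0; rewrite ?mulr0 //; apply: (subring0 sV).
  - by move=> _ _ [y Vy ->] [z Vz ->]; exists (y + z); rewrite ?mulrDr //; apply: (subringD sV).
  - by move=> a _ Va [z Vz ->]; exists (a * z); rewrite 1?mulrCA //; apply: (subringM sV).
split=> //.
  apply/(ideal_neqP V1 iM) => /mem_scale_vring; rewrite mulr1.
  exact: (vring_tinv1 H mn ut nt).
move=> J iJ MJ; have [JM|nJM] := pselect (J `<=` scale t (V n)).
  by left; apply/seteqP.
right; apply: contrapT => nJV; have /(ideal_neqP V1 iJ) := nJV; apply.
have [y [Jy ny]] : exists y, J y /\ ~ scale t (V n) y.
  by apply: contrapT => E; apply: nJM => y Jy; apply: contrapT => ny; apply: E; exists y.
have [JV _ JD JM] := iJ.
have [z Vz zy] : exists2 z, V n z & V n (t^-1 * (1 - z * y)).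
  by apply: vring_quotient; [exact: JV|move=> /mem_scale_vring].
rewrite -(subrK (z * y) 1); apply: JD; last exact: JM.
exact/MJ/mem_scale_vring.
Qed.

(** A regular element of [M] is a unit of [Q] of some value [k], so [t^k] is a multiple of it; [M]
    is prime, hence contains [t]. *)
Lemma vring_maximal_unique M : maximal_ideal (V n) M -> regular_part M !=set0 ->
  M = scale t (V n).
Proof.
move=> mM [y [My /lreg_unit uy]].
have [[MV M0 MD MM] _ _] := mM.
have [k ky] := vge_unit H mn ut nt uy.
apply/esym; apply: (maximal_ideal_sub vring_maximal mM).
suff Mt : M t by move=> _ [z Vz ->]; rewrite mulrC; apply: MM.
have k0 : 0 <= k.
  by apply/(vval_vge H mn ut nt _ ky)/vge0/MV.
have Mtk : M (t ^+ absz k).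
  rewrite -[t ^+ _]/(t ^ (absz k)%:Z) gez0_abs // -(divrK uy (t ^ k)); apply: MM => //.
  have [] := vval_inv H mn ut nt uy ky.
  by rewrite !vgeE opprK.
have [_ _ MP] := maximal_ideal_prime sV mM.
have M1 := maximal_ideal1 sV mM.
have Vt := t_vring H mn nt.
elim: (absz k) Mtk => [//|m IHm]; rewrite exprS.
by move=> /(MP _ _ Vt (subringX sV _ Vt))[].
Qed.

Lemma regular_maximal_ideal_vring : regular_maximal_ideal (V n) = scale t (V n).
Proof.
apply: xget_unique.
  split; first exact: vring_maximal.
  exists t; split; last exact/lreg_unit.
  by exists 1; rewrite ?mulr1 //; apply: (subring1 sV).
by move=> M [mM rM]; apply: vring_maximal_unique.
Qed.

Lemma ideal_pow_vring k : ideal_pow (V n) (scale t (V n)) k = scale (t ^+ k) (V n).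
Proof.
elim: k => [|k IHk] /=; first by rewrite expr0 scale1.
rewrite IHk; apply/seteqP; split=> [_ [s sP ->]|_ [y Vy ->]].
  rewrite big_seq; apply: (big_ind (scale (t ^+ k.+1) (V n))).
  - by exists 0; rewrite ?mulr0 //; apply: (subring0 sV).
  - by move=> _ _ [y Vy ->] [z Vz ->]; exists (y + z); rewrite ?mulrDr //; apply: (subringD sV).
  - move=> [a b] /sP[/= [y Vy ->] [z Vz ->]]; exists (y * z); first exact: (subringM sV).
    by rewrite exprS; ring.
exists [:: (t, t ^+ k * y)]; last by rewrite big_seq1 exprS mulrA.
move=> q; rewrite inE => /eqP -> /=; split; last by exists y.
by exists 1; rewrite ?mulr1 //; apply: (subring1 sV).
Qed.

Lemma ideal_zpow_vring k y :
  ideal_zpow (V n) (scale t (V n)) k y <-> vge A n t k y.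
Proof.
rewrite !vgeE; case: k => k; rewrite /ideal_zpow ideal_pow_vring.
  split=> [[z Vz ->]|Vy].
    by rewrite mulrA -exprnN mulVr ?mul1r ?unitrX.
  exists (t ^ (- k%:Z) * y) => //.
  by rewrite -exprnN mulVKr ?unitrX.
rewrite NegzE opprK; split=> [|Vy z [w Vw ->]].
  move=> E; rewrite mulrC; apply: E; exists 1; rewrite ?mulr1 //.
  exact: (subring1 sV).
by rewrite mulrA [y * _]mulrC; apply: (subringM sV).
Qed.

Lemma valuation_vring k y : vval A n t k y -> valuation (V n) y = (k%:E)%E.
Proof.
move=> ky; rewrite /valuation regular_maximal_ideal_vring.
case: (pselect (forall k, ideal_zpow (V n) (scale t (V n)) k y)) => [E|_] /=.
  by case: ky => _; case; apply/ideal_zpow_vring/E.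
congr (_%:E)%E; apply: xget_unique.
  split; first by apply/ideal_zpow_vring; case: ky.
  by move=> l /ideal_zpow_vring/(vval_vge H mn ut nt _ ky).
move=> l [/ideal_zpow_vring ly lub]; apply/eqP; rewrite eq_le; apply/andP; split.
  exact/(vval_vge H mn ut nt _ ky).
by apply: lub; apply/ideal_zpow_vring; case: ky.
Qed.

End OneMaximal.

(** If [w] is outside [W], then so is every monic polynomial expression of positive degree in [w]:
    drop the constant term, split off a factor [w] and use induction. Such an expression cannot
    vanish. *)
Lemma integrally_closed_valuation_ring (W : set Q) : valuation_rings R W ->
  forall w k, powers_span w k (w ^+ k) -> W w.
Proof.
move=> [sW RW _ nW] w k [a ea].
have R1 r : W (emb r) by apply: RW; exists r.
apply: contrapT => nw.
suff Hm m (b : nat -> R) : ~ W (\sum_(i < m.+1) emb (b i) * w ^+ i + w ^+ m.+1).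
  case: k ea => [|k] ea.
    by move/eqP: ea; rewrite big_ord0 expr0 oner_eq0.
  have := Hm k (fun i => - a i); apply.
  rewrite ea -big_split /= big1; first exact: (subring0 sW).
  by move=> i _; rewrite rmorphN mulNr addNr.
elim: m b => [|m IHm] b.
  rewrite big_ord1 mulr1 expr1 => Wbw; apply: nw.
  by rewrite -[w](addKr (emb (b 0%N))) addrC; apply: (subringB sW).
rewrite big_ord_recl mulr1 -addrA => Wb.
apply: (nW _ _ nw (IHm (fun i => b i.+1))).
have -> : w * (\sum_(i < m.+1) emb (b i.+1) * w ^+ i + w ^+ m.+1) =
   (emb (b 0%N) + (\sum_(i < m.+1) emb (b (lift ord0 i)) * w ^+ (lift ord0 i) + w ^+ m.+2)) - emb (b 0%N).
  rewrite [RHS]addrC addKr mulrDr mulr_sumr -exprS; congr (_ + _).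
  by apply: eq_bigr => i _; rewrite mulrCA -exprS.
exact: (subringB sW).
Qed.

Hypothesis Aint : forall w, A w -> exists k, powers_span w k (w ^+ k).

(** The [s] in [A] with [s / x] in [W] form a proper ideal; let [n] contain it. If [W] were not
    inside [V n], then [t^-1] would be in [W], and so would [u / x = t^(-j)], although [u] is
    outside [n]. Conversely [t V n] lies in [W], because the complement of [W] is closed under
    products, and [V n = A + t V n]. *)
Lemma valuation_ring_vring (W : set Q) : valuation_rings R W ->
  exists2 n, maximal_ideal A n & W = V n.
Proof.
move=> vW; have [sW RW WT nW] := vW.
have AW : A `<=` W.
  by move=> w /Aint[k]; apply: integrally_closed_valuation_ring.
have ux := emb_unit rx.
have nWx : ~ W xq^-1.
  move=> Wx; apply: WT; apply/seteqP; split=> // q _.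
  have [k [r er]] := total_pow_frac HN Hdim Jx q.
  have -> : q = xq^-1 ^+ k * emb r by rewrite -er exprVn mulKr ?unitrX.
  by apply: (subringM sW); [exact: (subringX sW)|apply: RW; exists r].
pose J : set Q := [set s | A s /\ W (s * xq^-1)].
have iJ : ideal A J.
  split; first by move=> s [].
  - by split; [exact: (subring0 sA)|rewrite mul0r; exact: (subring0 sW)].
  - move=> y z [Ay Wy] [Az Wz]; split; first exact: (subringD sA).
    by rewrite mulrDl; apply: (subringD sW).
  - move=> a y Aa [Ay Wy]; split; first exact: (subringM sA).
    by rewrite -mulrA; apply: (subringM sW) => //; apply: AW.
have [|n mn Jn] := integral_in_maximal H iJ; first by rewrite /J /= mul1r => -[].
exists n => //.
have [t ut nt] := maximal_principal H mn.
have [j [u [Au nu ej]]] := xq_factor H mn ut nt.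
have Vsub : W `<=` V n.
  move=> v Wv; apply: contrapT => nVv.
  have [k k0 [kv nkv]] := vring_nonmem mn ut nt nVv.
  have [s [As ns skv]] := kv.
  have na : ~ n (s * (t ^+ k * v)).
    move=> /(maximal_div nt)[a Aa ea]; apply: nkv; exists s; split=> //.
    by rewrite mulrCA ea mulKr.
  have [b Ab nb] := maximal_ideal_inv sA mn skv na.
  have [c Ac ec] := maximal_div nt nb.
  (* Divide [1 - b s t^k v = t c] by [t]; as [k] is positive, the inverse is absorbed by [t^k]. *)
  have Wt : W t^-1.
    have -> : t^-1 = t^-1 * (b * (s * (t ^+ k * v))) + c.
      by rewrite -[c](mulKr ut) -ec -mulrDr addrC subrK mulr1.
    apply: (subringD sW); last exact: AW.
    case: (k) k0 => // k' _.
    have -> : t^-1 * (b * (s * (t ^+ k'.+1 * v))) = b * s * (t ^+ k') * v.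
      by rewrite exprS -(mulrA t) (mulrCA s) (mulrCA b) mulKr // !mulrA.
    apply: (subringM sW) => //; apply: AW.
    have At : A t by apply/(maximal_subA mn)/(maximal_t H nt).
    by apply: (subringM sA); [exact: (subringM sA)|exact: (subringX sA)].
  apply: nu; apply: Jn; split=> //.
  have -> : u * xq^-1 = t^-1 ^+ j.
    by rewrite exprVn ej invrM ?unitrX //; [rewrite mulrA mulrV ?mul1r //|];
      move: ux; rewrite ej unitrM => /andP[].
  exact: (subringX sW).
have tV y : V n y -> W (t * y).
  move=> [s [As ns sy]]; apply: contrapT => nty.
  have nst : ~ W (s * t^-1).
    move=> /Vsub; rewrite mulrC => st; apply: ns.
    exact: (vring_tinv H mn ut nt (subring1 sA) (maximal_ideal1 sA mn) As st).
  apply: (nW _ _ nst nty); apply: AW.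
  by rewrite mulrA divrK.
apply/seteqP; split=> // y [s [As ns sy]].
have [b Ab nb] := maximal_ideal_inv sA mn As ns.
have [c Ac ec] := maximal_div nt nb.
have -> : y = b * (s * y) + t * (c * y).
  by rewrite !mulrA -ec -mulrDl addrC subrK mul1r.
apply: (subringD sW); first by apply: AW; apply: (subringM sA).
apply: tV; apply: (subringM (vring_subring H mn)); last by exists s.
exact: (A_vring H mn).
Qed.

(** [n] is recovered as the trace on [A] of the regular maximal ideal of its valuation ring. *)
Lemma vring_inj n m : maximal_ideal A n -> maximal_ideal A m -> V n = V m -> n = m.
Proof.
move=> mn mm e; apply: (maximal_ideal_sub mn mm) => y ny.
have [t ut nt] := maximal_principal H mn.
have [u uu nu] := maximal_principal H mm.
have etu : scale t (V n) = scale u (V m).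
  rewrite -(regular_maximal_ideal_vring mn ut nt) e.
  exact: (regular_maximal_ideal_vring mm uu nu).
have Ay : A y by apply: (maximal_subA mn).
have : scale u (V m) y.
  rewrite -etu; have [a Aa ->] := maximal_div nt ny; exists a => //.
  exact: (A_vring H mn).
move=> [z Vz ez]; apply: (vring_tinv H mm uu nu (subring1 sA) (maximal_ideal1 sA mm) Ay).
by rewrite ez mulKr.
Qed.

End ValuationRingClassification.

(** * Large residue fields *)

Section ExtendToLocalization.
Variable R : comNzRingType.
Local Notation Q := (total_frac R).
Local Notation emb := (@to_total R).
Variables (x : R) (A : set Q) (N : nat).
Hypothesis H : normal_extension x A N.
Local Notation HN := (ne_noetherian H).
Local Notation sA := (ne_subring H).
Implicit Types (n : set Q).

Let emb_mem' r : A (emb r) := emb_mem H r.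
Hint Resolve emb_mem' : core.

Hypothesis red : reduced R.
Variable m : set R.
Variables (Q' : comUnitRingType) (psi : {rmorphism R -> Q'}).
Hypothesis psi_unit : forall b, GRing.lreg b -> psi b \is a GRing.unit.
Hypothesis psi_ker : forall a, psi a = 0 -> exists2 u, ~ m u & u * a = 0.
Hypothesis psi_frac : forall y, exists a b, psi b \is a GRing.unit /\ y * psi b = psi a.

Lemma total_frac_pair (q : Q) : exists ab : R * R, GRing.lreg ab.2 /\ q * emb ab.2 = emb ab.1.
Proof. by have [a [b ?]] := total_fracP q; exists (a, b). Qed.

(** The ring map out of [Q] induced by [psi]. With the total ring of fractions of the localization
    at [m] as [Q'], it carries the valuation rings over [m] to valuation rings of the
    localization. *)
Definition extension (q : Q) : Q' :=
  let ab := projT1 (cid (total_frac_pair q)) in psi ab.1 / psi ab.2.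

Lemma extensionP q a b : GRing.lreg b -> q * emb b = emb a ->
  extension q * psi b = psi a.
Proof.
move=> rb e; rewrite /extension.
case: (cid (total_frac_pair q)) => -[a' b'] /= [rb' e'].
have eab : a * b' = a' * b.
  by apply: (@to_total_inj R); rewrite !rmorphM /= -e -e'; ring.
apply: (mulIr (psi_unit rb')); rewrite mulrAC divrK ?psi_unit //.
by rewrite -!rmorphM eab.
Qed.

Lemma extensionB q q' : extension (q - q') = extension q - extension q'.
Proof.
have [a [b [rb e]]] := total_fracP q; have [a' [b' [rb' e']]] := total_fracP q'.
have rbb : GRing.lreg (b * b') by apply: lregM.
apply: (mulIr (psi_unit rbb)); rewrite (extensionP (a := a * b' - a' * b)) //.
  rewrite mulrBl rmorphB !rmorphM -(extensionP rb e) -(extensionP rb' e'); ring.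
rewrite rmorphB !rmorphM /= -e -e'; ring.
Qed.

Lemma extensionM q q' : extension (q * q') = extension q * extension q'.
Proof.
have [a [b [rb e]]] := total_fracP q; have [a' [b' [rb' e']]] := total_fracP q'.
have rbb : GRing.lreg (b * b') by apply: lregM.
apply: (mulIr (psi_unit rbb)); rewrite (extensionP (a := a * a')) //.
  rewrite !rmorphM -(extensionP rb e) -(extensionP rb' e'); ring.
rewrite !rmorphM /= -e -e'; ring.
Qed.

Lemma extension_emb r : extension (emb r) = psi r.
Proof.
have := @extensionP (emb r) r 1 (@lreg1 R); rewrite !rmorph1 !mulr1; exact.
Qed.

(* A denominator regular only at m becomes regular after adding an element that *)
(* vanishes at m.                                                               *)
Lemma extension_surj y : exists q, extension q = y.
Proof.
have [a [b [ub e]]] := psi_frac y.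
have [c [bc rbc]] := regular_completion HN b red.
have psic : psi c = 0 by apply: (mulrI ub); rewrite -rmorphM bc rmorph0 mulr0.
exists (emb a / emb (b + c)).
have := @extensionP (emb a / emb (b + c)) a (b + c) rbc.
rewrite divrK ?total_unit_lreg // => /(_ erefl).
by rewrite rmorphD psic addr0 -e => /(mulIr ub).
Qed.

Variable n : set Q.
Hypothesis mn : maximal_ideal A n.
Hypothesis nm : contraction n = m.
Local Notation V := (vring A n).
Local Notation sV := (vring_subring H mn).

Lemma vring_cancel s q : ~ m s -> V (emb s * q) -> V q.
Proof.
move=> nms [u [Au nu usq]]; exists (u * emb s); split; last by rewrite -mulrA.
  exact: (subringM sA).
by apply: (maximal_idealM sA mn) => //; rewrite -nm in nms.
Qed.

(** A kernel element is killed by an element outside [m], which is a unit of [V]. Hence [V] is the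
    full preimage of its image. *)
Lemma extension_ker q : extension q = 0 -> V q.
Proof.
move=> e; have [a [b [rb eq]]] := total_fracP q.
have pa : psi a = 0 by rewrite -(extensionP rb eq) e mul0r.
have [u nmu ua] := psi_ker pa.
apply: (vring_cancel nmu); suff -> : emb u * q = 0 by apply: (subring0 sV).
apply: (mulIr (total_unit_lreg rb)).
by rewrite mul0r -mulrA eq -rmorphM ua rmorph0.
Qed.

Lemma extension_vring q : (extension @` V) (extension q) <-> V q.
Proof.
split=> [[q' Vq' e]|Vq]; last by exists q.
rewrite -(subrK q' q); apply: (subringD sV) => //.
by apply: extension_ker; rewrite extensionB e subrr.
Qed.

Lemma extension_vring_subring : GRing.subring_closed [in extension @` V].
Proof.
split=> [|_ _ /set_mem[y Vy <-] /set_mem[z Vz <-]|_ _ /set_mem[y Vy <-] /set_mem[z Vz <-]];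
  apply/mem_set.
- by exists 1; [exact: (subring1 sV)|rewrite -(rmorph1 emb) extension_emb rmorph1].
- by exists (y - z); [exact: (subringB sV)|rewrite extensionB].
- by exists (y * z); [exact: (subringM sV)|rewrite extensionM].
Qed.

Lemma extension_vring_frac y a s : ~ m s -> y * psi s = psi a -> (extension @` V) y.
Proof.
move=> nms e; have [q eq] := extension_surj y; exists q => //.
apply: (vring_cancel nms); rewrite -(subrK (emb a) (emb s * q)).
apply: (subringD sV); last exact/(A_vring H mn)/emb_mem'.
by apply: extension_ker; rewrite extensionB extensionM !extension_emb eq mulrC e subrr.
Qed.

Lemma extension_vring_proper : extension @` V <> setT.
Proof.
have [t ut nt] := maximal_principal H mn.
have [_ _ VT _] := vring_valuation_ring H mn ut nt.
move=> e; apply: VT; apply/seteqP; split=> // q _.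
by apply/extension_vring; rewrite e.
Qed.

Lemma extension_vring_mul y z : ~ (extension @` V) y -> ~ (extension @` V) z ->
  ~ (extension @` V) (y * z).
Proof.
have [t ut nt] := maximal_principal H mn.
have [_ _ _ VM] := vring_valuation_ring H mn ut nt.
have [q <-] := extension_surj y; have [q' <-] := extension_surj z.
by rewrite -extensionM !extension_vring; apply: VM.
Qed.

End ExtendToLocalization.

Section LargeResidueFields.
Variable R : comNzRingType.
Local Notation Q := (total_frac R).
Local Notation emb := (@to_total R).
Variables (x : R) (A : set Q) (N : nat).
Hypothesis H : normal_extension x A N.
Implicit Types (n : set Q).

Let emb_mem' r : A (emb r) := emb_mem H r.
Hint Resolve emb_mem' : core.

Hypothesis red : reduced R.
Hypothesis Hlarge : large_residue_fields R.

Lemma to_loc_lreg (m : spec R) b : GRing.lreg b ->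
  GRing.lreg (to_loc (prime_compl m) b : loc_at m).
Proof.
move=> /lreg0P rb; apply/lreg0P => y; have [a [s ->]] := fracP y.
rewrite /to_loc mkfrac_mul => /to_loc_eq0[u nu e]; apply/to_loc_eq0; exists u => //.
by apply: rb; rewrite -mulrA.
Qed.

Lemma to_loc_compl_unit (m : spec R) s : ~ (m : set R) s ->
  exists y, y * to_loc (prime_compl m) s = 1 :> loc_at m.
Proof.
move=> ns; exists (mkfrac 1 (Den (asboolT (ns : mulset_set (prime_compl m) s)))).
rewrite /to_loc mkfrac_mul; apply: frac_congr => /=; ring.
Qed.

(** The maximal ideals over [m] inject into the valuation rings of the localization at [m], and
    these into [R / m] by hypothesis; [g] picks representatives of the residue classes. *)
Lemma large_residue_separation (m : set R) : maximal_ideal setT m ->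
  exists g : set Q -> R, forall n n', maximal_ideal A n -> maximal_ideal A n' ->
    contraction n = m -> contraction n' = m -> m (g n - g n') -> n = n'.
Proof.
move=> mm; have pm := maximal_ideal_prime (@subring_setT R) mm.
pose p := Spec pm.
pose Qm : comUnitRingType := total_frac (loc_at p).
pose psi : {rmorphism R -> Qm} := (@to_total (loc_at p)) \o (to_loc (prime_compl p)).
have psiE r : psi r = to_total (to_loc (prime_compl p) r : loc_at p) by [].
have psi_unit b : GRing.lreg b -> psi b \is a GRing.unit.
  by move=> rb; apply/total_unit_lreg/to_loc_lreg.
have psi_s s : ~ m s -> psi s \is a GRing.unit.
  move=> nms; have [y ey] := @to_loc_compl_unit p s nms.
  have e1 : to_total y * psi s = 1 by rewrite psiE -rmorphM ey rmorph1.
  by apply/unitrP; exists (to_total y); rewrite e1 mulrC e1.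
have psi_ker a : psi a = 0 -> exists2 u, ~ m u & u * a = 0.
  move=> e; have : to_loc (prime_compl p) a = 0 :> loc_at p.
    by apply: (@to_total_inj (loc_at p)); rewrite rmorph0.
  by move=> /to_loc_eq0.
have psi_loc (y : loc_at p) : exists a s, ~ m s /\ to_total y * psi s = psi a.
  have [a [s ->]] := fracP y; exists a, (den_val s).
  split; first exact: (asboolW (denP s)).
  rewrite !psiE -rmorphM; congr to_total; rewrite /to_loc mkfrac_mul.
  apply: frac_congr => /=; ring.
have psi_frac y : exists a b, psi b \is a GRing.unit /\ y * psi b = psi a.
  have [u [v [rv e]]] := total_fracP y.
  have [a [s [ns ea]]] := psi_loc u; have [b [s' [ns' eb]]] := psi_loc v.
  exists (a * s'), (b * s); rewrite !rmorphM -ea -eb; split.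
    by rewrite !unitrM !psi_s // total_unit_lreg.
  by rewrite -e; ring.
have Hval n : maximal_ideal A n -> contraction n = m ->
    valuation_rings (loc_at p) (extension psi @` vring A n).
  move=> mn nm; split.
  - exact: (extension_vring_subring H psi_unit mn).
  - move=> _ [y _ <-]; have [a [s [ns e]]] := psi_loc y.
    exact: (extension_vring_frac H red psi_unit psi_ker psi_frac mn nm ns e).
  - exact: (extension_vring_proper H psi_unit psi_ker mn nm).
  - exact: (extension_vring_mul H red psi_unit psi_ker psi_frac mn nm).
have /card_leP[f] := Hlarge (m := p) mm.
(* Extended by 0 outside the valuation rings to obtain a total function. *)
pose h W : {ideal_quot (spec_pred p : idealr R)} :=
  if pselect (valuation_rings (loc_at p) W) is left vW then val (f (exist _ W (mem_set vW)))
  else 0.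
have hinj W W' : valuation_rings (loc_at p) W -> valuation_rings (loc_at p) W' ->
    h W = h W' -> W = W'.
  move=> vW vW'; rewrite /h; case: pselect => // v1; case: pselect => // v2 e.
  by have [] := @inj _ _ _ f _ _ (in_setT _) (in_setT _) (val_inj e).
exists (fun n => repr (h (extension psi @` vring A n))) => n n' mn mn' nm nm' gg.
have /hinj eh : h (extension psi @` vring A n) = h (extension psi @` vring A n').
  rewrite -[LHS]reprK -[RHS]reprK; apply/eqP.
  by rewrite -Quotient.idealrBE; apply/mem_set.
apply: (vring_inj H mn mn'); apply/seteqP; split=> q.
  move=> /(extension_vring H psi_unit psi_ker mn nm).
  rewrite eh; [|exact: Hval|exact: Hval].
  by move=> /(extension_vring H psi_unit psi_ker mn' nm').
move=> /(extension_vring H psi_unit psi_ker mn' nm').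
rewrite -eh; [|exact: Hval|exact: Hval].
by move=> /(extension_vring H psi_unit psi_ker mn nm).
Qed.

End LargeResidueFields.

(** * Values *)

(* An indexing of the maximal ideals of A, with generators tt, by a finite type; *)
(* vi_sep expresses that the residue fields are large.                          *)
Record valuation_index (R : comNzRingType) (A : set (total_frac R)) (I : choiceType)
    (sI : seq I) (nn : I -> set (total_frac R)) (tt : I -> total_frac R) : Prop :=
  ValuationIndex {
    vi_uniq : uniq sI;
    vi_all : forall i, i \in sI;
    vi_max : forall i, maximal_ideal A (nn i);
    vi_inj : injective nn;
    vi_surj : forall n, maximal_ideal A n -> exists i, nn i = n;
    vi_unit : forall i, tt i \is a GRing.unit;
    vi_gen : forall i, nn i = scale (tt i) A;
    vi_sep : forall m, maximal_ideal setT m -> exists g : I -> R, forall i j,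
      contraction (nn i) = m -> contraction (nn j) = m -> m (g i - g j) -> i = j }.

Section Values.
Variable R : comNzRingType.
Local Notation Q := (total_frac R).
Local Notation emb := (@to_total R).
Variables (x : R) (A : set Q) (N : nat).
Hypothesis H : normal_extension x A N.
Local Notation sA := (ne_subring H).
Implicit Types (n : set Q).

Let emb_mem' r : A (emb r) := emb_mem H r.
Hint Resolve emb_mem' : core.

Variables (I : choiceType) (sI : seq I) (nn : I -> set Q) (tt : I -> Q).
Hypothesis HI : valuation_index A sI nn tt.
Implicit Types (i j : I) (k l : int) (y z w : Q) (alpha beta gam : I -> int) (E F : set Q).
Local Notation mI := (vi_max HI).
Local Notation uI := (vi_unit HI).
Local Notation gI := (vi_gen HI).
Local Notation ge i := (vge A (nn i) (tt i)).
Local Notation va i := (vval A (nn i) (tt i)).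

(** The standard element of value exactly [alpha], see [va_tpow]. *)
Definition tpow alpha : Q := \prod_(i <- sI) tt i ^ alpha i.
Definition dset alpha : set Q := [set y | forall i, ge i (alpha i) y].

Lemma tpow_unit alpha : tpow alpha \is a GRing.unit.
Proof.
rewrite /tpow; elim: sI => [|i s IHs]; first by rewrite big_nil unitr1.
by rewrite big_cons unitrM IHs andbT unitrXz ?uI.
Qed.

Lemma ge_unitM i a k u y : u \is a GRing.unit -> va i a u ->
  ge i k (u * y) <-> ge i (k - a) y.
Proof.
move=> uu au; have [a1 _] := au.
have [b1 _] := vval_inv H (mI i) (uI i) (gI i) uu au.
split=> h; last first.
  by have := vgeM H (mI i) (uI i) a1 h; rewrite addrC subrK.
by have := vgeM H (mI i) (uI i) b1 h; rewrite mulKr // addrC.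
Qed.

Lemma va_unitM i a k u y : u \is a GRing.unit -> va i a u ->
  va i k (u * y) <-> va i (k - a) y.
Proof.
move=> uu au; rewrite /vval !(ge_unitM _ _ uu au).
by rewrite (_ : k + 1 - a = k - a + 1) //; ring.
Qed.

Lemma maximal_geP i y : A y -> nn i y <-> ge i 1 y.
Proof.
move=> Ay; rewrite vgeE -[tt i ^ (-1)]/((tt i)^-1); split.
  move=> /(maximal_div (gI i))[a Aa ->]; rewrite mulKr ?uI //.
  exact: (A_vring H (mI i)).
exact: (vring_tinv H (mI i) (uI i) (gI i) (subring1 sA) (maximal_ideal1 sA (mI i)) Ay).
Qed.

Lemma A_ge0 i y : A y -> ge i 0 y.
Proof. by move=> Ay; apply/vge0/(A_vring H (mI i)). Qed.

Lemma va0P i y : A y -> va i 0 y <-> ~ nn i y.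
Proof.
move=> Ay; rewrite (maximal_geP i Ay) /vval add0r.
by split=> [[]//|]; split=> //; apply: A_ge0.
Qed.

Lemma va_tt i j : va i (i == j)%:Z (tt j).
Proof.
case: eqVneq => [->|/eqP ij].
  have := (vval_scale A (nn j) (uI j) 1 1 1).2; rewrite mulr1 expr1z; apply.
  by rewrite subrr; apply: (vval1 H (mI j) (uI j) (gI j)).
have nt : nn j (tt j) by apply: (maximal_t H (gI j)).
apply/va0P; first exact: (maximal_subA (mI j)).
move=> it; apply: ij; apply: (vi_inj HI); apply/esym.
apply: (maximal_ideal_sub (mI j) (mI i)) => y /(maximal_div (gI j))[a Aa ->].
by rewrite mulrC; have [[_ _ _ nM] _ _] := mI i; apply: nM.
Qed.

Lemma va_ttX i j k : va i (if i == j then k else 0) (tt j ^ k).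
Proof.
have v1 := vval1 H (mI i) (uI i) (gI i).
have hn (n : nat) : va i (if i == j then n%:Z else 0) (tt j ^ n).
  elim: n => [|n IHn]; first by rewrite if_same.
  have := vvalM H (mI i) (uI i) (gI i) (va_tt i j) IHn.
  by rewrite -exprnP -exprS; case: ifP => _; rewrite ?addr0 //= -PoszD add1n.
case: k => n; first exact: hn.
have := vval_inv H (mI i) (uI i) (gI i) (unitrX n.+1 (uI j)) (hn n.+1).
by rewrite NegzE; case: ifP => _; rewrite ?oppr0 -exprVn // exprVn.
Qed.

Lemma va_tpow i alpha : va i (alpha i) (tpow alpha).
Proof.
rewrite /tpow.
have -> : alpha i = \sum_(j <- sI) (if i == j then alpha j else 0).
  rewrite (bigD1_seq i) ?(vi_uniq HI) ?(vi_all HI) //= eqxx big1 ?addr0 // => j.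
  by rewrite eq_sym => /negbTE ->.
elim: sI => [|j s IHs]; first by rewrite !big_nil; apply: (vval1 H (mI i) (uI i) (gI i)).
by rewrite !big_cons; apply: (vvalM H (mI i) (uI i) (gI i)) => //; apply: va_ttX.
Qed.

Lemma ge_tpow i k alpha y : ge i k (tpow alpha * y) <-> ge i (k - alpha i) y.
Proof. exact: (ge_unitM _ _ (tpow_unit alpha) (va_tpow i alpha)). Qed.

Lemma va_tpowM i k alpha y : va i k (tpow alpha * y) <-> va i (k - alpha i) y.
Proof. exact: (va_unitM _ _ (tpow_unit alpha) (va_tpow i alpha)). Qed.

Lemma geM i k l y z : ge i k y -> ge i l z -> ge i (k + l) (y * z).
Proof. exact: (vgeM H (mI i) (uI i)). Qed.

Lemma ge_le i k l y : l <= k -> ge i k y -> ge i l y.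
Proof. exact: (vge_le H (mI i) (uI i) (gI i)). Qed.

Lemma va_ge i k l y : va i k y -> ge i l y <-> l <= k.
Proof. exact: (vval_vge H (mI i) (uI i) (gI i)). Qed.

Lemma vaM i k l y z : va i k y -> va i l z -> va i (k + l) (y * z).
Proof. exact: (vvalM H (mI i) (uI i) (gI i)). Qed.

Lemma geD i k y z : ge i k y -> ge i k z -> ge i k (y + z).
Proof. exact: (vgeD H (mI i)). Qed.

Lemma geB i k y z : ge i k y -> ge i k z -> ge i k (y - z).
Proof. exact: (vgeB H (mI i)). Qed.

Lemma ge_AM i k a y : A a -> ge i k y -> ge i k (a * y).
Proof. by move=> Aa ky; rewrite -[k]add0r; apply: geM => //; apply: A_ge0. Qed.

Lemma va_addr i k y z : va i k y -> ge i (k + 1) z -> va i k (y + z).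
Proof.
move=> [ky nky] kz; split.
  by apply: geD => //; apply: ge_le kz; rewrite lerDl.
by move=> yz; apply: nky; rewrite -(addrK z y); apply: geB.
Qed.

(** [A] is the intersection of its localizations: the ideal of denominators of [y] lies in no
    maximal ideal. *)
Lemma dset0 : dset (fun=> 0) = A.
Proof.
apply/seteqP; split=> [y Dy|y Ay i]; last exact: A_ge0.
pose L : set Q := [set s | A s /\ A (s * y)].
have iL : ideal A L.
  split; first by move=> s [].
  - by split; rewrite ?mul0r; apply: (subring0 sA).
  - move=> s s' [As sy] [As' sy']; split; first exact: (subringD sA).
    by rewrite mulrDl; apply: (subringD sA).
  - move=> a s Aa [As sy]; split; first exact: (subringM sA).
    by rewrite -mulrA; apply: (subringM sA).
have [_] : L 1; last by rewrite mul1r.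
apply: (ideal_full H iL) => n mn Ln.
have [i ei] := vi_surj HI mn; subst n.
by have /vge0[s [As ns sy]] := Dy i; apply/ns/Ln.
Qed.

Lemma dset_scale alpha : dset alpha = scale (tpow alpha) A.
Proof.
have u := tpow_unit alpha; apply/seteqP; split=> [y Dy|_ [a Aa ->] i].
  exists ((tpow alpha)^-1 * y); last by rewrite mulVKr.
  rewrite -dset0 => i; have := Dy i.
  by rewrite -{1}(mulVKr u y) ge_tpow subrr.
by apply/ge_tpow; rewrite subrr; apply: A_ge0.
Qed.

Lemma dset_submodule alpha : submodule (dset alpha).
Proof. by rewrite dset_scale; apply/submodule_scale/(extension_submodule H). Qed.

Lemma dset_AM alpha a y : A a -> dset alpha y -> dset alpha (a * y).
Proof. by move=> Aa Dy i; apply: ge_AM. Qed.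

Lemma dset_le alpha beta : (forall i, alpha i <= beta i) -> dset beta `<=` dset alpha.
Proof. by move=> ab y Dy i; apply: ge_le (Dy i). Qed.

Lemma tpow_dset alpha beta : (forall i, beta i <= alpha i) -> dset beta (tpow alpha).
Proof. by move=> ba i; apply/(va_ge _ (va_tpow i alpha)). Qed.

Lemma va_exists i y : (exists k, ~ ge i k y) -> exists k, va i k y.
Proof.
move=> [l nl]; have [k ky] := vge_exists H (mI i) (uI i) (gI i) y.
by apply: (@int_max (fun k => ge i k y) k l) => // a b; apply: ge_le.
Qed.

Lemma dset_exists y : exists alpha, dset alpha y.
Proof.
have [alpha aP] := choice (fun i => vge_exists H (mI i) (uI i) (gI i) y).
by exists alpha.
Qed.

Lemma unit_va y : y \is a GRing.unit -> exists alpha, forall i, va i (alpha i) y.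
Proof.
move=> uy; have [alpha aP] := choice (fun i => vge_unit H (mI i) (uI i) (gI i) uy).
by exists alpha.
Qed.

(** Dividing by [tpow alpha] leaves an element of [A] of value 0 everywhere, which generates the
    unit ideal. *)
Lemma va_unit alpha y : (forall i, va i (alpha i) y) -> y \is a GRing.unit.
Proof.
move=> vy; have u := tpow_unit alpha.
pose w := (tpow alpha)^-1 * y.
have ey : y = tpow alpha * w by rewrite mulVKr.
have vw i : va i 0 w by have := vy i; rewrite ey va_tpowM subrr.
have Aw : A w by rewrite -dset0 => i; case: (vw i).
have iL : ideal A (scale w A).
  split; first by move=> _ [a Aa ->]; apply: (subringM sA).
  - by exists 0; rewrite ?mulr0 //; apply: (subring0 sA).
  - by move=> _ _ [a Aa ->] [b Ab ->]; exists (a + b); rewrite ?mulrDr //; apply: (subringD sA).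
  - by move=> a _ Aa [b Ab ->]; exists (a * b); rewrite 1?mulrCA //; apply: (subringM sA).
have [a Aa e] : scale w A 1.
  apply: (ideal_full H iL) => n mn Ln.
  have [i ei] := vi_surj HI mn; subst n.
  have /va0P := vw i; apply=> //; apply: Ln; exists 1; rewrite ?mulr1 //.
  exact: (subring1 sA).
rewrite ey unitrM u; apply/unitrP; exists a; by rewrite mulrC -e.
Qed.

Lemma dset_unit y alpha beta : y \is a GRing.unit -> (forall i, va i (alpha i) y) ->
  scale y (dset beta) = dset (fun i => alpha i + beta i).
Proof.
move=> uy vy; apply/seteqP; split=> [_ [z Dz ->] i|z Dz].
  by apply/(ge_unitM _ _ uy (vy i)); rewrite addrC addKr.
exists (y^-1 * z) => [i|]; last by rewrite mulVKr.
have := Dz i; rewrite -{1}(mulVKr uy z) (ge_unitM _ _ uy (vy i)).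
by rewrite addrC addKr.
Qed.

End Values.

(** * Elements with prescribed values *)

Section Generic.
Variable R : comNzRingType.
Local Notation Q := (total_frac R).
Local Notation emb := (@to_total R).
Variables (x : R) (A : set Q) (N : nat).
Hypothesis H : normal_extension x A N.
Local Notation sA := (ne_subring H).
Implicit Types (n : set Q).

Let emb_mem' r : A (emb r) := emb_mem H r.
Hint Resolve emb_mem' : core.

Variables (I : choiceType) (sI : seq I) (nn : I -> set Q) (tt : I -> Q).
Hypothesis HI : valuation_index A sI nn tt.
Implicit Types (i j : I) (k l : int) (y z w : Q) (alpha beta gam : I -> int) (E F : set Q).
Local Notation mI := (vi_max HI).
Local Notation uI := (vi_unit HI).
Local Notation gI := (vi_gen HI).
Local Notation ge i := (vge A (nn i) (tt i)).
Local Notation va i := (vval A (nn i) (tt i)).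

Local Notation dset := (dset A nn tt).
Local Notation tpow := (tpow sI tt).

Lemma maximal_emb i r : contraction (nn i) r <-> ge i 1 (emb r).
Proof. exact: (maximal_geP H HI i (emb_mem' r)). Qed.

Lemma va_emb i r : ~ contraction (nn i) r -> va i 0 (emb r).
Proof. by move=> nr; apply/(va0P H HI). Qed.

Lemma residual_ge i y : ge i 0 y -> exists r, ge i 1 (y - emb r).
Proof.
move=> /vge0[s [As ns sy]].
have [b Ab nb] := maximal_ideal_inv sA (mI i) As ns.
have Abs : A (b * (s * y)) by apply: (subringM sA).
have [r nr] := ne_residual H (mI i) Abs; exists r.
have -> : y - emb r = (1 - b * s) * y + (b * (s * y) - emb r) by ring.
apply: (geD H HI).
  rewrite -[1]addr0; apply: (geM H HI); last by apply/vge0; exists s.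
  by apply/(maximal_geP H HI) => //; apply: (maximal_subA (mI i)).
by apply/(maximal_geP H HI) => //; apply: (maximal_subA (mI i)).
Qed.

(** The quotient of the leading terms of [z] and [y] lies in the residue field of [V], which comes
    from [R] by residual rationality. *)
Lemma leading_coef i k y z : va i k y -> ge i k z -> exists r, ge i (k + 1) (z - emb r * y).
Proof.
move=> [ky nky] kz; have ky' := ky; have kz' := kz; rewrite !vgeE in ky' kz'.
have tk w : tt i ^ (- (k + 1)) * w = (tt i)^-1 * (tt i ^ (- k) * w).
  by rewrite opprD exprzDr ?uI // mulrA [_ * (tt i)^-1]mulrC.
have sV := vring_subring H (mI i).
have nky' : ~ vring A (nn i) ((tt i)^-1 * (tt i ^ (- k) * y)).
  by move=> Vy; apply: nky; rewrite !vgeE tk.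
have [w Vw yw] := vring_quotient H (mI i) (uI i) (gI i) ky' nky'.
have [r rw] : exists r, ge i 1 (w * (tt i ^ (- k) * z) - emb r).
  by apply: residual_ge; apply/vge0; apply: (subringM sV).
exists r; rewrite !vgeE tk.
have -> : (tt i)^-1 * (tt i ^ (- k) * (z - emb r * y)) =
    (tt i)^-1 * (1 - w * (tt i ^ (- k) * y)) * (tt i ^ (- k) * z) +
    (tt i)^-1 * (w * (tt i ^ (- k) * z) - emb r) * (tt i ^ (- k) * y) by ring.
rewrite vgeE -[tt i ^ (-1)]/((tt i)^-1) in rw.
by apply: (subringD sV); apply: (subringM sV).
Qed.

Lemma ge_embM i k r y : ge i k y -> ge i k (emb r * y).
Proof. by move=> ky; apply: (ge_AM H HI). Qed.

Lemma va_embM i k r y : ~ contraction (nn i) r -> va i k y -> va i k (emb r * y).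
Proof. by move=> nr ky; rewrite -[k]add0r; apply: (vaM H HI) => //; apply: va_emb. Qed.

Lemma ge_embM_succ i k r y : contraction (nn i) r -> ge i k y -> ge i (k + 1) (emb r * y).
Proof. by move=> /maximal_emb cr ky; rewrite addrC; apply: (geM H HI). Qed.

Lemma contraction_avoid m : maximal_ideal setT m -> exists2 u, ~ m u &
  forall i, contraction (nn i) <> m -> contraction (nn i) u.
Proof.
move=> mm; pose s := [seq contraction (nn i) | i <- sI & `[< contraction (nn i) <> m >]].
have [M|u _ [nmu su]] := maximal_ideal_avoid (@subring_setT R) (s := s) mm.
  move=> /mapP[i]; rewrite mem_filter => /andP[/asboolP nim _] ->; split=> //.
  exact: (contraction_maximal H (mI i)).
exists u => // i nim; apply: su; apply: map_f; rewrite mem_filter (vi_all HI) andbT.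
exact/asboolP.
Qed.

(* Let m be the maximal ideal of R below i0.  Among the candidates y - r z, with *)
(* r in R / m, and w y + z, with w in m, each valuation above m rules out at    *)
(* most one, so the large residue field leaves one.                             *)
Lemma generic_combination E alpha (s : seq I) i0 y z : submodule E ->
  E y -> E z -> dset alpha y -> dset alpha z ->
  (forall i, i \in s -> va i (alpha i) y) -> va i0 (alpha i0) z ->
  exists y', [/\ E y', dset alpha y' & forall i, i \in i0 :: s -> va i (alpha i) y'].
Proof.
move=> sE Ey Ez Dy Dz sy z0.
have [y0|ny0] := pselect (va i0 (alpha i0) y).
  by exists y; split=> // i; rewrite inE => /predU1P[->//|/sy].
have {ny0} y0 : ge i0 (alpha i0 + 1) y by apply: contrapT => n; apply: ny0; split.
set m := contraction (nn i0).
have mm : maximal_ideal setT m := contraction_maximal H (mI i0).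
(* Multiplying [z] by [u] keeps its value at [i0] and raises the lower bound at valuations not over
   [m]. *)
have [u nmu mu] := contraction_avoid mm.
set z' := emb u * z.
have Ez' : E z' by apply: submoduleM.
have Dz' : dset alpha z' by move=> i; apply: ge_embM.
have z'm i : contraction (nn i) <> m -> ge i (alpha i + 1) z'.
  by move=> im; apply: ge_embM_succ (Dz i); apply: mu.
have z'0 : va i0 (alpha i0) z' by apply: va_embM.
have [allz|nallz] := pselect (forall i, contraction (nn i) = m -> va i (alpha i) z').
  have [b _ mb] := maximal_ideal_inv (@subring_setT R) mm Logic.I nmu.
  pose w := 1 - b * u; have wn i : contraction (nn i) <> m -> ~ contraction (nn i) w.
    move=> im iw; have ci := contraction_maximal H (mI i).
    apply: (maximal_ideal1 (@subring_setT R) ci).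
    have [[_ _ cD cM] _ _] := ci; rewrite -(subrK (b * u) 1); apply: cD => //.
    by apply: cM => //; apply: mu.
  exists (emb w * y + z'); split.
  - by apply: submoduleD => //; apply: submoduleM.
  - by move=> i; apply: (geD H HI) => //; apply: ge_embM.
  - move=> i; rewrite inE => si.
    have [im|im] := pselect (contraction (nn i) = m).
      rewrite addrC; apply: (va_addr H HI); first exact: allz.
      by apply: ge_embM_succ (Dy i); rewrite im.
    apply: (va_addr H HI); last exact: z'm.
    apply: va_embM; first exact: wn.
    by apply: sy; case/predU1P: si => // e; case: im; rewrite e.
have [l0 [l0m nl0]] : exists l0 : I, contraction (nn l0) = m /\ ~ va l0 (alpha l0) z'.
  by apply: contrapT => n; apply: nallz => i im; apply: contrapT => ni; apply: n; exists i.
(* Modulo [m], [kap i] is the coefficient to avoid: the one for which the leading terms at [i]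
   cancel. *)
have kex i : exists r, va i (alpha i) z' -> ge i (alpha i + 1) (y - emb r * z').
  have [v|nv] := pselect (va i (alpha i) z'); last by exists 0.
  by have [r rP] := leading_coef v (Dy i); exists r.
have [kap kapP] := choice kex.
have [g gP] := vi_sep HI mm.
pose Im := [seq i <- sI | `[< contraction (nn i) = m >]].
pose L := [seq i <- Im | `[< va i (alpha i) z' >]].
(* Otherwise each [l] over [m] has some [j] in [L] with [g l = kap j] modulo [m]. As [g] separates
   residues, this injects [Im] into [L], which misses [l0]. *)
have [l [lm lP]] : exists l : I, contraction (nn l) = m /\
    forall j, contraction (nn j) = m -> va j (alpha j) z' -> ~ m (g l - kap j).
  apply: contrapT => nl.
  have kill (l : I) : exists j, contraction (nn l) = m ->
     [/\ contraction (nn j) = m, va j (alpha j) z' & m (g l - kap j)].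
    have [lm|nlm] := pselect (contraction (nn l) = m); last by exists l.
    apply: contrapT => nj; apply: nl; exists l; split=> // j jm vj mj.
    by apply: nj; exists j.
  have [h hP] := choice kill.
  have uIm : uniq Im by apply: filter_uniq; apply: (vi_uniq HI).
  have ImP i : (i \in Im) = `[< contraction (nn i) = m >].
    by rewrite mem_filter (vi_all HI) andbT.
  have : (size Im <= size L)%N.
    rewrite -(size_map h); apply: uniq_leq_size.
      rewrite map_inj_in_uniq // => i j; rewrite !ImP => /asboolP im /asboolP jm e.
      have [_ _ mi] := hP i im; have [_ _ mj] := hP j jm.
      apply: gP => //; have -> : g i - g j = (g i - kap (h i)) - (g j - kap (h j)).
        by rewrite e; ring.
      by have [im0 _ _] := mm; apply: idealB.
    move=> ? /mapP[i]; rewrite ImP => /asboolP im ->.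
    have [hm hv _] := hP i im.
    by rewrite mem_filter ImP; apply/andP; split; apply/asboolP.
  rewrite leqNgt => /negP; apply.
  rewrite size_filter -(count_predC (fun i => `[< va i (alpha i) z' >]) Im) -addn1 leq_add2l.
  rewrite -has_count; apply/hasP; exists l0; first by rewrite ImP; apply/asboolP.
  exact/asboolPn.
exists (y - emb (g l) * z'); split.
- by apply: submoduleB => //; apply: submoduleM.
- by move=> i; apply: (geB H HI) => //; apply: ge_embM.
move=> i; rewrite inE => si.
have [im|im] := pselect (contraction (nn i) = m); last first.
  have vi : va i (alpha i) y by apply: sy; case/predU1P: si => // e; case: im; rewrite e.
  apply: (va_addr H HI) => //; rewrite -mulNr -rmorphN; apply: ge_embM; exact: z'm.
have [vz|nvz] := pselect (va i (alpha i) z').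
  have -> : y - emb (g l) * z' = - emb (g l - kap i) * z' + (y - emb (kap i) * z').
    by rewrite rmorphB; ring.
  apply: (va_addr H HI); last exact: kapP.
  rewrite -rmorphN; apply: va_embM => // c; apply: (lP i im vz).
  by rewrite -im -[g l - _]opprK; apply: idealN; [case: (contraction_maximal H (mI i))|].
have gz : ge i (alpha i + 1) z' by apply: contrapT => n; apply: nvz; split.
have vi : va i (alpha i) y.
  by apply: sy; case/predU1P: si => // e; case: nvz; rewrite e.
by apply: (va_addr H HI) => //; rewrite -mulNr -rmorphN; apply: ge_embM.
Qed.

(** The indices are treated one at a time by [generic_combination], starting from 0. *)
Lemma generic_element E alpha : submodule E ->
  (forall i, exists z, [/\ E z, dset alpha z & va i (alpha i) z]) ->
  exists2 y, E y & forall i, va i (alpha i) y.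
Proof.
move=> sE Ez.
suff [y [Ey _ sy]] : exists y, [/\ E y, dset alpha y & forall i, i \in sI -> va i (alpha i) y].
  by exists y => // i; apply/sy/(vi_all HI).
elim: sI => [|i s [y [Ey Dy sy]]].
  exists 0; split=> //; first exact: submodule0.
  exact: (submodule0 (dset_submodule H HI alpha)).
have [z [Ez0 Dz zi]] := Ez i.
exact: (generic_combination sE Ey Ez0 Dy Dz sy zi).
Qed.

(* The value set of E; dset alpha is the set of all y of value at least alpha. *)
Definition gset E : set (I -> int) := [set alpha | exists2 y, E y & forall i, va i (alpha i) y].

Definition minf alpha beta : I -> int := fun i => Num.min (alpha i) (beta i).

Lemma gset_min E alpha beta : submodule E -> gset E alpha -> gset E beta ->
  gset E (minf alpha beta).
Proof.
move=> sE [y Ey ya] [z Ez zb]; apply: generic_element => // i.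
have Dy : dset (minf alpha beta) y.
  by move=> j; apply/(va_ge H HI _ (ya j)); rewrite /minf ge_min lexx.
have Dz : dset (minf alpha beta) z.
  by move=> j; apply/(va_ge H HI _ (zb j)); rewrite /minf ge_min lexx orbT.
rewrite /minf; have [ab|ba] := leP (alpha i) (beta i).
  by exists y; split=> //; rewrite /minf min_l.
by exists z; split=> //; rewrite /minf min_r // ltW.
Qed.

Lemma gset_tpow E alpha beta : dset alpha `<=` E -> (forall i, alpha i <= beta i) ->
  gset E beta.
Proof.
move=> aE ab; exists (tpow beta) => [|i]; last exact: (va_tpow H HI).
by apply: aE; apply: (tpow_dset H HI).
Qed.

(* The values of y may be infinite: adding an element of large value makes them *)
(* finite without changing them below M.                                        *)
Lemma gset_truncate E y (M : I -> int) : submodule E -> dset M `<=` E -> E y ->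
  exists2 eta, gset E eta & forall i k, k <= M i -> ge i k y <-> k <= eta i.
Proof.
move=> sE ME Ey.
(* Where [y] has value exactly [M i], the added element must have larger value to avoid
   cancellation. *)
pose d i : int := if `[< va i (M i) y >] then M i + 1 else M i.
have Md i : M i <= d i by rewrite /d; case: ifP; rewrite // lerDl.
have vd i : va i (d i) (tpow d) by apply: (va_tpow H HI).
have eP i : exists e, va i e (y + tpow d) /\ forall k, k <= M i -> ge i k y <-> k <= e.
  have [My|nMy] := pselect (ge i (M i) y); last first.
    have [|e ey] := @va_exists _ _ _ _ H _ _ _ _ HI i y; first by exists (M i).
    have eM : e + 1 <= M i.
      by rewrite lezD1 ltNge; apply/negP => Me; apply/nMy/(va_ge H HI _ ey).
    exists e; split=> [|k _]; last exact: (va_ge H HI).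
    by apply: (va_addr H HI) => //; apply/(va_ge H HI _ (vd i)); apply: le_trans (Md i).
  exists (M i); have [vM|nvM] := pselect (va i (M i) y).
    split=> [|k _]; last exact: (va_ge H HI).
    apply: (va_addr H HI) => //; apply/(va_ge H HI _ (vd i)).
    by rewrite /d; case: asboolP.
  split=> [|k kM]; last by split=> // _; apply: (ge_le H HI) My.
  have ed : d i = M i by rewrite /d; case: asboolP.
  rewrite addrC; apply: (va_addr H HI); first by rewrite -[M i]ed.
  by apply: contrapT => n; apply: nvM; split.
have [eta etaP] := choice eP.
exists eta => [|i k kM]; last by have [_] := etaP i; apply.
exists (y + tpow d) => [|i]; last by case: (etaP i).
by apply: submoduleD => //; apply: ME; apply: (tpow_dset H HI).
Qed.

End Generic.

(** * Duality by a canonical ideal *)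

Section CanonicalDuality.
Variable R : comNzRingType.
Local Notation Q := (total_frac R).
Local Notation emb := (@to_total R).
Local Notation R0 := (image_ring R).
Variables (x : R) (A : set Q) (N : nat).
Hypothesis H : normal_extension x A N.
Local Notation rx := (ne_lreg H).
Local Notation sA := (ne_subring H).
Local Notation AN := (ne_finite H).
Implicit Types (n : set Q).

Let emb_mem' r : A (emb r) := emb_mem H r.
Hint Resolve emb_mem' : core.

Variables (I : choiceType) (sI : seq I) (nn : I -> set Q) (tt : I -> Q).
Hypothesis HI : valuation_index A sI nn tt.
Implicit Types (i j : I) (k l : int) (y z w : Q) (alpha beta gam : I -> int) (E F : set Q).
Local Notation mI := (vi_max HI).
Local Notation uI := (vi_unit HI).
Local Notation gI := (vi_gen HI).
Local Notation ge i := (vge A (nn i) (tt i)).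
Local Notation va i := (vval A (nn i) (tt i)).

Local Notation dset := (dset A nn tt).
Local Notation tpow := (tpow sI tt).

Local Notation gset := (gset A nn tt).

(** Each coordinate attains its minimum at some element of [P]; the minimum of these finitely many
    elements is least. *)
Lemma least_element (P : set (I -> int)) beta : P !=set0 ->
  (forall a b, P a -> P b -> P (minf a b)) ->
  (forall a, P a -> forall i, beta i <= a i) ->
  exists2 c, P c & forall a, P a -> forall i, c i <= a i.
Proof.
move=> [a0 Pa0] Pmin Pbd.
have minP i : exists a, P a /\ forall b, P b -> a i <= b i.
  have ex : exists d, `[< exists2 a, P a & absz (a i - beta i) = d >].
    by exists (absz (a0 i - beta i)); apply/asboolP; exists a0.
  case: (ex_minnP ex) => d /asboolP[a Pa <-] dmin; exists a; split=> // b Pb.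
  have := dmin (absz (b i - beta i)) ltac:(by apply/asboolP; exists b).
  have := Pbd a Pa i; have := Pbd b Pb i; lia.
have [a aP] := choice minP.
suff [c Pc cs] : exists2 c, P c & forall i, i \in sI -> c i <= a i i.
  exists c => // b Pb i; apply: le_trans (cs i (vi_all HI i)) _.
  by have [_] := aP i; apply.
elim: sI => [|i s [c Pc cs]]; first by exists a0.
exists (minf c (a i)); first by apply: Pmin => //; case: (aP i).
move=> j; rewrite inE /minf => /predU1P[->|/cs js]; first by rewrite ge_min lexx orbT.
by rewrite ge_min js.
Qed.

(** The working form of a regular fractional ideal, see [regular_fractional_idealP]. *)
Definition bounded E := submodule E /\
  exists alpha beta, dset alpha `<=` E /\ E `<=` dset beta.

Lemma image_ring_bounded : bounded R0.
Proof.
split; first exact: image_ring_submodule.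
have ux := embX_unit rx N.
have [gam gP] := unit_va H HI ux.
exists gam, (fun=> 0); split; last first.
  by rewrite (dset0 H HI); apply: image_ring_sub H.
have := @dset_unit _ _ _ _ H _ _ _ _ HI _ gam (fun=> 0) ux gP.
have -> : (fun i => gam i + 0) = gam by apply/funext => i; rewrite addr0.
by move=> <- _ [a Da ->]; apply: AN; rewrite -(dset0 H HI).
Qed.

Lemma regular_fractional_idealP E : regular_fractional_ideal E <-> bounded E.
Proof.
have [_ [gam [b0 [gR Rb0]]]] := image_ring_bounded.
split=> [[[sE [r [Rr /lreg_unit ur] rE]] [y [Ey /lreg_unit uy]]]|[sE [alpha [beta [aE Eb]]]]].
  split=> //.
  have [a aP] := unit_va H HI uy; have [b bP] := unit_va H HI ur.
  exists (fun i => a i + gam i), (fun i => - b i + b0 i); split.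
    rewrite -(dset_unit H HI _ uy aP) => _ [z /gR[s _ <-] ->].
    by rewrite mulrC; apply: submoduleM.
  move=> z Ez; rewrite -[z](mulKr ur).
  have urV : r^-1 \is a GRing.unit by rewrite unitrV.
  have bV i : va i (- b i) r^-1 by apply: (vval_inv H (mI i) (uI i) (gI i)).
  rewrite -(dset_unit H HI _ urV bV).
  by exists (r * z) => //; apply/Rb0/rE.
split; first split=> //.
  pose d : I -> int := fun i => Num.max (gam i - beta i) (gam i).
  exists (tpow d).
    split; last exact/lreg_unit/(tpow_unit HI).
    by apply: gR; apply: (tpow_dset H HI) => i; rewrite /d le_max lexx orbT.
  move=> z /Eb Dz; apply: gR => i; apply/(ge_tpow H HI).
  by apply: (ge_le H HI) (Dz i); rewrite lerBlDr -lerBlDl le_max lexx.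
exists (tpow alpha); split; last exact/lreg_unit/(tpow_unit HI).
by apply: aE; apply: (tpow_dset H HI).
Qed.

Lemma dset_bounded alpha : bounded (dset alpha).
Proof. by split; [exact: (dset_submodule H HI)|exists alpha, alpha; split]. Qed.

Lemma bounded_between E F G : submodule E -> bounded F -> bounded G ->
  F `<=` E -> E `<=` G -> bounded E.
Proof.
move=> sE [_ [a [_ [aF _]]]] [_ [_ [b [_ Gb]]]] FE EG; split=> //.
by exists a, b; split; [exact: (subset_trans aF FE)|exact: (subset_trans EG Gb)].
Qed.

Lemma bounded_add E F : bounded E -> bounded F -> bounded (ideal_add E F).
Proof.
move=> [sE [a [b [aE Eb]]]] [sF [a' [b' [aF Fb]]]]; split; first exact: submodule_add.
exists a, (minf b b'); split.
  by apply: subset_trans aE _; apply: submodule_addl.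
apply: submodule_add_min; first exact: (dset_submodule H HI).
  by apply: subset_trans Eb _; apply: (dset_le H HI) => i; rewrite /minf ge_min lexx.
by apply: subset_trans Fb _; apply: (dset_le H HI) => i; rewrite /minf ge_min lexx orbT.
Qed.

Lemma dset_mul alpha beta y z : dset alpha y -> dset beta z ->
  dset (fun i => alpha i + beta i) (y * z).
Proof. by move=> Dy Dz i; apply: (geM H HI). Qed.

Lemma colon_submodule E F : submodule E -> submodule (colon E F).
Proof.
move=> sE; split.
- by move=> f _; rewrite mul0r; apply: submodule0.
- by move=> y z Ey Ez f Ff; rewrite mulrDl; apply: submoduleD => //; [apply: Ey|apply: Ez].
- by move=> r y Ey f Ff; rewrite -mulrA; apply: submoduleM => //; apply: Ey.
Qed.

Lemma colon_bounded E F : bounded E -> bounded F -> bounded (colon E F).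
Proof.
move=> [sE [a [b [aE Eb]]]] [sF [a' [b' [aF Fb]]]]; split; first exact: colon_submodule.
exists (fun i => a i - b' i), (fun i => b i - a' i); split.
  move=> y Dy f /Fb Df; apply: aE.
  by have := dset_mul Dy Df; apply: (dset_le H HI) => i; rewrite subrK.
move=> y Ey i; apply/(ge_tpow H HI).
by rewrite mulrC; apply: Eb; apply: Ey; apply: aF; apply: (tpow_dset H HI).
Qed.

Lemma colon_sub E F G : F `<=` G -> colon E G `<=` colon E F.
Proof. by move=> FG y Ey f Ff; apply/Ey/FG. Qed.

Lemma colon_add E F G : submodule E -> submodule F -> submodule G ->
  colon E (ideal_add F G) = colon E F `&` colon E G.
Proof.
move=> sE sF sG; apply/seteqP; split=> [y Ey|y [yF yG] _ [f [g [Ff Gg ->]]]].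
  by split; apply: colon_sub Ey; [exact: submodule_addl|exact: submodule_addr].
by rewrite mulrDr; apply: submoduleD => //; [apply: yF|apply: yG].
Qed.

(** Checked locally: at each [i] one of [alpha], [beta] attains the minimum, and an element of [A]
    of value 0 at [i] moves [y] into the corresponding set. *)
Lemma dset_minf alpha beta E : submodule E -> dset alpha `<=` E -> dset beta `<=` E ->
  dset (minf alpha beta) `<=` E.
Proof.
move=> sE aE bE y Dy.
pose L : set Q := [set s | A s /\ ideal_add (dset alpha) (dset beta) (s * y)].
have sab := submodule_add (dset_submodule H HI alpha) (dset_submodule H HI beta).
have [sa sb] := (dset_submodule H HI alpha, dset_submodule H HI beta).
have iL : ideal A L.
  split; first by move=> s [].
  - by split; rewrite ?mul0r; [exact: (subring0 sA)|exact: submodule0].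
  - move=> s s' [As sy] [As' sy']; split; first exact: (subringD sA).
    by rewrite mulrDl; apply: submoduleD.
  - move=> a s Aa [As [f [g [Df Dg e]]]]; split; first exact: (subringM sA).
    exists (a * f), (a * g); split; [exact: (dset_AM H HI)|exact: (dset_AM H HI)|].
    by rewrite -mulrA e mulrDr.
have [_] : L 1; last first.
  rewrite mul1r => -[f [g [Df Dg ->]]].
  by apply: submoduleD => //; [exact: aE|exact: bE].
apply: (ideal_full H iL) => n mn Ln.
have [i ei] := vi_surj HI mn; subst n.
have key a : dset a `<=` ideal_add (dset alpha) (dset beta) ->
    (forall j, minf alpha beta j <= a j) -> minf alpha beta i <> a i.
  move=> aab ma mai.
  pose d j : int := a j - minf alpha beta j.
  have Ad : A (tpow d).
    by rewrite -(dset0 H HI); apply: (tpow_dset H HI) => j; rewrite subr_ge0.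
  have /(va0P H HI) : va i 0 (tpow d).
    by have := va_tpow H HI i d; rewrite /d mai subrr.
  apply=> //; apply: Ln; split=> //; apply: aab => j; apply/(ge_tpow H HI).
  by rewrite /d opprB addrC subrK; apply: Dy.
have [ab|/ltW ba] := leP (alpha i) (beta i).
  apply: (key alpha); first exact: submodule_addl.
    by move=> j; rewrite /minf ge_min lexx.
  by rewrite /minf min_l.
apply: (key beta); first exact: submodule_addr.
  by move=> j; rewrite /minf ge_min lexx orbT.
by rewrite /minf min_r.
Qed.

Lemma dset_succ alpha i z y : dset alpha z -> va i (alpha i) y -> dset alpha y ->
  exists r, dset (fun j => alpha j + (j == i)%:Z) (z - emb r * y).
Proof.
move=> Dz vy Dy; have [r rP] := leading_coef H HI vy (Dz i); exists r => j.
case: eqVneq => [->//|_]; rewrite addr0; apply: (geB H HI) => //.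
by apply: (ge_embM H HI).
Qed.

Section Canonical.
Variable K : set Q.
Hypothesis bK : bounded K.
Hypothesis Kcan : forall E, bounded E -> E = colon K (colon K E).
Let sK : submodule K := proj1 bK.

Lemma conductor_exists : exists2 c, dset c `<=` K &
  forall a, dset a `<=` K -> forall i, c i <= a i.
Proof.
have [_ [a [b [aK Kb]]]] := bK.
apply: (@least_element [set a | dset a `<=` K] b).
- by exists a.
- by move=> a1 a2; apply: dset_minf.
- move=> a1 a1K i; apply/(va_ge H HI _ (va_tpow H HI i a1)).
  by apply: Kb; apply: a1K; apply: (tpow_dset H HI).
Qed.

Variable c : I -> int.
Hypothesis cK : dset c `<=` K.
Hypothesis cmin : forall a, dset a `<=` K -> forall i, c i <= a i.

(** By [dset_succ], such a [y] together with [dset c] would generate all of [dset (c - e_i)] inside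
    [K], against the minimality of [c]. *)
Lemma conductor_gap i y : K y -> va i (c i - 1) y ->
  (forall j, j != i -> ge j (c j) y) -> False.
Proof.
move=> Ky vy gy; pose a j : int := c j - (j == i)%:Z.
have ai : a i = c i - 1 by rewrite /a eqxx.
have Dy : dset a y.
  move=> j; rewrite /a; case: eqVneq => [->|/gy]; first by case: vy.
  by rewrite subr0.
have : c i <= a i.
  apply: cmin => z Dz.
  have [|r] := dset_succ (i := i) Dz _ Dy; first by rewrite ai.
  rewrite (_ : (fun j => _) = c) => [Dc|]; last by apply/funext => j; rewrite /a subrK.
  rewrite -(subrK (emb r * y) z); apply: submoduleD => //; first exact: cK.
  exact: submoduleM.
by rewrite ai; lia.
Qed.

(** If [y] had value [k < c i - beta i] at [i], multiplying it by an element of [dset beta] of value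
    [c i - 1 - k] at [i] and large value elsewhere would contradict [conductor_gap]. *)
Lemma colon_dset beta : colon K (dset beta) = dset (fun i => c i - beta i).
Proof.
apply/seteqP; split=> [y Ky|y Dy f Df]; last first.
  by apply: cK; have := dset_mul Dy Df; apply: (dset_le H HI) => i; rewrite subrK.
move=> i; apply: contrapT => nge.
have [|k ky] := @va_exists _ _ _ _ H _ _ _ _ HI i y; first by exists (c i - beta i).
have kc : k < c i - beta i.
  by rewrite ltNge; apply/negP => ck; apply/nge/(va_ge H HI _ ky).
have [b Db] := dset_exists H HI y.
pose d j : int := if j == i then c i - 1 - k else Num.max (beta j) (c j - b j).
have bd j : beta j <= d j.
  by rewrite /d; case: eqP => [->|_]; [lia|rewrite le_max lexx].
apply: (@conductor_gap i (y * tpow d)).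
- by apply: Ky; apply: (tpow_dset H HI).
- rewrite mulrC; apply/(va_tpowM H HI); rewrite /d eqxx.
  by rewrite (_ : _ - _ = k) //; ring.
- move=> j ji; rewrite mulrC; apply/(ge_tpow H HI).
  apply: (ge_le H HI) (Db j); rewrite /d (negbTE ji).
  by rewrite lerBlDr -lerBlDl le_max lexx orbT.
Qed.

(* Modular law: if K : F has no element of exact value alpha at i, dualizing    *)
(* shows that F + D(c - alpha) contains D(c - alpha - e_i).                     *)
Lemma colon_dual_value F i alpha : bounded F ->
  ~ (exists y, [/\ F y, va i (c i - 1 - alpha i) y &
      forall j, j != i -> ge j (c j - alpha j) y]) ->
  exists z, [/\ colon K F z, dset alpha z & va i (alpha i) z].
Proof.
move=> bF nF; apply: contrapT => nz; apply: nF.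
have [sF _] := bF.
pose a j : int := c j - alpha j; pose a' j : int := a j - (j == i)%:Z.
have aa' j : a' j <= a j by rewrite /a' lerBlDr lerDl; case: eqP.
have colonE d : colon K (ideal_add F (dset d)) = colon K F `&` dset (fun j => c j - d j).
  by rewrite (colon_add sK sF (dset_submodule H HI d)) colon_dset.
have sub : colon K (ideal_add F (dset a)) `<=` colon K (ideal_add F (dset a')).
  rewrite !colonE => z [Fz Dz]; split=> // j; rewrite /a' /a; case: eqVneq => [->|_].
    apply: contrapT => n; apply: nz; exists z; split=> //.
      by move=> k; have := Dz k; rewrite /a subKr.
    split; first by have := Dz i; rewrite /a subKr.
    move=> E; apply: n; suff -> : c i - (c i - alpha i - true%:Z) = alpha i + 1 by []; rewrite /=; ring.
  by rewrite subr0; apply: Dz.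
have Fa : ideal_add F (dset a') `<=` ideal_add F (dset a).
  rewrite (Kcan (bounded_add bF (dset_bounded a'))) (Kcan (bounded_add bF (dset_bounded a))).
  exact: colon_sub.
have [f [d [Ff Dd e]]] : ideal_add F (dset a) (tpow a').
  by apply: Fa; apply: submodule_addr => //; apply: (tpow_dset H HI).
have -> : c i - 1 - alpha i = a' i by rewrite /a' /a eqxx /=; ring.
have ef : f = tpow a' - d by rewrite e addrK.
exists f; split=> // [|j ji].
  rewrite ef; apply: (va_addr H HI); first exact: (va_tpow H HI).
  rewrite -[- d]mulN1r -(rmorphN1 emb); apply: (ge_embM H HI).
  by have := Dd i; rewrite /a' eqxx subrK.
have a'j : a' j = a j by rewrite /a' (negbTE ji) subr0.
rewrite ef; apply: (geB H HI); last exact: Dd.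
by rewrite -[c j - _]a'j; apply: (tpow_dset H HI).
Qed.

(** Products give one inclusion. For the other, [generic_element] and [colon_dual_value] leave an
    element of [F] to be excluded; once truncated, its value plus [alpha] is a value of [K] in the
    gap. *)
Lemma gset_colon F : bounded F -> gset (colon K F) = vcolon (gset K) (gset F).
Proof.
move=> bF; have [sF [f [f' [fF Ff']]]] := bF.
apply/seteqP; split=> [alpha [y Ky ya] beta [z Fz zb]|alpha Ka].
  by exists (y * z) => [|i]; [exact: Ky|exact: (vaM H HI)].
apply: (generic_element H HI (colon_submodule F sK)) => i.
apply: colon_dual_value => // -[y [Fy vy gy]].
(* The bound [f] keeps [dset M] inside [F]; the bounds from [c - alpha] make truncation faithful at
   the thresholds compared below. *)
pose M j : int := Num.max (f j) (Num.max (c j - alpha j) (c i - alpha i)).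
have [|eta [w Fw we] etaP] := gset_truncate H HI (M := M) sF _ Fy.
  by apply: subset_trans fF; apply: (dset_le H HI) => j; rewrite /M le_max lexx.
have [k Kk kv] := Ka eta (ex_intro2 _ _ w Fw we).
have Mc j : c j - alpha j <= M j by rewrite /M !le_max lexx orbT.
have ei : eta i = c i - 1 - alpha i.
  have [gi ngi] := vy.
  have le1 : c i - 1 - alpha i <= eta i by apply/etaP => //; have := Mc i; lia.
  have : ~ (c i - alpha i <= eta i).
    by move=> /etaP-/(_ (Mc i)) E; apply: ngi; rewrite (_ : c i - 1 - alpha i + 1 = c i - alpha i) //; ring.
  by move: le1; lia.
apply: (conductor_gap (i := i) Kk) => [|j ji].
  have := kv i; rewrite fctE ei (_ : alpha i + (c i - 1 - alpha i) = c i - 1) //; ring.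
apply/(va_ge H HI _ (kv j)); rewrite fctE.
have : c j - alpha j <= eta j by apply/etaP => //; apply: gy.
lia.
Qed.

End Canonical.
End CanonicalDuality.

(** * Distance and length *)

Section Distance.
Variable R : comNzRingType.
Local Notation Q := (total_frac R).
Local Notation emb := (@to_total R).
Local Notation R0 := (image_ring R).
Variables (x : R) (A : set Q) (N : nat).
Hypothesis H : normal_extension x A N.
Local Notation xq := (emb x).
Local Notation HN := (ne_noetherian H).
Local Notation Hdim := (ne_dim H).
Local Notation Jx := (ne_jacobson H).
Local Notation rx := (ne_lreg H).
Local Notation sA := (ne_subring H).
Local Notation AN := (ne_finite H).

Let emb_mem' r : A (emb r) := emb_mem H r.
Hint Resolve emb_mem' : core.

Variables (I : choiceType) (sI : seq I) (nn : I -> set Q) (tt : I -> Q).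
Hypothesis HI : valuation_index A sI nn tt.
Implicit Types (i j : I) (y z w : Q) (alpha beta gam : I -> int) (E F : set Q).
Local Notation ge i := (vge A (nn i) (tt i)).
Local Notation va i := (vval A (nn i) (tt i)).

Local Notation dset := (dset A nn tt).
Local Notation tpow := (tpow sI tt).

Local Notation gset := (gset A nn tt).

Local Notation bounded := (bounded A nn tt).

Section OneModule.
Variable E : set Q.
Hypothesis bE : bounded E.
Let sE : submodule E := proj1 bE.
Local Notation filt alpha := (E `&` dset alpha).

Lemma filt_submodule alpha : submodule (filt alpha).
Proof. exact: (submodule_setI sE (dset_submodule H HI alpha)). Qed.

Lemma gset_ge alpha y : (forall i, va i (alpha i) y) -> dset alpha y.
Proof. by move=> ya i; case: (ya i). Qed.

Lemma bounded_below (beta : I -> int) :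
  exists2 M : I -> int, dset M `<=` E & forall i, beta i <= M i.
Proof.
have [_ [a [_ [aE _]]]] := bE; exists (fun i => Num.max (a i) (beta i)) => [|i].
  by apply: subset_trans aE; apply: (dset_le H HI) => i; rewrite le_max lexx.
by rewrite le_max lexx orbT.
Qed.

Lemma lt_funP (alpha beta : I -> int) : (alpha < beta)%O <->
  (forall i, alpha i <= beta i) /\ exists i, alpha i < beta i.
Proof.
rewrite lt_neqAle; split=> [/andP[/eqP ne /lefP le]|[le [i lt]]].
  split=> //; apply: contrapT => nlt; apply: ne; apply/funext => i.
  apply/eqP; rewrite eq_le le leNgt; apply/negP => lt; apply: nlt; by exists i.
apply/andP; split; last exact/lefP.
by apply/eqP => e; move: lt; rewrite e ltxx.
Qed.

(** If [i] is an index with [alpha i < beta i], an element of [E] of value at least [alpha] and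
    above [alpha i] at [i] lies in [dset beta]: otherwise the minimum of its truncated value and
    [beta] would lie strictly between. Hence one leading coefficient at [i] describes the quotient,
    which is simple by [leading_coef]. *)
Lemma consecutive_len alpha beta : gset E alpha -> gset E beta -> (alpha < beta)%O ->
  ~ (exists2 delta, gset E delta & (alpha < delta < beta)%O) ->
  len (filt beta) (filt alpha) 1.
Proof.
move=> Ga Gb /lt_funP[ab [i lti]] ncons.
have jump y : E y -> dset alpha y -> ge i (alpha i + 1) y -> dset beta y.
  move=> Ey Dy gy.
  have [M ME Mb] := bounded_below beta.
  have [eta Ge etaP] := gset_truncate H HI sE ME Ey.
  have ae j : alpha j <= eta j.
    by apply/etaP; [exact: le_trans (ab j) (Mb j)|exact: Dy].
  have aei : alpha i < eta i.
    by rewrite -lezD1; apply/etaP => //; apply: le_trans (Mb i); rewrite lezD1.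
  have Gm := gset_min H HI sE Ge Gb.
  have am : (alpha < minf eta beta)%O.
    apply/lt_funP; split=> [j|]; first by rewrite /minf le_min ae ab.
    by exists i; rewrite /minf lt_min aei.
  have bm : beta = minf eta beta.
    apply: contrapT => ne; apply: ncons; exists (minf eta beta) => //; rewrite am /=.
    rewrite lt_neqAle; apply/andP; split; first by apply/eqP => e; apply: ne.
    by apply/lefP => j; rewrite /minf ge_min lexx orbT.
  move=> j; apply/etaP; first exact: Mb.
  by rewrite {1}bm /minf ge_min lexx.
have [w Ew wa] := Ga; have Dw := gset_ge wa.
apply: len1.
- exact: filt_submodule.
- exact: filt_submodule.
- split=> [y [Ey Dy]|sub]; first by split=> //; apply: (dset_le H HI) Dy.
  have [_ Dbw] : filt beta w by apply: sub.
  have [_ nw] := wa i; apply: nw; apply: (ge_le H HI) (Dbw i).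
  by rewrite lezD1.
move=> C sC bC Ca; have [Cb|nCb] := pselect (C `<=` filt beta).
  by left; apply/seteqP.
right; apply/seteqP; split=> // z [Ez Dz].
have [v [Cv nv]] : exists v, C v /\ ~ filt beta v.
  by apply: contrapT => n; apply: nCb => v Cv; apply: contrapT => nv; apply: n; exists v.
have [Ev Dv] := Ca v Cv.
have vi : va i (alpha i) v.
  split; first exact: Dv.
  by move=> gv; apply: nv; split=> //; apply: jump.
have [r rP] := leading_coef H HI vi (Dz i).
rewrite -(subrK (emb r * v) z); apply: submoduleD => //; last exact: submoduleM.
have Ezv : E (z - emb r * v) by apply: submoduleB => //; apply: submoduleM.
apply: bC; split=> //; apply: jump => //.
by move=> j; apply: (geB H HI) => //; apply: (ge_embM H HI).
Qed.

Lemma saturated_len alpha beta (n : nat) c : saturated_chain (gset E) alpha beta n c ->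
  len (filt beta) (filt alpha) n.
Proof.
move=> [<- <- cE cS].
suff : forall k, (k <= n)%N -> len (filt (c k)) (filt (c 0%N)) k by apply.
elim=> [_|k IHk kn].
  by split; [apply/chain0/filt_submodule|exact: blen0].
have [lt ncons] := cS k kn.
rewrite -add1n; apply: len_add (IHk (ltnW kn)).
by apply: consecutive_len => //; apply: cE => //; apply: ltnW.
Qed.

(** Among the elements above [alpha] and up to [beta], one nearest to [alpha] for the distance [h]
    is a direct successor; induction on [h]. *)
Lemma saturated_exists alpha beta : gset E alpha -> gset E beta -> (alpha <= beta)%O ->
  exists (n : nat) c, saturated_chain (gset E) alpha beta n c.
Proof.
pose h (a b : I -> int) := (\sum_(i <- sI) absz (b i - a i)%R)%N.
have hlt (a a' b : I -> int) : (a < a')%O -> (a' <= b)%O -> (h a' b < h a b)%N.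
  move=> /lt_funP[le [i lt]] /lefP le'.
  rewrite /h !(big_rem i (vi_all HI i)) /=.
  have := lt; have := le' i; set S := (\sum_(j <- _) _)%N; set S' := (\sum_(j <- _) _)%N.
  have : (S <= S')%N.
    by apply: leq_sum => j _; have := le j; have := le' j; lia.
  by lia.
have hlt' (a b b' : I -> int) : (a <= b)%O -> (b < b')%O -> (h a b < h a b')%N.
  move=> /lefP le' /lt_funP[le [i lt]].
  rewrite /h !(big_rem i (vi_all HI i)) /=.
  have := lt; have := le' i; set S := (\sum_(j <- _) _)%N; set S' := (\sum_(j <- _) _)%N.
  have : (S <= S')%N.
    by apply: leq_sum => j _; have := le j; have := le' j; lia.
  by lia.
have [m] := ubnP (h alpha beta); elim: m alpha => // m IHm alpha hm Ga Gb ab.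
have [e|ne] := pselect (alpha = beta).
  by exists 0%N, (fun=> alpha); split.
have ltab : (alpha < beta)%O by rewrite lt_neqAle ab andbT; apply/eqP.
have ex : exists d, `[< exists2 a, gset E a & [/\ (alpha < a)%O, (a <= beta)%O & h alpha a = d] >].
  by exists (h alpha beta); apply/asboolP; exists beta.
case: (ex_minnP ex) => d /asboolP[a Ea [la ab' hd]] dmin.
have [|n [c [c0 cn cE cS]]] := IHm a _ Ea Gb ab'.
  by have := hlt _ _ _ la ab'; lia.
exists n.+1, (fun k => if k is k'.+1 then c k' else alpha); split=> //.
  by case.
case=> [_|k kn]; last exact: cS.
rewrite c0; split=> // -[delta Gd /andP[d1 d2]].
have : (d <= h alpha delta)%N.
  apply: dmin; apply/asboolP; exists delta => //; split=> //.
  by apply: le_trans (ltW d2) ab'.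
by have := hlt' _ _ _ (ltW d1) d2; lia.
Qed.

Lemma chain_lengthP alpha beta : gset E alpha -> gset E beta -> (alpha <= beta)%O ->
  len (filt beta) (filt alpha) (chain_length (gset E) alpha beta).
Proof.
move=> Ga Gb ab; have [n [c sc]] := saturated_exists Ga Gb ab.
rewrite (_ : chain_length _ _ _ = n); first exact: saturated_len sc.
apply: xget_unique; first by exists c.
by move=> m [c' sc']; apply: (len_uniq (saturated_len sc') (saturated_len sc)).
Qed.

Lemma least_ofE (P : set (I -> int)) c : P c -> (forall a, P a -> forall i, c i <= a i) ->
  least_of (fun=> 0) P = c.
Proof.
move=> Pc cmin; apply: xget_unique.
  by split=> // a Pa; apply/lefP; apply: cmin.
move=> c' [Pc' c'min]; apply/eqP; rewrite eq_le c'min //=.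
by apply/lefP; apply: cmin.
Qed.

Lemma mu_ofP : gset E (mu_of (gset E)) /\ (forall a, gset E a -> (mu_of (gset E) <= a)%O)
  /\ filt (mu_of (gset E)) = E.
Proof.
have [_ [a0 [b0 [aE Eb]]]] := bE.
have [|||mu Gmu mumin] := least_element HI (P := gset E) (beta := b0).
- by exists a0; apply: (gset_tpow H HI aE).
- by move=> a b; apply: (gset_min H HI sE).
- by move=> a [y Ey ya] i; apply/(va_ge H HI _ (ya i)); apply: Eb.
rewrite /mu_of (least_ofE Gmu mumin); split=> //; split=> [a Ga|]; first exact/lefP/mumin.
apply/setIidPl => y Ey i; have [M ME Mb] := bounded_below mu.
have [eta Ge etaP] := gset_truncate H HI sE ME Ey.
by apply/etaP => //; apply: mumin.
Qed.

(** Starting from some [dset M] inside [E], lower one coordinate at a time: an element of [E] of the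
    new value and [dset_succ] supply what is added. This identifies [gamma_of] with a conductor. *)
Lemma vcolon_cone alpha : vcolon (gset E) (@natural_cone I) alpha <-> dset alpha `<=` E.
Proof.
split=> [Ga|aE beta b0]; last first.
  by apply: (gset_tpow H HI aE) => i; rewrite fctE lerDl.
have [M ME Ma] := bounded_below alpha.
suff Hm m (beta : I -> int) : (forall i, alpha i <= beta i <= M i) ->
    (\sum_(i <- sI) absz (M i - beta i)%R < m)%N -> dset beta `<=` E.
  by apply: (Hm _ alpha _ (leqnn _)) => i; rewrite lexx Ma.
elim: m beta => // m IHm beta bP hm.
have [e|ne] := pselect (M = beta); first by rewrite -e.
have [i bi] : exists i, beta i < M i.
  apply: contrapT => n; apply: ne; apply/funext => i; apply/eqP; rewrite eq_le.
  have /andP[_ ->] := bP i; rewrite andbT leNgt; apply/negP => lt; apply: n; by exists i.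
have [y Ey yb] : gset E beta.
  have -> : beta = alpha + (fun i => beta i - alpha i).
    by apply/funext => j; rewrite fctE addrC subrK.
  by apply: Ga => j; rewrite subr_ge0; have /andP[] := bP j.
move=> z Dz; have [r rP] := dset_succ H HI Dz (yb i) (gset_ge yb).
rewrite -(subrK (emb r * y) z); apply: submoduleD => //; last exact: submoduleM.
apply: IHm rP => [j|].
  have /andP[b1 b2] := bP j; case: eqVneq => [e|_]; last by rewrite addr0 b1 b2.
  by rewrite e in b1 *; rewrite lezD1 bi andbT; apply: le_trans b1 _; rewrite lerDl.
rewrite ltnS in hm; apply: leq_trans hm.
rewrite !(big_rem i (vi_all HI i)) /= eqxx.
have : (\sum_(j <- rem i sI) absz (M j - (beta j + (j == i)%:Z))%R <=
  \sum_(j <- rem i sI) absz (M j - beta j)%R)%N.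
  apply: leq_sum => j _; case: eqVneq => [->|_]; last by rewrite addr0.
  by move: bi => /=; lia.
by move: bi => /=; lia.
Qed.

Lemma gamma_ofP : dset (gamma_of (gset E)) `<=` E.
Proof.
have [_ [a0 [b0 [aE Eb]]]] := bE.
have [|||g Gg gmin] := least_element HI (P := vcolon (gset E) (@natural_cone I)) (beta := b0).
- by exists a0; apply/vcolon_cone.
- by move=> a b /vcolon_cone aE' /vcolon_cone bE'; apply/vcolon_cone; apply: (dset_minf H HI).
- move=> a /vcolon_cone aE' i; apply/(va_ge H HI _ (va_tpow H HI i a)).
  by apply/Eb/aE'/(tpow_dset H HI).
by rewrite /gamma_of (least_ofE Gg gmin); apply/vcolon_cone.
Qed.

End OneModule.

Lemma bounded_blen E F : bounded E -> bounded F -> exists n, blen E F n.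
Proof.
move=> [sE [a [_ [aE _]]]] [sF [_ [b [_ Fb]]]].
have [j [r er]] := total_pow_frac HN Hdim Jx (tpow b).
have [l [s es]] := total_pow_frac HN Hdim Jx (tpow a)^-1.
have FR : scale (xq ^+ (N + j)) F `<=` R0.
  move=> _ [y /Fb Dy ->]; move: Dy; rewrite (dset_scale H HI) => -[w Aw ->].
  have -> : xq ^+ (N + j) * (tpow b * w) = xq ^+ N * (emb r * w).
    by rewrite -er exprD; ring.
  by apply: AN; apply: (subringM sA).
have RE : scale (xq ^+ l) R0 `<=` E.
  move=> _ [_ [w _ <-] ->]; apply: aE; rewrite (dset_scale H HI).
  exists (emb s * emb w); first exact: (subringM sA).
  by rewrite -es mulrA (mulrCA (tpow a)) mulrV ?mulr1 // (tpow_unit HI).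
have rxk : GRing.lreg (x ^+ (N + j + l)) by apply/lregX/rx.
have [n bn] := finite_length HN Hdim rxk; exists n => k ck.
have sR := image_ring_submodule R.
rewrite rmorphXn /= in bn.
apply: (blen_sub (submodule_scale _ sR) sR _ FR bn (chain_scale (embX_unit rx (N + j)) ck)).
rewrite (exprD _ (N + j) l) -scale_scale; exact: scale_sub.
Qed.

(** With [g] the conductor of [E], the two chain lengths are those of [F / dset g] and
    [E / dset g]. *)
Lemma distance_len E F p : bounded E -> bounded F -> len E F p ->
  distance (gset F) (gset E) = p%:Z.
Proof.
move=> bE bF lEF; have [_ _ EF] := chainP lEF.1.
set g := gamma_of (gset E).
have gE := gamma_ofP bE; rewrite -/g in gE.
have gF := subset_trans gE EF.
have [muE [muEmin fE]] := mu_ofP bE; have [muF [muFmin fF]] := mu_ofP bF.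
have GE : gset E g by apply: (gset_tpow H HI gE).
have GF : gset F g by apply: (gset_tpow H HI gF).
have lE := chain_lengthP bE muE GE (muEmin _ GE).
have lF := chain_lengthP bF muF GF (muFmin _ GF).
rewrite fE (setIidr gE) in lE; rewrite fF (setIidr gF) in lF.
have := len_uniq (len_add lE lEF) lF; rewrite /distance -/g => <-.
by rewrite PoszD addrC addKr.
Qed.

(** By biduality [K : -] is injective and reverses strict chains, so [F / E] and [(K : E) / (K : F)]
    have equal length. *)
Lemma distance_dual K E F : bounded K -> (forall G, bounded G -> G = colon K (colon K G)) ->
  bounded E -> bounded F -> E `<=` F ->
  distance (gset (colon K E)) (gset (colon K F)) = distance (gset F) (gset E).
Proof.
move=> bK Kcan bE bF EF; have [sK _] := bK; have [sE _] := bE; have [sF _] := bF.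
have [n bn] := bounded_blen bE bF.
have [p lp] := len_exists sE sF EF bn.
have [bKE bKF] := (colon_bounded H HI bK bE, colon_bounded H HI bK bF).
have strict G G' : bounded G -> bounded G' -> G `<` G' -> colon K G' `<` colon K G.
  move=> bG bG' [GG' nG]; split; first exact: colon_sub.
  move=> sub; apply: nG; rewrite (Kcan G bG) (Kcan G' bG'); exact: colon_sub.
have dual C D k : bounded C -> bounded D -> chain C D k -> chain (colon K D) (colon K C) k.
  move=> bC bD; apply: chain_rev => [G _ _ _|G G' sG sG' CG GG' G'D].
    exact: colon_submodule.
  have [sGG' _] := GG'.
  apply: strict => //.
    exact: (bounded_between sG bC bD CG (subset_trans sGG' G'D)).
  exact: (bounded_between sG' bC bD (subset_trans CG sGG') G'D).
rewrite (distance_len bE bF lp); apply: distance_len => //.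
have [cp bp] := lp; split; first exact: dual.
by move=> k ck; apply: bp; rewrite (Kcan E bE) (Kcan F bF); apply: dual.
Qed.

End Distance.

(** * Admissible rings *)

Lemma admissible_normal_extension (R : comNzRingType) : admissible R ->
  exists x N, normal_extension x (integral_closure R) N.
Proof.
move=> [[HN Hdim Hdepth] Hsemi Hred Hres _].
have red := reduced_of_analytically_reduced HN Hred.
have [x Jx rx] := exists_regular_jacobson HN Hsemi red Hdepth.
have [N NP] := integral_closure_finite HN Hdim Jx rx Hred.
exists x, N; split=> //.
- split=> [|y z /set_mem Ay /set_mem Az|y z /set_mem Ay /set_mem Az]; apply/mem_set.
  + rewrite -(rmorph1 (@to_total R)); exact: integral_closure_emb.
  + exact: integral_closureB.
  + exact: integral_closureM.
- exact: integral_closure_emb.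
- by move=> w k wk; apply/integral_closureP; exists k.
Qed.

(** Valuation rings correspond to maximal ideals of the closure, finite in number; the residues come
    from [large_residue_separation]. *)
Lemma admissible_valuation_index (R : comNzRingType) (x : R) N : admissible R ->
  normal_extension x (integral_closure R) N ->
  exists sI (nn : set_type (valuation_rings R) -> set (total_frac R)) tt,
    valuation_index (integral_closure R) sI nn tt /\
    forall i, set_val i = vring (integral_closure R) (nn i).
Proof.
set A := integral_closure R => Radm H.
have [_ _ Hred _ Hlarge] := Radm.
have red := reduced_of_analytically_reduced (ne_noetherian H) Hred.
have Aint w : A w -> exists k, powers_span w k (w ^+ k) by move=> /integral_closureP.
have [s sP] := integral_maximal_seq H.
have nnex (i : set_type (valuation_rings R)) :
    exists n, maximal_ideal A n /\ set_val i = vring A n.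
  by have [n mn e] := valuation_ring_vring H Aint (set_valP i); exists n.
have [nn nnP] := choice nnex.
have ttex (i : set_type (valuation_rings R)) :
    exists t, t \is a GRing.unit /\ nn i = scale t A.
  by have [t ut nt] := maximal_principal H (nnP i).1; exists t.
have [tt ttP] := choice ttex.
have Vn n : maximal_ideal A n -> exists i : set_type (valuation_rings R), set_val i = vring A n.
  move=> mn; have [t ut nt] := maximal_principal H mn.
  have Vmem := mem_set (vring_valuation_ring H mn ut nt).
  by exists (exist (fun W => W \in valuation_rings R) (vring A n) Vmem).
have nninj : injective nn.
  move=> i j e; apply: val_inj; have ei := (nnP i).2.
  by rewrite e -(nnP j).2 in ei; exact: ei.
pose sI : seq (set_type (valuation_rings R)) := pmap insub [seq vring A n | n <- s].
exists (undup sI), nn, tt; split=> [|i]; last exact: (nnP i).2.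
split.
- exact: undup_uniq.
- move=> i; rewrite mem_undup mem_pmap_sub.
  by apply/mapP; exists (nn i); [apply/sP; exact: (nnP i).1|exact: (nnP i).2].
- by move=> i; exact: (nnP i).1.
- exact: nninj.
- move=> n mn; have [i ei] := Vn n mn; exists i.
  by apply: (vring_inj H) => //; [exact: (nnP i).1|rewrite -(nnP i).2].
- by move=> i; exact: (ttP i).1.
- by move=> i; exact: (ttP i).2.
- move=> m mm; have [g gP] := large_residue_separation H red Hlarge mm.
  exists (fun i => g (nn i)) => i j im jm gij; apply: nninj.
  by apply: gP gij => //; [exact: (nnP i).1|exact: (nnP j).1].
Qed.

(** Regular elements of [Q] are its units, which are the elements all of whose values are finite. *)
Lemma value_setE (R : comNzRingType) (x : R) A N sI
    (nn : set_type (valuation_rings R) -> set (total_frac R)) tt (E : set (total_frac R)) :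
  normal_extension x A N -> valuation_index A sI nn tt ->
  (forall i, set_val i = vring A (nn i)) ->
  value_set E = gset A nn tt E.
Proof.
move=> H HI HV.
have val i k y : vval A (nn i) (tt i) k y -> valuation (set_val i) y = (k%:E)%E.
  move=> ky; rewrite HV.
  exact: (valuation_vring H (vi_max HI i) (vi_unit HI i) (vi_gen HI i) ky).
apply/seteqP; split=> [alpha [y [Ey /lreg_unit uy] ya]|alpha [y Ey ya]].
  exists y => // i; have [beta bP] := unit_va H HI uy.
  by have := ya i; rewrite (val _ _ _ (bP i)) => -[<-].
exists y; first by split=> //; apply/lreg_unit; apply: (va_unit H HI ya).
by move=> V; apply: val.
Qed.

Theorem theorem5p3p4 (R : comNzRingType) (K : set (total_frac R))
    (Radm : admissible R) (Kcan : canonical_ideal K) :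
  (forall F : set (total_frac R), regular_fractional_ideal F ->
     value_set (colon K F) =
     vcolon (value_set K) (value_set F)) /\
  (forall E F : set (total_frac R),
     regular_fractional_ideal E -> regular_fractional_ideal F -> E `<=` F ->
     distance (vcolon (value_set K) (value_set E))
              (vcolon (value_set K) (value_set F)) =
     distance (value_set F) (value_set E)).
Proof.
have [x [N H]] := admissible_normal_extension Radm.
have [sI [nn [tt [HI HV]]]] := admissible_valuation_index Radm H.
have vE E := value_setE E H HI HV.
have bP E := regular_fractional_idealP H HI E.
have [/bP bK Kdual] := Kcan.
have dual E : bounded (integral_closure R) nn tt E -> E = colon K (colon K E).
  by move=> /bP; apply: Kdual.
have [c cK cmin] := conductor_exists H HI bK.
have partA F : bounded (integral_closure R) nn tt F ->
    value_set (colon K F) = vcolon (value_set K) (value_set F).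
  by move=> bF; rewrite !vE; apply: (gset_colon H HI bK dual cK cmin bF).
split=> [F /bP|E F /bP bE /bP bF EF]; first exact: partA.
(* By (a) both differences are value sets of colon ideals. *)
by rewrite -!partA // !vE; apply: (distance_dual H HI).
Qed.
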